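(* Let the setting be as in the context. Assume that: (i) $V^*=(v_0^*,\dots,v_k^* )^T\in B^*(R)$ satisfies $L_i(V^* )=0$ in $\Omega$ for $i=0,\dots,k$; (ii) $a^*$ is the function $a[V^*]$; (iii) there are vector functions $G\in B(R)$, $G^*\in B^*(R)$ with $\|G-G^*\|_{H^{m_n}_{k+1}(\Omega)}<\sigma$, where $\sigma\in(0,1)$ is a sufficiently small number (the noise level). Let $Q(V^* )=V^*-G^*$, let $I_{\lambda,\alpha}(W)=J_{\lambda,\alpha}(W+G)$ for $W\in\overline{B_0(2R)}$, and let $\lambda_2$ be the number described in the context. For any $\lambda\ge\lambda_2$ let $W_{\min,\lambda}\in\overline{B_0(2R)}$ be the unique minimizer of $I_{\lambda,\alpha}$ on $\overline{B_0(2R)}$, and let $a_{\mathrm{comp,min},\lambda}=a[W_{\min,\lambda}+G]$. Then there is a number $C_1=C_1(R,\alpha,h,k)>0$, depending only on the listed parameters, such that for all $\lambda\ge\lambda_2$ $$\|W_{\min,\lambda}-Q(V^* )\|_{H^2_{k+1}(\Omega)}\le C_1\sqrt\lambda\sqrt\sigma\, e^{\lambda(B^2-A^2)}+C_1\sqrt{\lambda\alpha}\,e^{-\lambda(A^2-c)},$$ $$\|a_{\mathrm{comp,min},\lambda}-a^*\|_{L_2(\Omega)}\le C_1\sqrt\lambda\sqrt\sigma\, e^{\lambda(B^2-A^2)}+C_1\sqrt{\lambda\alpha}\,e^{-\lambda(A^2-c)}.$$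
   Context: All functions are real valued. Let $n\ge1$, $0<A<B$, $D>0$, and $\Omega=\{\mathbf{x}\in\mathbb{R}^n: x_1\in(A,B),\ |x_j|<D,\ j=2,\dots,n\}$, $\Gamma_0=\{x_1=B,\ |x_j|<D,\ j=2,\dots,n\}\subset\partial\Omega$. Fix $\varepsilon>0$, an integer $k\ge3$, a step $h\ge h_0>0$ ($h_0\in(0,1)$ fixed), and $t_i=\varepsilon+ih$, $i=0,\dots,k$, $T=t_k$. The data $\Omega$ and $\varepsilon$ are considered as fixed. Put $$w(\mathbf{x},\varepsilon)=-\frac{|\mathbf{x}|^2}{4\varepsilon}-\ln\left((2\sqrt{\pi\varepsilon})^n\right).$$ Operators. For a vector function $V=(v_0,\dots,v_k)^T$ on $\Omega$ define $$L_0=\Delta v_0+2\nabla v_0\cdot\nabla w(\mathbf{x},\varepsilon)+(v_0-v_1)/h,$$ $$L_i=\Delta v_i+2\nabla v_i\cdot\nabla w(\mathbf{x},\varepsilon)+2h\nabla v_i\cdot\sum_{j=0}^i\nabla v_j+(v_i-v_{i+1})/h,\quad i=1,\dots,k-1,$$ $$L_k=\Delta v_k+2\nabla v_k\cdot\nabla w(\mathbf{x},\varepsilon)+2h\nabla v_k\cdot\sum_{j=0}^k\nabla v_j+(v_{k-1}+v_{k-2}+v_{k-3}-3v_k)/(6h).$$ Boundary conditions. For given functions $g_0(\mathbf{x},t_i)$ on $\partial\Omega$ and $g_1(\mathbf{x},t_i)$ on $\Gamma_0$, $i=0,\dots,k$, the boundary conditions BC$(g_0,g_1)$ for $V$ are: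 $v_i=\frac{g_0(\cdot,t_{i+1})-g_0(\cdot,t_i)}{h}$ on $\partial\Omega$ and $\partial_{x_1}v_i=\frac{g_1(\cdot,t_{i+1})-g_1(\cdot,t_i)}{h}$ on $\Gamma_0$ for $i=0,\dots,k-1$; and $v_k=\frac{3g_0(\cdot,t_k)-g_0(\cdot,t_{k-1})-g_0(\cdot,t_{k-2})-g_0(\cdot,t_{k-3})}{6h}$ on $\partial\Omega$, $\partial_{x_1}v_k=\frac{3g_1(\cdot,t_k)-g_1(\cdot,t_{k-1})-g_1(\cdot,t_{k-2})-g_1(\cdot,t_{k-3})}{6h}$ on $\Gamma_0$. There are two sets of data: noisy data $(g_0,g_1)$ and noiseless data $(g_0^*,g_1^* )$. Spaces and sets. $m_n=[n/2]+2$ ($[\cdot]$ is the integer part). For a Hilbert space $H$, $H_{k+1}$ is the space of $(k+1)$-tuples of elements of $H$ with $\|Q\|_{H_{k+1}}^2=\sum_i\|q_i\|_H^2$. $[\cdot,\cdot]$ is the scalar product in $H^{m_n}_{k+1}(\Omega)$. $H^{m}_0(\Omega)=\{q\in H^m(\Omega): q|_{\partial\Omega}=0,\ q_{x_1}|_{\Gamma_0}=0\}$ for $m=2,m_n$, and $H^{m_n}_{0,k+1}(\Omega)$ is the corresponding space of $(k+1)$-tuples. For $R>0$, $B(R)=\{V\in H^{m_n}_{k+1}(\Omega):\|v_i\|_{H^{m_n}(\Omega)}<R\ \forall i,\ V\text{ satisfies BC}(g_0,g_1)\}$, $B^*(R)=\{V\in H^{m_n}_{k+1}(\Omega):\|v_i\|_{H^{m_n}(\Omega)}<R\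 \forall i,\ V\text{ satisfies BC}(g_0^*,g_1^* )\}$, $\overline{B_0(2R)}=\{Z\in H^{m_n}_{0,k+1}(\Omega):\|z_i\|_{H^{m_n}(\Omega)}\le2R\ \forall i\}$. Functional. $\varphi_\lambda(x_1)=e^{2\lambda x_1^2}$, $\alpha\in(0,1)$, $c>0$, and $$J_{\lambda,\alpha}(V)=e^{-2\lambda c}\sum_{i=0}^{k}\int_\Omega\left[L_i(V)\right]^2\varphi_\lambda(x_1)\,d\mathbf{x}+\alpha\|V\|^2_{H^{m_n}_{k+1}(\Omega)},$$ the same formula being used for all $V=W+G$ with $W\in\overline{B_0(2R)}$. The number $\lambda_2$. $\lambda_2=\lambda_2(R,\alpha,h,k)\ge1$ is a threshold, depending only on the listed parameters, for which the global strong convexity theorem holds for $I_{\lambda,\alpha}$ on $\overline{B_0(2R)}$ (it is the threshold for radius $2R$ in place of $R$): for all $\lambda\ge\lambda_2$ the functional $I_{\lambda,\alpha}$ has a Fréchet derivative $I'_{\lambda,\alpha}(W)\in H^{m_n}_{0,k+1}(\Omega)$ at every $W\in\overline{B_0(2R)}$; with some $C_1=C_1(R,\alpha,h,k)>0$, for all $W_1,W_2\in\overline{B_0(2R)}$, $$I_{\lambda,\alpha}(W_2)-I_{\lambda,\alpha}(W_1)-[I'_{\lambda,\alpha}(W_1),W_2-W_1]\ge C_1\frac{e^{2\lambda(A^2-c)}}{\lambda}\sum_{i,j=1}^n\|\partial^2_{x_ix_j}(W_2-W_1)\|^2_{L_{2,k+1}(\Omega)}+C_1e^{2\lambda(A^2-c)}\|W_2-W_1\|^2_{H^1_{k+1}(\Omega)}+\alpha\|W_2-W_1\|^2_{H^{m_n}_{k+1}(\Omega)};$$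 and $I_{\lambda,\alpha}$ has a unique minimizer $W_{\min,\lambda}$ on $\overline{B_0(2R)}$, which satisfies $[I'_{\lambda,\alpha}(W_{\min,\lambda}),W_{\min,\lambda}-W]\le0$ for all $W\in\overline{B_0(2R)}$. Reconstruction formula. For $V=(v_0,\dots,v_k)^T$ put $w_V(\mathbf{x},t_i)=h\sum_{j=0}^iv_j(\mathbf{x})+w(\mathbf{x},\varepsilon)$ and $$a[V](\mathbf{x})=\frac{1}{T-\varepsilon}\left(w_V(\mathbf{x},t_k)-w(\mathbf{x},\varepsilon)\right)-\frac1{T-\varepsilon}\sum_{i=0}^k\left(\Delta w_V(\mathbf{x},t_i)+|\nabla w_V(\mathbf{x},t_i)|^2\right).$$ *)

(* Defs.v *)
(* The space R^N, N >= 1, is 'rV[R]_n.+1 with N = n.+1, and the coordinates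
   x_1, ..., x_N are x 0 i for i : 'I_n.+1, starting with x_1 = x 0 0. *)
From HB Require Import structures.
From mathcomp Require Import all_boot all_order all_algebra.
From mathcomp Require Import all_classical all_reals all_analysis.

Set Implicit Arguments.
Unset Strict Implicit.
Unset Printing Implicit Defensive.

Import Order.TTheory GRing.Theory Num.Theory.
Import numFieldNormedType.Exports.

Local Open Scope classical_set_scope.
Local Open Scope ring_scope.

(* Borel sigma-algebra of R^n, generated by the coordinates. *)
Definition row_display : measure_display.
Proof. exact: default_measure_display. Qed.

Section RowMeasurable.
Context (R : realType) (n : nat).

Definition row_coord (i : 'I_n) (x : 'rV[R]_n) : measurableTypeR R := x 0 i.

Let row_set0 : g_sigma_preimage row_coord set0.
Proof. exact: sigma_algebra0. Qed.

Let row_setC X : g_sigma_preimage row_coord X -> g_sigma_preimage row_coord (~` X).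
Proof. exact: sigma_algebraC. Qed.

Let row_bigcup (F : (set 'rV[R]_n)^nat) :
  (forall i, g_sigma_preimage row_coord (F i)) ->
  g_sigma_preimage row_coord (\bigcup_i (F i)).
Proof. exact: sigma_algebra_bigcup. Qed.

HB.instance Definition _ :=
  @isMeasurable.Build row_display
    'rV[R]_n (g_sigma_preimage row_coord) row_set0 row_setC row_bigcup.

End RowMeasurable.

Section RowLebesgue.
Context (R : realType).

Definition row_cons n (p : 'rV[R]_n * measurableTypeR R) : 'rV[R]_n.+1 :=
  \row_i (if unlift ord0 i is Some j then p.1 0 j else p.2).

(* Lebesgue measure on R^n, as an iterated product. *)
Fixpoint lebesgue_row n : set 'rV[R]_n -> \bar R :=
  match n with
  | 0 => dirac (0 : 'rV[R]_0)
  | m.+1 => pushforward (lebesgue_row (n := m) \x lebesgue_measure)%E (@row_cons m)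
  end.

Lemma measurable_row_coord n (i : 'I_n) :
  measurable_fun [set: 'rV[R]_n] (@row_coord R n i).
Proof.
move=> _ Y mY; rewrite setTI; apply: sub_sigma_algebra => /=.
rewrite -bigcup_seq/=; exists i => /=; first by rewrite mem_index_enum.
by exists Y => //; rewrite setTI.
Qed.

Lemma measurable_row_cons n : measurable_fun setT (@row_cons n).
Proof.
suff H : preimage_set_system setT (@row_cons n) measurable `<=` measurable.
  by move=> _ Y mY; rewrite setTI; apply: H; exists Y => //; rewrite setTI.
rewrite [X in preimage_set_system _ _ X](_ : _ = g_sigma_preimage (@row_coord R n.+1))//.
rewrite -g_sigma_preimage_comp.
apply: smallest_sub; first exact: sigma_algebra_measurable.
rewrite -bigcup_mkord_ord; apply: bigcup_sub => i /= _ B [C mC <-].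
rewrite setTI.
have -> : row_coord (inord i) \o @row_cons n =
  (fun p => if unlift ord0 (inord i) is Some j then row_coord j p.1 else p.2).
  by apply/funext => p; rewrite /= /row_coord mxE.
rewrite -[X in measurable X]setTI.
case: unlift => [j|]; last exact: measurable_snd.
exact: (measurableT_comp (@measurable_row_coord n j) measurable_fst).
Qed.

Lemma lebesgue_rowP n :
  exists mu : {measure set 'rV[R]_n -> \bar R}, @lebesgue_row n = mu.
Proof.
elim: n => [|n [mu IH]]; first by exists (dirac (0 : 'rV[R]_0)).
pose nu : {measure set _ -> \bar R} := (mu \x (@lebesgue_measure R))%E.
have mf := @measurable_row_cons n.
exists (measure_function_pushforward__canonical__measure_function_Measure nu mf).
by rewrite /= IH.
Qed.

Let lebesgue_row0 n : @lebesgue_row n set0 = 0%E.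
Proof. by have [mu ->] := lebesgue_rowP n; exact: measure0. Qed.

Let lebesgue_row_ge0 n X : (0 <= @lebesgue_row n X)%E.
Proof. by have [mu ->] := lebesgue_rowP n; exact: measure_ge0. Qed.

Let lebesgue_row_sigma_additive n : semi_sigma_additive (@lebesgue_row n).
Proof.
by have [mu ->] := lebesgue_rowP n; exact: measure_semi_sigma_additive.
Qed.

HB.instance Definition _ n := isMeasure.Build _ _ _ (@lebesgue_row n)
  (lebesgue_row0 n) (@lebesgue_row_ge0 n) (@lebesgue_row_sigma_additive n).

End RowLebesgue.

(* Sobolev spaces H^m(U), U an open subset of R^n.+1.  Functions are defined
   everywhere and represent their classes modulo null sets. *)
Section Sobolev.
Context (R : realType) (n : nat).
Notation point := 'rV[R]_n.+1.
Notation mu := (@lebesgue_row R n.+1).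

Definition partial (i : 'I_n.+1) (f : point -> R) : point -> R :=
  fun x => 'D_(delta_mx 0 i) f x.

Definition partials (s : seq 'I_n.+1) (f : point -> R) : point -> R :=
  foldr partial f s.

Definition test_function (U : set point) (f : point -> R) : Prop :=
  (forall s : seq 'I_n.+1,
     continuous (partials s f) /\
     forall i x, derivable (partials s f) x (delta_mx 0 i)) /\
  exists K, [/\ compact K, K `<=` U & forall x, ~ K x -> f x = 0].

Section Spaces.
Variable U : set point.

Definition memL2 (f : point -> R) : Prop :=
  measurable_fun U f /\ (\int[mu]_(x in U) ((f x) ^+ 2)%:E < +oo)%E.

Definition ipL2 (f g : point -> R) : R := \int[mu]_(x in U) (f x * g x).

Definition normL2 (f : point -> R) : R := Num.sqrt (ipL2 f f).

(* v is the weak derivative of u in the directions listed in s, and is in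
   L_2(U). *)
Definition is_wderiv (s : seq 'I_n.+1) (u v : point -> R) : Prop :=
  memL2 v /\
  forall f, test_function U f ->
    \int[mu]_(x in U) (u x * partials s f x) =
    (-1) ^+ size s * \int[mu]_(x in U) (v x * f x).

(* Weak derivatives are unique up to null sets; this picks a representative,
   and is 0 if there is no weak derivative in L_2(U). *)
Definition wderiv (s : seq 'I_n.+1) (u : point -> R) : point -> R :=
  xget (fun=> 0) [set v | is_wderiv s u v].

Definition wlap (u : point -> R) : point -> R :=
  fun x => \sum_i wderiv [:: i; i] u x.

(* Multi-indices of order <= m are the functions a : 'I_n.+1 -> {0..m} with
   mi_order a <= m. *)
Definition mi_order m (a : {ffun 'I_n.+1 -> 'I_m.+1}) : nat :=
  (\sum_i (a i : nat))%N.

Definition mi_seq m (a : {ffun 'I_n.+1 -> 'I_m.+1}) : seq 'I_n.+1 :=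
  flatten [seq nseq (a i) i | i <- enum 'I_n.+1].

Definition memH (m : nat) (u : point -> R) : Prop :=
  memL2 u /\
  forall a : {ffun 'I_n.+1 -> 'I_m.+1}, (mi_order a <= m)%N ->
    exists v, is_wderiv (mi_seq a) u v.

Definition ipH (m : nat) (u v : point -> R) : R :=
  \sum_(a : {ffun 'I_n.+1 -> 'I_m.+1} | (mi_order a <= m)%N)
    ipL2 (wderiv (mi_seq a) u) (wderiv (mi_seq a) v).

Definition normH (m : nat) (u : point -> R) : R := Num.sqrt (ipH m u u).

(* The trace of u on S, a part of the boundary of U, is g: the boundary values
   are those of the continuous extension of u to the closure of U.  It is only
   used for u in H^m(U) and for first derivatives of such u, with m = [N/2] + 2,
   when H^m(U) is embedded in C^1 of the closure. *)
Definition has_trace (u : point -> R) (S : set point) (g : point -> R) : Prop :=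
  exists f : point -> R,
    [/\ {within closure U, continuous f},
        {ae mu, forall x, U x -> f x = u x} &
        forall x, S x -> f x = g x].

Section Tuples.
Variable k : nat.
Notation tup := ('I_k.+1 -> point -> R).

Definition memHk (m : nat) (V : tup) : Prop := forall i, memH m (V i).

Definition ipHk (m : nat) (V W : tup) : R := \sum_i ipH m (V i) (W i).

Definition normHk (m : nat) (V : tup) : R := Num.sqrt (ipHk m V V).

Definition normL2k (V : tup) : R := Num.sqrt (\sum_i normL2 (V i) ^+ 2).

End Tuples.
End Spaces.
End Sobolev.

Section Problem.
Context (R : realType) (n : nat).
Variables (A B D eps : R) (k : nat) (h : R).
Notation point := 'rV[R]_n.+1.
Notation mu := (@lebesgue_row R n.+1).
Notation tup := ('I_k.+1 -> point -> R).

Definition Omega : set point :=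
  [set x | A < x 0 0 < B /\ forall j, j != 0 -> `|x 0 j| < D].

Definition bdOmega : set point := closure Omega `\` interior Omega.

Definition Gamma0 : set point :=
  [set x | x 0 0 = B /\ forall j, j != 0 -> `|x 0 j| < D].

Definition tgrid (i : nat) : R := eps + i%:R * h.
Definition Tfin : R := tgrid k.

Definition sqnorm (x : point) : R := \sum_j x 0 j ^+ 2.

Definition w_eps (x : point) : R :=
  - (sqnorm x / (4 * eps)) - ln ((2 * Num.sqrt (pi * eps)) ^+ n.+1).

(* As k >= 3, every argument of inord below is at most k. *)
Definition Lop (V : tup) (i : 'I_k.+1) (x : point) : R :=
  let v (j : nat) := V (inord j) in
  let linear := wlap Omega (V i) x
    + 2 * \sum_l wderiv Omega [:: l] (V i) x * partial l w_eps x in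
  let quadratic := 2 * h * \sum_l wderiv Omega [:: l] (V i) x *
    \sum_(j < k.+1 | (j <= i)%N) wderiv Omega [:: l] (V j) x in
  if i == 0%N :> nat then linear + (v 0%N x - v 1%N x) / h
  else if (i < k)%N then linear + quadratic + (V i x - v i.+1 x) / h
  else linear + quadratic
    + (v (k - 1)%N x + v (k - 2)%N x + v (k - 3)%N x - 3 * v k x) / (6 * h).

Definition data_quotient (g : point -> R -> R) (i : 'I_k.+1) (x : point) : R :=
  if (i < k)%N then (g x (tgrid i.+1) - g x (tgrid i)) / h
  else (3 * g x (tgrid k) - g x (tgrid (k - 1)) - g x (tgrid (k - 2))
        - g x (tgrid (k - 3))) / (6 * h).

Definition BC (g0 g1 : point -> R -> R) (V : tup) : Prop :=
  forall i, has_trace Omega (V i) bdOmega (data_quotient g0 i) /\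
    has_trace Omega (wderiv Omega [:: 0] (V i)) Gamma0 (data_quotient g1 i).

(* m_N = [N/2] + 2 *)
Definition mn : nat := ((n.+1)./2 + 2)%N.

Definition H0 (m : nat) (q : point -> R) : Prop :=
  [/\ memH Omega m q, has_trace Omega q bdOmega (fun=> 0) &
      has_trace Omega (wderiv Omega [:: 0] q) Gamma0 (fun=> 0)].

Definition H0k (m : nat) (Q : tup) : Prop := forall i, H0 m (Q i).

Definition Bset (g0 g1 : point -> R -> R) (r : R) (V : tup) : Prop :=
  [/\ memHk Omega mn V, forall i, normH Omega mn (V i) < r & BC g0 g1 V].

Definition B0bar (r : R) (Z : tup) : Prop :=
  H0k mn Z /\ forall i, normH Omega mn (Z i) <= r.

Definition carleman_weight (lambda : R) (x : point) : R :=
  expR (2 * lambda * x 0 0 ^+ 2).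

Definition Jfun (c lambda alpha : R) (V : tup) : R :=
  expR (- (2 * lambda * c)) *
    \sum_i \int[mu]_(x in Omega) (Lop V i x ^+ 2 * carleman_weight lambda x)
  + alpha * normHk Omega mn V ^+ 2.

Definition Ifun (c lambda alpha : R) (G W : tup) : R := Jfun c lambda alpha (W + G).

(* P represents, via the scalar product of H^{m_N}_{k+1}, the Frechet derivative
   at W of F restricted to S: the increments are W' - W with W' in S. *)
Definition is_frechet (F : tup -> R) (S : tup -> Prop) (W P : tup) : Prop :=
  forall e, 0 < e -> exists2 d, 0 < d &
    forall W', S W' -> normHk Omega mn (W' - W) < d ->
      `|F W' - F W - ipHk Omega mn P (W' - W)| <= e * normHk Omega mn (W' - W).

Definition is_minimizer (F : tup -> R) (S : tup -> Prop) (W : tup) : Prop :=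
  S W /\ forall W', S W' -> F W <= F W'.

(* Strong convexity of Ifun on the closure of B_0(2r) with the constant C, for
   one value of lambda, together with the existence, the uniqueness (modulo null
   sets) and the variational inequality for the minimizer. *)
Definition strongly_convex (c lambda alpha r C : R) (G : tup) : Prop :=
  let F := Ifun c lambda alpha G in
  let S := B0bar (2 * r) in
  exists dF : tup -> tup,
  [/\ forall W, S W -> H0k mn (dF W) /\ is_frechet F S W (dF W),
      forall W1 W2, S W1 -> S W2 ->
        C * (expR (2 * lambda * (A ^+ 2 - c)) / lambda) *
          (\sum_i \sum_j
             normL2k Omega (fun l => wderiv Omega [:: i; j] ((W2 - W1) l)) ^+ 2)
        + C * expR (2 * lambda * (A ^+ 2 - c)) * normHk Omega 1 (W2 - W1) ^+ 2
        + alpha * normHk Omega mn (W2 - W1) ^+ 2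
        <= F W2 - F W1 - ipHk Omega mn (dF W1) (W2 - W1),
      exists W, is_minimizer F S W,
      forall W1 W2, is_minimizer F S W1 -> is_minimizer F S W2 ->
        forall l, {ae mu, forall x, Omega x -> W1 l x = W2 l x} &
      forall Wmin, is_minimizer F S Wmin ->
        forall W, S W -> ipHk Omega mn (dF Wmin) (Wmin - W) <= 0].

(* lambda2 and C are uniform with respect to the boundary data and to G. *)
Definition convexity_threshold (c alpha r lambda2 C : R) : Prop :=
  forall g0 g1 G, Bset g0 g1 r G ->
    forall lambda, lambda2 <= lambda -> strongly_convex c lambda alpha r C G.

Definition wV (V : tup) (i : 'I_k.+1) (x : point) : R :=
  h * (\sum_(j < k.+1 | (j <= i)%N) V j x) + w_eps x.

Definition recon (V : tup) (x : point) : R :=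
  (Tfin - eps)^-1 * (wV V ord_max x - w_eps x)
  - (Tfin - eps)^-1 * \sum_i (wlap Omega (wV V i) x
      + \sum_l wderiv Omega [:: l] (wV V i) x ^+ 2).

End Problem.

(* Main.v *)
(** Let Q be the difference of the exact solution V' and of G'; it belongs to the ball on which
    the functional is minimized.  Strong convexity at the pair of the minimizer and Q, together
    with the variational inequality, bounds the squared H^2-distance of the two, with the weight
    e^(2 lambda (A^2 - c)) / lambda, by the value of the functional at Q, which is
    J (V' + (G - G')).  Since L_i (V') = 0, L_i (V' + (G - G')) consists of terms linear in
    G - G' and of products of two first derivatives, one of which is a derivative of G - G'.
    First derivatives being bounded by the H^m-norm, it is of size sigma in L_2, and the Carleman
    weight is at most e^(2 lambda B^2).  The reconstruction formula is Lipschitz on bounded sets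
    of H^m for the same reason.

    The bound on first derivatives is the Sobolev embedding on a box.  A point x of a quadrant of
    the box is the corner of a small cone of cubes staying in the box; the means of a function w
    against a product kernel scaled by t around x are compared at the scales t and t/4.  The
    kernel is chosen so that the difference of two consecutive means telescopes into pairings of
    w with derivatives of high order in a single coordinate, hence of weak derivatives of w with
    test functions; these are summable over the scales, so that the means are uniformly bounded.
    Their limit is w almost everywhere.  As only test functions of product form occur, boxes and
    Fubini's theorem suffice to identify limits and to prove the uniqueness of weak derivatives. *)

(* The obstacle is that strong convexity is used only to control derivatives up to order two in L_2,
   while the operators and the reconstruction formula are quadratic in the gradient. One factor of
   each product must be bounded uniformly, and this bound comes from the a priori H^m balls (radius
   r for V', 3r for the minimizer plus G), not from the small H^2-distance. With N the dimension, m
   = [N/2] + 2 gives 2(m - 1) > N: using derivatives of order m - 1 of a first derivative, the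
   passage from scale t to t/4 costs at most a multiple of sqrt t, and the ratio 4 turns this into a
   geometric series of ratio 1/2. Kernels are one-sided in each coordinate so that means at points
   near the boundary stay in the box; the side also fixes the value at 0 of the smoothed step, hence
   which faces the limiting half-open boxes contain. Dividing the value of the functional at Q by
   e^(2 lambda (A^2 - c)) / lambda leaves lambda sigma^2 e^(2 lambda (B^2 - A^2)), where c cancels,
   and lambda alpha e^(-2 lambda (A^2 - c)), from alpha times a squared norm that is bounded but not
   small. Replacing sigma^2 by sigma and taking roots gives the stated error. *)
Require Import Defs.
From HB Require Import structures.
From mathcomp Require Import all_boot all_order all_algebra.
From mathcomp Require Import all_classical all_reals all_analysis.
From mathcomp Require Import measurable_realfun ring lra.

Set Implicit Arguments.
Unset Strict Implicit.
Unset Printing Implicit Defensive.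

Import Order.TTheory GRing.Theory Num.Theory.
Import numFieldNormedType.Exports.

Local Open Scope classical_set_scope.
Local Open Scope ring_scope.

(** * Smooth functions of one variable *)

Section Smooth1.
Context (R : realType).
Implicit Types (f g : R -> R) (p : {poly R}) (x : R).

(** The polynomial factor closes the family under differentiation: with y = 1/x, the derivative in x
    of p(y) e^(-y) is y^2 (p - p')(y) e^(-y). *)
Definition flat_fun p x := if 0 < x then p.[x^-1] * expR (- x^-1) else 0.

Lemma poly_growth p : exists2 C, 0 <= C &
  forall y, 1 <= y -> `|p.[y]| <= C * y ^+ size p.
Proof.
exists (\sum_(i < size p) `|p`_i|); first exact: sumr_ge0.
move=> y y1; rewrite horner_coef (le_trans (ler_norm_sum _ _ _))// mulr_suml.
apply: ler_sum => i _; rewrite normrM normrX (ger0_norm (le_trans ler01 y1)).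
by rewrite ler_wpM2l// ler_weXn2l// ltnW.
Qed.

(** With d = [size p] and 0 < h <= 1, e^(1/h) exceeds (1/h)^(d+1) / (d+1)!, one power more than the
    growth allowed to p(1/h); the spare power is the factor |h|. *)
Lemma flat_fun_small p : exists2 C, 0 <= C &
  forall h, h <= 1 -> `|flat_fun p h| <= C * `|h|.
Proof.
have [C C0 hC] := poly_growth p.
exists (C * (size p).+1`!%:R); first by rewrite mulr_ge0.
move=> h h1; rewrite /flat_fun; case: ltP => h0; last by rewrite normr0 !mulr_ge0.
have hi1 : 1 <= h^-1 by rewrite invf_ge1.
have y0 : 0 <= h^-1 by rewrite invr_ge0 ltW.
rewrite normrM (ger0_norm (expR_ge0 _)) (gtr0_norm h0).
apply: (le_trans (ler_wpM2r (expR_ge0 _) (hC _ hi1))).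
rewrite -!mulrA ler_wpM2l//.
have := expR_ge1Dxn (size p) y0.
rewrite expRN -ler_pdivlMr; last by rewrite invr_gt0 expR_gt0.
rewrite invrK -mulrA -ler_pdivrMl ?ltr0n ?fact_gt0// -ler_pdivrMl// => H.
apply: le_trans H; rewrite (_ : _ * _ = h^-1 ^+ (size p).+1 / (size p).+1`!%:R).
  by rewrite lerDr.
by rewrite exprS; ring.
Qed.

Lemma is_derive0_quadratic f x C : (forall h, h <= 1 -> `|f (h + x) - f x| <= C * h ^+ 2) ->
  is_derive x 1 f 0.
Proof.
move=> hC.
suff H : h^-1 *: ((f \o shift x) (h *: 1) - f x) @[h --> 0^'] --> (0 : R).
  by apply: DeriveDef; [apply: cvgP H|exact: cvg_lim H].
apply/cvgr0Pnorm_le => e e0.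
have C0 : 0 <= C by have := hC 1 (lexx _); rewrite expr1n mulr1; apply: le_trans.
have d0 : 0 < Num.min 1 (e / (C + 1)) by rewrite lt_min ltr01 divr_gt0// ltr_wpDl.
near=> h.
have hn0 : h != 0 by near: h; exact: nbhs_dnbhs_neq.
have : `|h| < Num.min 1 (e / (C + 1)).
  near: h; exact: dnbhs0_lt.
rewrite lt_min => /andP[h1 h2].
have hC' := hC h (le_trans (ler_norm _) (ltW h1)).
rewrite /= [h *: 1]mulr1 normrZ normfV ler_pdivrMl ?normr_gt0//.
apply: (le_trans hC'); rewrite -[h ^+ 2]real_normK ?num_real// expr2 mulrA mulrC.
rewrite ler_wpM2l// mulrC (le_trans (ler_wpM2r C0 (ltW h2)))//.
rewrite -mulrA ger_pMr// mulrC ler_pdivrMr; lra.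
Unshelve. all: by end_near. Qed.

Lemma is_derive_flat_fun p x :
  is_derive x 1 (flat_fun p) (flat_fun ('X ^+ 2 * (p - p^`())) x).
Proof.
have [x0|x0|->] := ltgtP x 0.
- rewrite [X in is_derive _ _ _ X](_ : _ = 0); last by rewrite /flat_fun ltNge (ltW x0).
  apply: (@near_eq_is_derive _ _ _ (cst 0)) => //.
  near=> y; rewrite /flat_fun ltNge ltW//; near: y; exact: lt_nbhsl.
- apply: (@near_eq_is_derive _ _ _ (fun x => p.[x^-1] * expR (- x^-1))) => //.
    near=> y; rewrite /flat_fun ifT//; near: y; exact: lt_nbhsr.
  have xn0 : x != 0 by rewrite gt_eqF.
  have dV : is_derive x 1 (fun y : R => y^-1) (- x ^- 2).
    have := @is_deriveV _ id x 1 1 xn0 (is_derive_id _ _).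
    by rewrite [_ *: _]mulr1.
  have dp := @is_derive1_comp _ (horner p) GRing.inv x _ _ (is_derive_poly _ _) dV.
  have de := @is_derive1_comp _ expR (fun y => - y^-1) x _ _ (is_derive_expR _) (is_deriveN dV).
  apply: (is_derive_eq (is_deriveM dp de)).
  rewrite /flat_fun x0 !(hornerE, hornerXn).
  rewrite [LHS](_ : _ = p.[x^-1] * (expR (- x^-1) * - - x ^- 2) +
     expR (- x^-1) * (p^`().[x^-1] * - x ^- 2))//.
  by rewrite exprVn; ring.
(* At 0, passing from [p] to [p * 'X] extracts one factor h, and [flat_fun_small] supplies a second
   one: the increment is quadratic. *)
- rewrite [X in is_derive _ _ _ X](_ : _ = 0); last by rewrite /flat_fun ltxx.
  have [C C0 hC] := flat_fun_small (p * 'X).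
  apply: (@is_derive0_quadratic _ _ C) => h h1.
  rewrite addr0 [flat_fun p 0]/flat_fun ltxx subr0.
  have -> : flat_fun p h = h * flat_fun (p * 'X) h.
    rewrite /flat_fun; case: ltP => h0; last by rewrite mulr0.
    by rewrite hornerMX; field; rewrite gt_eqF.
  rewrite normrM -[h ^+ 2]real_normK ?num_real// expr2 mulrCA.
  by rewrite ler_wpM2l// hC.
Unshelve. all: by end_near. Qed.

(** Smoothness is replaced by a generated class: one induction ([smooth1_ex_derive]) shows that each
    member has a derivative in the class, and all orders of differentiability follow. *)
Inductive smooth1 : (R -> R) -> Prop :=
| smooth1_cst c : smooth1 (fun=> c)
| smooth1_id : smooth1 id
| smooth1_flat p : smooth1 (flat_fun p)
| smooth1D f g : smooth1 f -> smooth1 g -> smooth1 (fun x => f x + g x)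
| smooth1M f g : smooth1 f -> smooth1 g -> smooth1 (fun x => f x * g x)
| smooth1V f : smooth1 f -> (forall x, f x != 0) -> smooth1 (fun x => (f x)^-1)
| smooth1_comp f g : smooth1 f -> smooth1 g -> smooth1 (fun x => f (g x)).

Lemma smooth1_ex_derive f : smooth1 f ->
  exists2 g, smooth1 g & forall x, is_derive x 1 f (g x).
Proof.
elim => {f} [c||p|f g _ [f' sf df] _ [g' sg dg]|f g sf [f' sf' df] sg [g' sg' dg]
            |f sf [f' sf' df] f0|f g sf [f' sf' df] sg [g' sg' dg]].
- by exists (fun=> 0); [exact: smooth1_cst|move=> x; exact: is_derive_cst].
- by exists (fun=> 1); [exact: smooth1_cst|move=> x; exact: is_derive_id].
- exists (flat_fun ('X ^+ 2 * (p - p^`()))); first exact: smooth1_flat.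
  exact: is_derive_flat_fun.
- by exists (fun x => f' x + g' x); [exact: smooth1D|move=> x; exact: is_deriveD].
- exists (fun x => f x * g' x + g x * f' x).
    by apply: smooth1D; apply: smooth1M.
  by move=> x; exact: is_deriveM.
- exists (fun x => (-1) * (((f x)^-1 * (f x)^-1) * f' x)).
    apply: smooth1M; first exact: smooth1_cst.
    by apply: smooth1M => //; apply: smooth1M => //; exact: smooth1V.
  move=> x; apply: (is_derive_eq (is_deriveV (f0 x) (df x))).
  rewrite [LHS](_ : _ = - f x ^- 2 * f' x)//.
  by rewrite expr2 invfM; ring.
- exists (fun x => f' (g x) * g' x).
    by apply: smooth1M => //; exact: smooth1_comp.
  by move=> x; exact: is_derive1_comp.
Qed.

Lemma smooth1_derivable f x : smooth1 f -> derivable f x 1.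
Proof. by move=> /smooth1_ex_derive[g _ /(_ x)]; case. Qed.

Lemma smooth1_derive1 f : smooth1 f -> smooth1 (derive1 f).
Proof.
move=> /smooth1_ex_derive[g sg dg]; rewrite (_ : derive1 f = g)//.
by apply/funext => x; rewrite derive1E; apply: derive_val.
Qed.

Lemma smooth1_derive1n n f : smooth1 f -> smooth1 (derive1n n f).
Proof. by elim: n => // n ih sf; rewrite derive1nS; apply/smooth1_derive1/ih. Qed.

Lemma smooth1_continuous f : smooth1 f -> continuous f.
Proof.
move=> sf x; apply: differentiable_continuous; apply/derivable1_diffP.
exact: smooth1_derivable.
Qed.

Lemma smooth1_is_derive f x : smooth1 f -> is_derive x 1 f (derive1 f x).
Proof.
by move=> sf; rewrite derive1E; apply: derivableP; exact: smooth1_derivable.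
Qed.

Lemma smooth1B f g : smooth1 f -> smooth1 g -> smooth1 (fun x => f x - g x).
Proof.
move=> sf sg; rewrite (_ : (fun x => _) = (fun x => f x + (-1) * g x)); last first.
  by apply/funext => x; rewrite mulN1r.
by apply: smooth1D => //; apply: smooth1M => //; exact: smooth1_cst.
Qed.

Lemma smooth1X n : smooth1 (fun x => x ^+ n).
Proof.
elim: n => [|n ih]; first exact: smooth1_cst.
rewrite (_ : (fun x => _) = (fun x => x * x ^+ n)).
  by apply: smooth1M => //; exact: smooth1_id.
by apply/funext => x; rewrite exprS.
Qed.

Lemma smooth1_affine f a b : smooth1 f -> smooth1 (fun x => f (a * x + b)).
Proof.
move=> sf; apply: (@smooth1_comp f (fun x => a * x + b)) => //.
apply: smooth1D; last exact: smooth1_cst.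
by apply: smooth1M; [exact: smooth1_cst|exact: smooth1_id].
Qed.

Lemma derive1_val f x d : is_derive x 1 f d -> derive1 f x = d.
Proof. by move=> fd; rewrite derive1E; apply: derive_val. Qed.

Lemma derive1nD k f g : smooth1 f -> smooth1 g ->
  derive1n k (fun x => f x + g x) = fun x => derive1n k f x + derive1n k g x.
Proof.
elim: k f g => // k ih f g sf sg; rewrite !derive1Sn.
rewrite (_ : derive1 _ = fun x => derive1 f x + derive1 g x).
  by rewrite ih//; exact: smooth1_derive1.
by apply/funext => x; apply: derive1_val; apply: is_deriveD; exact: smooth1_is_derive.
Qed.

Lemma derive1nZ k f a : smooth1 f ->
  derive1n k (fun x => a * f x) = fun x => a * derive1n k f x.
Proof.
elim: k f => // k ih f sf; rewrite !derive1Sn.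
rewrite (_ : derive1 _ = fun x => a * derive1 f x).
  by rewrite ih//; exact: smooth1_derive1.
apply/funext => x; apply: derive1_val.
exact: (@is_deriveZ _ _ _ f a x 1 _ (smooth1_is_derive _ sf)).
Qed.

Lemma is_derive_affine f a b x d : is_derive (a * x + b) 1 f d ->
  is_derive x 1 (fun x => f (a * x + b)) (a * d).
Proof.
move=> fd; have da : is_derive x 1 (fun x => a * x + b) a.
  have := @is_deriveD _ _ _ _ _ x 1 _ _ (@is_deriveZ _ _ _ id a x 1 1 (is_derive_id _ _))
    (is_derive_cst b x 1).
  by rewrite addr0 [_ *: _]mulr1.
by rewrite mulrC; exact: (@is_derive1_comp _ f (fun x => a * x + b)).
Qed.

Lemma derive1n_affine k f a b : smooth1 f ->
  derive1n k (fun x => f (a * x + b)) = fun x => a ^+ k * derive1n k f (a * x + b).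
Proof.
elim: k f => [f sf|k ih f sf]; first by apply/funext => x; rewrite mul1r.
rewrite !derive1Sn (_ : derive1 _ = fun x => a * derive1 f (a * x + b)).
  have sf' := smooth1_derive1 sf.
  rewrite derive1nZ; last exact: (smooth1_affine a b sf').
  by rewrite ih//; apply/funext => x; rewrite exprS mulrA.
by apply/funext => x; apply: derive1_val; apply: is_derive_affine; exact: smooth1_is_derive.
Qed.

Lemma derive1n_local (U : set R) k f g : open U ->
  (forall x, U x -> f x = g x) -> forall x, U x -> derive1n k f x = derive1n k g x.
Proof.
move=> oU; elim: k f g => [f g|k ih f g fg x Ux]; first exact.
rewrite 2!derive1Sn.
apply: ih => // {Ux}x Ux; rewrite !derive1E; apply: near_eq_derive.
by near=> y; apply: fg; near: y; exact: open_nbhs_nbhs.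
Unshelve. all: by end_near. Qed.

Lemma derive1n_cst k (a : R) : derive1n k.+1 ((fun=> a) : R -> R) = (fun=> 0).
Proof.
elim: k => [|k ih]; last by rewrite derive1nS ih; apply/funext => x; rewrite derive1_cst.
by rewrite derive1n1; apply/funext => x; rewrite derive1_cst.
Qed.

Lemma derive1n_monomial k : derive1n k (fun x => x ^+ k / k`!%:R) = fun=> 1.
Proof.
elim: k => [|k ih]; first by apply/funext => x; rewrite /= fact0 divr1.
rewrite derive1Sn -ih; congr derive1n; apply/funext => x; apply: derive1_val.
have d1 : is_derive x 1 (fun x => x ^+ k.+1) (k.+1%:R * x ^+ k).
  have := @is_deriveX _ _ id k.+1 x 1 1 (is_derive_id _ _).
  rewrite [_ *: _]mulr1 (_ : id ^+ _ = (fun x => x ^+ k.+1))//.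
  by apply/funext => y; rewrite exprfctE.
have := @is_deriveZ _ _ _ _ (k.+1`!%:R)^-1 x 1 _ d1.
rewrite (_ : _ \*: _ = (fun x0 => x0 ^+ k.+1 / k.+1`!%:R)); last first.
  by apply/funext => y; rewrite mulrC.
move=> d2; apply: (is_derive_eq d2).
rewrite [LHS](_ : _ = (k.+1`!%:R)^-1 * (k.+1%:R * x ^+ k))//.
by rewrite factS natrM; field; rewrite nat1r !pnatr_eq0 -lt0n fact_gt0.
Qed.

(** * A smooth step and its dilations *)

Definition smoothstep y :=
  flat_fun 1 (4 * y - 1) / (flat_fun 1 (4 * y - 1) + flat_fun 1 (- 4 * y + 3)).

Lemma flat_fun1_gt0 x : 0 < x -> 0 < flat_fun 1 x.
Proof. by move=> x0; rewrite /flat_fun x0 hornerE mul1r expR_gt0. Qed.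

Lemma flat_fun_le0 p x : x <= 0 -> flat_fun p x = 0.
Proof. by move=> x0; rewrite /flat_fun ltNge x0. Qed.

Lemma flat_fun1_ge0 x : 0 <= flat_fun 1 x.
Proof.
by have [/flat_fun1_gt0/ltW//|x0] := ltP 0 x; rewrite flat_fun_le0.
Qed.

Lemma smooth1_smoothstep : smooth1 smoothstep.
Proof.
have s1 a b : smooth1 (fun x => flat_fun 1 (a * x + b)).
  exact/smooth1_affine/smooth1_flat.
apply: smooth1M => //; apply: smooth1V; first exact: smooth1D.
(* The denominator is positive because the half-lines x > 1/4 and x < 3/4, on which the two flat
   functions are respectively positive, cover R. *)
move=> x; rewrite gt_eqF//; have [x1|x1] := ltP 0 (4 * x - 1).
  by rewrite ltr_wpDr ?flat_fun1_ge0 ?flat_fun1_gt0.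
by rewrite ltr_wpDl ?flat_fun1_ge0 ?flat_fun1_gt0//; lra.
Qed.

Lemma smoothstep0 y : y <= 1/4 -> smoothstep y = 0.
Proof. by move=> y1; rewrite /smoothstep flat_fun_le0 ?mul0r//; lra. Qed.

Lemma smoothstep1 y : 3/4 <= y -> smoothstep y = 1.
Proof.
move=> y1; rewrite /smoothstep [X in _ / (_ + X)]flat_fun_le0 ?addr0 ?divff//; last lra.
by rewrite gt_eqF// flat_fun1_gt0//; lra.
Qed.

(** [E] is a primitive of the one-dimensional averaging kernel E', which has mass 1 and support in
    [c + 1/16, c + 15/16]. The last clause makes the kernel minus its rescaling 4 E'(4y) an exact
    derivative of order [S] of a function with the same compact support; this is what turns the
    difference of two means into a pairing with derivatives of order [S]. The values c = 0 and c =
    -1 give averages to the right and to the left of a point. *)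
Variant dilation_spec (S : nat) (c : R) (E psi : R -> R) : Prop :=
  DilationSpec of smooth1 E & smooth1 psi
  & (forall y, y <= c + 1/16 -> E y = 0) & (forall y, c + 15/16 <= y -> E y = 1)
  & (forall y, y <= c + 1/16 -> psi y = 0) & (forall y, c + 15/16 <= y -> psi y = 0)
  & (forall y, derive1n S psi y = derive1 E y - 4 * derive1 E (4 * y)).

(* With F a smoothed truncation of the monomial y^(S-1)/(S-1)!, the difference
   F(y) - 4^(1-S) F(4y) vanishes for large y, while E = F^(S-1) is a smooth step. *)
Lemma dilation_exists (S : nat) (c : R) : c = 0 \/ c = -1 ->
  exists E, exists psi, dilation_spec S.+1 c E psi.
Proof.
move=> hc; pose F y := y ^+ S / S`!%:R * smoothstep (1 * y + - c).
have sm : smooth1 (fun y : R => y ^+ S / S`!%:R).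
  by apply: smooth1M; [exact: smooth1X|exact: smooth1_cst].
have sF : smooth1 F.
  by apply: smooth1M => //; exact: (smooth1_affine 1 (- c) smooth1_smoothstep).
have F0 y : y <= c + 1/4 -> F y = 0.
  by move=> yc; rewrite /F smoothstep0 ?mulr0//; lra.
have F1 y : c + 3/4 <= y -> F y = y ^+ S / S`!%:R.
  by move=> yc; rewrite /F smoothstep1 ?mulr1//; lra.
pose psi y := F y + (- (4 ^- S)) * F (4 * y + 0).
have sF4 : smooth1 (fun y => F (4 * y + 0)) by exact: smooth1_affine.
exists (derive1n S F), psi; split.
- exact: smooth1_derive1n.
- by apply: smooth1D => //; apply: smooth1M => //; exact: smooth1_cst.
- move=> y yc; rewrite (@derive1n_local [set x | x < c + 1/4] _ _ (fun=> 0)); last 3 first.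
  + exact: open_lt.
  + by move=> x /= xc; rewrite F0// ltW.
  + by move=> /=; lra.
  by case: S {F sm sF F0 F1 psi sF4} => [//|S]; rewrite derive1n_cst.
- move=> y yc; rewrite (@derive1n_local [set x | c + 3/4 < x] _ _ (fun y => y ^+ S / S`!%:R)); last 3 first.
  + exact: open_gt.
  + by move=> x /= xc; rewrite F1// ltW.
  + by move=> /=; lra.
  by rewrite derive1n_monomial.
(* The margins fit the ratio 4 exactly: 4 (c + 1/16) = c + 1/4 for c = 0 here, and 4 (c + 15/16) = c
   + 3/4 for c = -1 in the next case. *)
- move=> y yc; rewrite /psi !F0 ?mulr0 ?addr0//; last lra.
  by case: hc => hc; lra.
- move=> y yc; rewrite /psi !F1; [|by case: hc => hc; lra|lra].
  by rewrite addr0 exprMn; field; rewrite expf_neq0 pnatr_eq0// -lt0n fact_gt0.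
- move=> y; rewrite /psi derive1nD//; last first.
    by apply: smooth1M => //; exact: smooth1_cst.
  rewrite derive1nZ// derive1n_affine// addr0 -!derive1nS.
  by rewrite exprS; field; rewrite expf_neq0// pnatr_eq0.
Qed.

End Smooth1.

(** * Lebesgue measure on boxes *)

Section RowMeasure.
Context (R : realType).
Notation leb := (@lebesgue_measure R).

Definition cbox n (A : 'I_n -> set R) : set 'rV[R]_n := [set x | forall j, A j (x 0 j)].

Lemma measurable_cbox n (A : 'I_n -> set R) :
  (forall j, measurable (A j)) -> measurable (cbox A).
Proof.
move=> mA; rewrite [cbox A](_ : _ = \bigcap_(j in setT) (@row_coord R n j @^-1` A j)).
  apply: fin_bigcap_measurable => // j _; rewrite -[X in measurable X]setTI.
  exact: (@measurable_row_coord R n j measurableT _ (mA j)).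
by apply/seteqP; split=> [x xA j _|x xA j]; [exact: xA|exact: (xA j I)].
Qed.

Lemma row_cons_lift n (p : 'rV[R]_n * measurableTypeR R) j :
  row_cons p 0 (lift ord0 j) = p.1 0 j.
Proof. by rewrite mxE liftK. Qed.

Lemma row_cons0 n (p : 'rV[R]_n * measurableTypeR R) : row_cons p 0 ord0 = p.2.
Proof. by rewrite mxE unlift_none. Qed.

Lemma preimage_row_cons_cbox n (A : 'I_n.+1 -> set R) :
  @row_cons R n @^-1` cbox A = cbox (A \o lift ord0) `*` A ord0.
Proof.
apply/seteqP; split=> [[x t] /= xA|[x t] [/= xA tA] j].
  by split=> [j|]; [have := xA (lift ord0 j); rewrite row_cons_lift|
                    have := xA ord0; rewrite row_cons0].
by have [j'|] := unliftP ord0 j => ->; rewrite ?row_cons_lift ?row_cons0//; exact: xA.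
Qed.

Lemma lebesgue_row_cbox n (A : 'I_n -> set R) : (forall j, measurable (A j)) ->
  lebesgue_row (cbox A) = (\prod_j leb (A j))%E.
Proof.
elim: n A => [|n ih] A mA.
  rewrite big_ord0 (_ : cbox A = setT)/= ?diracT//.
  by apply/seteqP; split=> // x _ [].
rewrite /= /pushforward preimage_row_cons_cbox product_measure1E; last 2 first.
- by apply: measurable_cbox => j; exact: mA.
- exact: mA.
transitivity (lebesgue_row (cbox (A \o lift ord0)) * leb (A ord0))%E => //.
by rewrite ih 1?big_ord_recl 1?muleC// => j; exact: mA.
Qed.

Lemma lebesgue_row_sigma_finite n : sigma_finite setT (@lebesgue_row R n).
Proof.
pose F (k : nat) : set 'rV[R]_n := cbox (fun=> `[- k%:R, k%:R]%classic).
exists F.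
  apply/seteqP; split=> // x _.
  have [k hk] : exists k : nat, forall j, `|x 0 j| <= k%:R.
    exists (\max_j (Num.trunc (`|x 0%R j| : R)).+1)%N => j.
    apply: le_trans (ltW (truncnS_gt _)) _.
    by rewrite ler_nat; exact: leq_bigmax.
  by exists k => // j /=; rewrite in_itv/= -ler_norml.
move=> k; split; first exact: measurable_cbox.
rewrite lebesgue_row_cbox// lebesgue_measure_itv/=.
by case: ifP => _; rewrite ?prodEFin ?ltry// -EFinB prodEFin ltry.
Qed.

HB.instance Definition _ n := @Measure_isSigmaFinite.Build _ _ _
  (@lebesgue_row R n) (@lebesgue_row_sigma_finite n).

Notation mu n := (@lebesgue_row R n).

Lemma ge0_integral_row_cons n (f : 'rV[R]_n.+1 -> \bar R) :
  measurable_fun setT f -> (forall x, 0 <= f x)%E ->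
  (\int[mu n.+1]_x f x = \int[mu n \x leb]_p f (row_cons p))%E.
Proof.
move=> mf f0; have mc := @measurable_row_cons R n.
pose nu : {measure set _ -> \bar R} := ((mu n) \x leb)%E.
by rewrite -(@ge0_integral_pushforward _ _ _ _ _ _ mc nu setT f).
Qed.

Lemma integrable_row_cons n (f : 'rV[R]_n.+1 -> \bar R) : measurable_fun setT f ->
  (mu n \x leb)%E.-integrable setT (f \o @row_cons R n) -> (mu n.+1).-integrable setT f.
Proof.
move=> mf /integrableP[_ fi]; apply/integrableP; split => //.
by rewrite ge0_integral_row_cons//; exact: measurableT_comp.
Qed.

Lemma integral_row_cons n (f : 'rV[R]_n.+1 -> \bar R) : measurable_fun setT f ->
  (mu n \x leb)%E.-integrable setT (f \o @row_cons R n) ->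
  (\int[mu n.+1]_x f x = \int[mu n \x leb]_p f (row_cons p))%E.
Proof.
move=> mf fi; have mc := @measurable_row_cons R n.
pose nu : {measure set _ -> \bar R} := ((mu n) \x leb)%E.
by rewrite -(@integral_pushforward _ _ _ _ _ _ mc nu setT f).
Qed.

Definition prodf n (g : 'I_n -> R -> R) (x : 'rV[R]_n) : R := \prod_j g j (x 0 j).

Lemma measurable_coord n (j : 'I_n) (g : R -> R) : measurable_fun setT g ->
  measurable_fun [set: 'rV[R]_n] (fun x => g (x 0 j)).
Proof.
by move=> mg; exact: (measurableT_comp mg (@measurable_row_coord R n j)).
Qed.

Lemma measurable_prodf n (g : 'I_n -> R -> R) : (forall j, measurable_fun setT (g j)) ->
  measurable_fun setT (prodf g).
Proof. by move=> mg; apply: measurable_prod => j _; exact: measurable_coord. Qed.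

Lemma prodf_row_cons n (g : 'I_n.+1 -> R -> R) p :
  prodf g (row_cons p) = g ord0 p.2 * prodf (g \o lift ord0) p.1.
Proof.
rewrite /prodf big_ord_recl row_cons0; congr (_ * _).
by apply: eq_bigr => j _; rewrite row_cons_lift.
Qed.

Lemma integral_prodf n (g : 'I_n -> R -> R) :
  (forall j, leb.-integrable setT (EFin \o g j)) ->
  (mu n).-integrable setT (EFin \o prodf g) /\
  (\int[mu n]_x (prodf g x)%:E = (\prod_j (\int[leb]_x (g j x))%R)%:E)%E.
Proof.
elim: n g => [|n ih] g ig.
  have gE x : prodf g x = 1 by rewrite /prodf big_ord0.
  split; last first.
    by under eq_integral do rewrite gE; rewrite big_ord0 integral_cst//= diracT mule1.
  apply/integrableP; split.
    by apply/measurable_EFinP; apply: measurable_prodf => -[].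
  under eq_integral do rewrite /= gE.
  by rewrite integral_cst//= diracT mule1 normr1 ltry.
have mg j : measurable_fun setT (g j).
  by apply/measurable_EFinP; exact: measurable_int (ig j).
have [ig' Ig'] := ih (g \o lift ord0) (fun j => ig _).
have mp : measurable_fun setT (EFin \o prodf g).
  by apply/measurable_EFinP; apply: measurable_prodf.
have E (x : 'rV[R]_n) (t : R) : prodf g (row_cons (x, t)) = prodf (g \o lift ord0) x * g ord0 t.
  by rewrite prodf_row_cons/= mulrC.
have ip : (mu n \x leb)%E.-integrable setT ((EFin \o prodf g) \o @row_cons R n).
  apply/integrable12ltyP.
    by apply: measurableT_comp => //; exact: measurable_row_cons.
  under eq_integral.
    move=> x _; under eq_integral do rewrite /= E normrM EFinM.
    rewrite ge0_integralZl//; last 1 first.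
      by apply/measurable_EFinP; apply: measurableT_comp => //; exact: mg.
    over.
  rewrite ge0_integralZr//; last 2 first.
    apply/measurable_EFinP; apply: measurableT_comp => //.
    by apply: measurable_prodf => j; exact: mg.
    by apply: integral_ge0.
  have /integrableP[_ i1] := ig'; have /integrableP[_ i2] := ig ord0.
  by apply: lte_mul_pinfty => //; rewrite ?ge0_fin_numE//; exact: integral_ge0.
split; first exact: integrable_row_cons.
rewrite integral_row_cons// -integral12_prod_meas1// /fubini_F.
have i0 : (\int[leb]_t (g ord0 t)%:E)%E = (\int[leb]_t g ord0 t)%:E.
  by rewrite /Rintegral fineK//; apply: integrable_fin_num => //; exact: ig.
under eq_integral.
  move=> x _; under eq_integral do rewrite /= E EFinM.
  rewrite integralZl//; last exact: ig.
  rewrite i0.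
  over.
rewrite integralZr// Ig' -EFinM big_ord_recl mulrC.
by congr (_ * _)%:E.
Qed.

(** The sigma-algebra is generated by the coordinates rather than by the open sets; an open set is
    recovered as the union of the rational boxes it contains, which [unpickle] enumerates. *)
Lemma continuous_row_measurable n (f : 'rV[R]_n -> R) : continuous f ->
  measurable_fun setT f.
Proof.
move=> cf; apply: (measurability (@RGenOInfty.G R)).
  exact: RGenOInfty.measurableE.
move=> _ [_ [a ->] <-]; rewrite setTI.
set U := f @^-1` _.
have oU : open U by apply: open_comp; [by move=> x _; exact: cf|exact: interval_open].
pose box (q : {ffun 'I_n -> rat * rat}) : set 'rV[R]_n :=
  cbox (fun j => `]ratr (q j).1, ratr (q j).2[%classic).
pose B k := if @unpickle {ffun 'I_n -> rat * rat} k is Some q then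
  if `[< box q `<=` U >] then box q else set0 else set0.
rewrite (_ : U = \bigcup_k B k).
  apply: bigcupT_measurable => k; rewrite /B.
  case: unpickle => [q|//]; case: ifP => // _.
  by apply: measurable_cbox => j; exact: measurable_itv.
apply/seteqP; split=> [x Ux|x [k _]]; last first.
  by rewrite /B; case: unpickle => [q|//]; case: asboolP => // bU /bU.
have /nbhs_ballP[e /= e0 xe] : nbhs x U by exact: open_nbhs_nbhs.
have qj (j : 'I_n) : exists q : rat * rat,
    [/\ x 0 j - e < ratr q.1, ratr q.1 < x 0 j, x 0 j < ratr q.2 & ratr q.2 < x 0 j + e].
  have [q1 /andP[]] := @rat_in_itvoo R (x 0 j - e) (x 0 j) ltac:(lra).
  have [q2 /andP[]] := @rat_in_itvoo R (x 0 j) (x 0 j + e) ltac:(lra).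
  by exists (q1, q2).
pose q := [ffun j => sval (cid (qj j))].
exists (pickle q) => //; rewrite /B pickleK; case: asboolP => [_|].
  by move=> j /=; rewrite in_itv/= ffunE; case: cid => /= ? [_ -> -> _].
case=> y yq; apply: xe; split=> // i j; rewrite ord1.
have := yq j; rewrite /= in_itv/= ffunE; case: cid => /= ? [h1 h2 h3 h4] /andP[h5 h6].
by rewrite /ball/= ltr_norml; apply/andP; split; lra.
Qed.

(** A side [true] means [a, b[ and a side [false] means ]a, b]. Smoothed indicators built from
    one-sided steps converge at every point to the indicator of such a box, so the faces need no
    separate treatment. *)
Definition hbox n (s : 'I_n -> bool) (a b : 'I_n -> R) : set 'rV[R]_n :=
  cbox (fun j => [set` Interval (BSide (s j) (a j)) (BSide (s j) (b j))]).

Definition obox n (l u : 'I_n -> R) : set 'rV[R]_n :=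
  cbox (fun j => `]l j, u j[%classic).

Lemma measurable_obox n (l u : 'I_n -> R) : measurable (obox l u).
Proof. by apply: measurable_cbox => j; exact: measurable_itv. Qed.

Lemma measurable_hbox n s (a b : 'I_n -> R) : measurable (hbox s a b).
Proof. by apply: measurable_cbox => j; exact: measurable_itv. Qed.

(** The pi-system of the Dynkin argument below: these sets generate the sigma-algebra and cut a
    half-open box in a half-open box with the same sides. *)
Definition rays n (s : 'I_n -> bool) : set (set 'rV[R]_n) :=
  [set A | exists a, A = cbox (fun j => [set` Interval (BSide (s j) (a j)) +oo%O])].

Lemma raysI n s : setI_closed (@rays n s).
Proof.
move=> _ _ [a ->] [b ->]; exists (fun j => Num.max (a j) (b j)).
apply/seteqP; split=> [x [xa xb] j|x xab].
  have := xa j; have := xb j; rewrite /= !in_itv/= !andbT.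
  by case: (s j); rewrite /= ?ge_max ?gt_max => -> ->.
have H j : (BSide (s j) (a j) <= BLeft (x 0 j))%O /\ (BSide (s j) (b j) <= BLeft (x 0 j))%O.
  have := xab j; rewrite /= in_itv/= andbT.
  by case: (s j); rewrite /= ?ge_max ?gt_max => /andP[]; rewrite !bnd_simp.
split=> j; have [] := H j; rewrite /= in_itv/= andbT;
  by case: (s j); rewrite !bnd_simp.
Qed.

Lemma itv_bndy_measurableE (s : bool) :
  @measurable _ (measurableTypeR R) =
  <<s [set A : set R | exists a, A = [set` Interval (BSide s a) +oo%O]] >>.
Proof. by case: s; [exact: RGenCInfty.measurableE|exact: RGenOInfty.measurableE]. Qed.

(** A ray in one coordinate is the union over k of product rays whose other endpoints are -k. *)
Lemma rays_measurableE n (s : 'I_n -> bool) :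
  @measurable _ 'rV[R]_n = <<s @rays n s >>.
Proof.
apply/seteqP; split; last first.
  apply: smallest_sub; first exact: sigma_algebra_measurable.
  by move=> _ [a ->]; apply: measurable_cbox => j; exact: measurable_itv.
apply: smallest_sub; first exact: smallest_sigma_algebra.
rewrite -bigcup_seq; apply: bigcup_sub => j _ _ [Y mY <-]; rewrite setTI.
pose T := g_sigma_algebraType (@rays n s).
suff : measurable_fun [set: T] (fun x : T => (x : 'rV[R]_n) 0 j : measurableTypeR R).
  by move=> /(_ measurableT _ mY); rewrite setTI.
apply: (measurability _ (itv_bndy_measurableE (s j))) => _ [_ [a ->] <-].
rewrite setTI (_ : _ @^-1` _ = \bigcup_k cbox (fun i =>
    [set` Interval (BSide (s i) (if i == j then a else - k%:R)) +oo%O])).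
  apply: bigcupT_measurable => k; apply: sub_sigma_algebra.
  by exists (fun i => if i == j then a else - k%:R).
apply/seteqP; split=> [x /= xa|x [k _ /(_ j)]]; last by rewrite eqxx.
exists (\max_i (Num.trunc (`|(x : 'rV[R]_n) 0%R i| : R)).+1)%N => // i /=.
case: eqP => [-> //|_]; rewrite in_itv/= andbT.
set m := (\max_i _)%N.
suff : - m%:R < (x : 'rV[R]_n) 0 i by case: (s i) => //= /ltW.
rewrite ltrNl (le_lt_trans (ler_norm _))// normrN.
by rewrite (lt_le_trans (truncnS_gt _))// ler_nat; exact: leq_bigmax.
Qed.

Lemma hboxI_ray n s (a b c : 'I_n -> R) :
  cbox (fun j => [set` Interval (BSide (s j) (c j)) +oo%O]) `&` hbox s a b =
  hbox s (fun j => Num.max (c j) (a j)) b.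
Proof.
apply/seteqP; split=> [x [xc xa] j|x xab].
  have := xc j; have := xa j; rewrite /= !in_itv/= !andbT.
  by case: (s j); rewrite /= ?ge_max ?gt_max => /andP[-> ->] ->.
split=> j; have := xab j; rewrite /= !in_itv/= ?andbT;
by case: (s j); rewrite /= ?ge_max ?gt_max => /andP[/andP[h1 h2] h3];
  rewrite ?h1 ?h2 ?h3.
Qed.

Lemma hbox_eq0 n s (a b : 'I_n -> R) j : b j <= a j -> hbox s a b = set0.
Proof.
move=> ba; apply/seteqP; split=> // x /(_ j); rewrite /= in_itv/=.
by case: (s j) => /= /andP[h1 h2]; lra.
Qed.

(** Dynkin induction extends the vanishing from boxes to all measurable subsets of a slightly
    smaller box, so [w] is null almost everywhere there; countably many smaller boxes exhaust the
    open one. *)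
Lemma integral_boxes_eq0 n (l u : 'I_n -> R) s (w : 'rV[R]_n -> R) :
  (mu n).-integrable (obox l u) (EFin \o w) ->
  (forall a b, (forall j, [/\ l j < a j, a j < b j & b j < u j]) ->
    (\int[mu n]_(x in hbox s a b) (w x)%:E = 0)%E) ->
  {ae mu n, forall x, obox l u x -> w x = 0}.
Proof.
move=> iw w0.
have [e [k0 eE]] : exists e : nat -> R, (forall k, 0 < e k) /\ forall k, e k = k.+1%:R^-1.
  by exists (fun k => k.+1%:R^-1); split=> // k; rewrite invr_gt0.
(* The hypothesis speaks only of boxes that stay away from the faces of [obox l u], hence the margin
   [e k] = 1/(k+1). *)
pose Q k := hbox s (fun j => l j + e k) (fun j => u j - e k).
have QO k : Q k `<=` obox l u.
  move=> x Qx j; have := Qx j; have := k0 k; rewrite /= !in_itv/=.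
  move: (e k) => f; move: (x 0 j) (l j) (u j) => y a b.
  by case: (s j) => /= k0' /andP[h1 h2]; apply/andP; split; lra.
have mQ k : measurable (Q k) by exact: measurable_hbox.
have iQ k : (mu n).-integrable (Q k) (EFin \o w).
  by apply: integrableS iw => //; exact: measurable_obox.
have E0 k E : measurable E -> (\int[mu n]_(x in E `&` Q k) (w x)%:E = 0)%E.
  have iE F : measurable F -> (mu n).-integrable (F `&` Q k) (EFin \o w).
    by move=> mF; apply: integrableS (iQ k) => //; exact: measurableI.
  have IU F G : measurable F -> measurable G -> F `&` G = set0 ->
     (\int[mu n]_(x in (F `|` G) `&` Q k) (w x)%:E = \int[mu n]_(x in F `&` Q k) (w x)%:E +
        \int[mu n]_(x in G `&` Q k) (w x)%:E)%E.
    move=> mF mG FG; rewrite setIUl integral_setU_EFin//.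
    - exact: measurableI.
    - exact: measurableI.
    - rewrite -setIUl; apply/measurable_EFinP.
      exact: measurable_int (iE _ (measurableU _ _ mF mG)).
    - by apply/disj_set2P; rewrite setIACA FG set0I.
  have QT : (\int[mu n]_(x in Q k) (w x)%:E = 0)%E.
    have [ab|] := pselect (forall j, l j + e k < u j - e k).
      by apply: w0 => j; have := k0 k; have := ab j; split; lra.
    move=> /existsNP[j /negP]; rewrite -leNgt => ba.
    by rewrite /Q (hbox_eq0 _ ba) integral_set0.
  move=> mE; have : <<s @rays n s >> E by rewrite -rays_measurableE.
  move: E {mE}; apply: (@dynkin_induction _ _ (@rays n s)).
  - exact: rays_measurableE.
  - exact: raysI.
  - by rewrite setTI.
  - move=> _ [c ->]; rewrite /Q hboxI_ray.
    set a' := (fun j => _).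
    have [ab|] := pselect (forall j, a' j < u j - e k).
      apply: w0 => j; have := k0 k; have := ab j; split=> //; last lra.
      by rewrite /a' lt_max; apply/orP; right; lra.
    move=> /existsNP[j /negP]; rewrite -leNgt => ba.
    by rewrite (hbox_eq0 _ ba) integral_set0.
  - move=> S mS S0; have := IU S (~` S) mS (measurableC mS) (setICr _).
    by rewrite setUv setTI QT S0 add0e.
  - move=> F mF tF F0; rewrite setI_bigcupl integral_bigcup//; last 3 first.
    + exact: trivIset_setIr.
    + by move=> i; exact: measurableI.
    + by rewrite -setI_bigcupl; apply: iE; exact: bigcupT_measurable.
    by rewrite eseries0.
have aeQ k : {ae mu n, forall x, Q k x -> w x = 0}.
  have := @integral_ae_eq _ _ _ (mu n) (Q k) (mQ k) (cst 0%E) (EFin \o w) (iQ k)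
    (measurable_cst _).
  move=> H; have {}H : ae_eq (mu n) (Q k) (EFin \o w) (cst 0%E).
    apply: H => E EQ mE; rewrite integral0 -(E0 k E mE).
    by rewrite setIidl.
  by apply: filterS H => x H /H /= -[].
have : {ae mu n, forall x k, Q k x -> w x = 0} by exact: ae_foralln.
apply: filterS => x xQ xO.
have [k hk] : exists k : nat, forall j, k.+1%:R^-1 < x 0 j - l j /\ k.+1%:R^-1 < u j - x 0 j.
  pose d j := Num.min (x 0 j - l j) (u j - x 0 j).
  have d0 j : 0 < d j.
    by have := xO j; rewrite /d lt_min /= in_itv/= => /andP[h1 h2]; apply/andP; split; lra.
  exists (\max_j (Num.trunc ((d j)^-1)))%N => j; apply/andP; rewrite -lt_min -/(d j).
  rewrite -[ltRHS]invrK ltf_pV2 ?posrE ?invr_gt0//.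
  by rewrite (lt_le_trans (truncnS_gt _))// ler_nat ltnS; exact: (leq_bigmax j).
apply: (xQ k) => j; have [h1 h2] := hk j; rewrite -eE in h1 h2; rewrite /= in_itv/=.
by case: (s j); apply/andP; split; rewrite /=; lra.
Qed.

End RowMeasure.

(** * The space L_2 *)

Section L2.
Context (R : realType) (n : nat).
Notation point := 'rV[R]_n.+1.
Notation mu := (@lebesgue_row R n.+1).
Variable U : set point.
Hypothesis mU : measurable U.
Implicit Types f g : point -> R.

Lemma memL2_integrableM f g : memL2 U f -> memL2 U g ->
  mu.-integrable U (EFin \o (fun x => f x * g x)).
Proof.
move=> [mf f2] [mg g2].
apply: (@le_integrable _ _ _ mu U mU _ (EFin \o (fun x => f x ^+ 2 + g x ^+ 2))).
- by apply/measurable_EFinP; exact: measurable_funM.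
- move=> x _ /=; rewrite lee_fin.
  have := sqr_ge0 (`|f x| - `|g x|); rewrite sqrrB !real_normK ?num_real// => h.
  have : `|f x| * `|g x| + `|f x| * `|g x| <= f x ^+ 2 + g x ^+ 2 by lra.
  have := sqr_ge0 (f x); have := sqr_ge0 (g x); have := normr_ge0 (f x * g x).
  rewrite normrM => h1 h2 h3 h4.
  by rewrite (ger0_norm (addr_ge0 h3 h2)); lra.
- have i2 (h : point -> R) : measurable_fun U h -> (\int[mu]_(x in U) (h x ^+ 2)%:E < +oo)%E ->
      mu.-integrable U (EFin \o (fun x => h x ^+ 2)).
    move=> mh h2; apply/integrableP; split.
      by apply/measurable_EFinP; exact: measurable_funX.
    rewrite (eq_integral (fun x => (h x ^+ 2)%:E))// => x _.
    by rewrite /= ger0_norm// sqr_ge0.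
  rewrite (_ : EFin \o _ = ((EFin \o (fun x => f x ^+ 2)%R) \+ (EFin \o (fun x => g x ^+ 2)%R))%E)//.
  by apply: integrableD => //; exact: i2.
Qed.

Lemma memL2_ext f g : (forall x, f x = g x) -> memL2 U f -> memL2 U g.
Proof. by move=> /funext ->. Qed.

Lemma memL2P f : measurable_fun U f -> mu.-integrable U (EFin \o (fun x => f x * f x)) ->
  memL2 U f.
Proof.
move=> mf /integrableP[_ fi]; split => //; apply: le_lt_trans fi.
rewrite le_eqVlt; apply/orP; left; apply/eqP; apply: eq_integral => x _ /=.
by rewrite -expr2 ger0_norm// sqr_ge0.
Qed.

Lemma memL2D f g : memL2 U f -> memL2 U g -> memL2 U (fun x => f x + g x).
Proof.
move=> mf mg; apply: memL2P; first by apply: measurable_funD; [case: mf|case: mg].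
rewrite (_ : EFin \o _ = ((EFin \o (fun x => f x * f x)%R) \+ (EFin \o (fun x => g x * g x)%R)
   \+ (EFin \o (fun x => f x * g x)%R) \+ (EFin \o (fun x => f x * g x)%R))%E); last first.
  by apply/funext => x /=; rewrite -!EFinD; congr EFin; ring.
by do 3 (apply: integrableD => //; last exact: memL2_integrableM);
  exact: memL2_integrableM.
Qed.

Lemma memL2M_bounded (b : point -> R) f M : measurable_fun U b -> (forall x, U x -> `|b x| <= M) ->
  memL2 U f -> memL2 U (fun x => b x * f x).
Proof.
move=> mb hb mf; apply: memL2P; first by apply: measurable_funM => //; case: mf.
apply: (@le_integrable _ _ _ mu U mU _ (fun x => (M * M)%:E * (EFin \o (fun x => f x * f x)%R) x)%E).
- apply/measurable_EFinP; apply: measurable_funM; apply: measurable_funM => //; by case: mf.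
- move=> x Ux /=; rewrite lee_fin mulrACA normrM [leRHS]normrM.
  rewrite ler_wpM2r// normrM (le_trans _ (ler_norm _))//.
  by apply: ler_pM => //; exact: hb.
- by apply: integrableZl => //; exact: memL2_integrableM.
Qed.

Lemma memL2Z c f : memL2 U f -> memL2 U (fun x => c * f x).
Proof. by apply: (@memL2M_bounded (fun=> c) _ `|c|). Qed.

Lemma memL20 : memL2 U (fun=> 0).
Proof.
split=> //; under eq_integral do rewrite expr0n; by rewrite integral0.
Qed.

Lemma memL2_sum (I : Type) (s : seq I) (P : pred I) (F : I -> point -> R) :
  (forall i, memL2 U (F i)) -> memL2 U (fun x => \sum_(i <- s | P i) F i x).
Proof.
move=> mF; elim: s => [|i s ih].
  by apply: memL2_ext memL20 => x; rewrite big_nil.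
have [Pi|Pi] := boolP (P i).
  by apply: memL2_ext (memL2D (mF i) ih) => x; rewrite big_cons Pi.
by apply: memL2_ext ih => x; rewrite big_cons (negbTE Pi).
Qed.

Lemma ipL2Dl f g w : memL2 U f -> memL2 U g -> memL2 U w ->
  ipL2 U (fun x => f x + g x) w = ipL2 U f w + ipL2 U g w.
Proof.
move=> mf mg mw; rewrite /ipL2 -RintegralD//; [|exact: memL2_integrableM..].
by apply: eq_Rintegral => x _; rewrite mulrDl.
Qed.

Lemma ipL2Zl c f w : memL2 U f -> memL2 U w ->
  ipL2 U (fun x => c * f x) w = c * ipL2 U f w.
Proof.
move=> mf mw; rewrite /ipL2 -RintegralZl//; last exact: memL2_integrableM.
by apply: eq_Rintegral => x _; rewrite mulrA.
Qed.

Lemma ipL2C f g : ipL2 U f g = ipL2 U g f.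
Proof. by apply: eq_Rintegral => x _; rewrite mulrC. Qed.

Lemma ipL2_ge0 f : 0 <= ipL2 U f f.
Proof. by apply: Rintegral_ge0 => x _; rewrite -expr2 sqr_ge0. Qed.

Lemma normL2_sq f : normL2 U f ^+ 2 = ipL2 U f f.
Proof. by rewrite sqr_sqrtr// ipL2_ge0. Qed.

Lemma normL2_ge0 f : 0 <= normL2 U f.
Proof. exact: sqrtr_ge0. Qed.

Lemma ipL2_ae f g w : {ae mu, forall x, U x -> f x = g x} ->
  memL2 U f -> memL2 U g -> memL2 U w -> ipL2 U f w = ipL2 U g w.
Proof.
move=> fg [mf _] [mg _] [mw _]; rewrite /ipL2 /Rintegral; congr fine.
apply: ae_eq_integral => //.
- by apply/measurable_EFinP; exact: measurable_funM.
- by apply/measurable_EFinP; exact: measurable_funM.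
- by apply: filterS fg => x fg /fg ->.
Qed.

Lemma ipL2_ae2 f g f' g' : {ae mu, forall x, U x -> f x = f' x} ->
  {ae mu, forall x, U x -> g x = g' x} ->
  memL2 U f -> memL2 U g -> memL2 U f' -> memL2 U g' -> ipL2 U f g = ipL2 U f' g'.
Proof.
move=> ff gg mf mg mf' mg'.
by rewrite (@ipL2_ae f f')// ipL2C (@ipL2_ae g g')// ipL2C.
Qed.

Lemma ipL2_expand c f g : memL2 U f -> memL2 U g ->
  ipL2 U (fun x => f x + c * g x) (fun x => f x + c * g x) =
  ipL2 U f f + 2 * c * ipL2 U f g + c ^+ 2 * ipL2 U g g.
Proof.
move=> mf mg; have mcg := memL2Z c mg; have mfg := memL2D mf mcg.
have E w : memL2 U w -> ipL2 U w (fun x => f x + c * g x) = ipL2 U w f + c * ipL2 U w g.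
  by move=> mw; rewrite ipL2C ipL2Dl// ipL2Zl// ipL2C (ipL2C g).
by rewrite E// (ipL2C _ f) (ipL2C _ g) !E// (ipL2C g f); ring.
Qed.

Lemma cauchy_schwarz f g : memL2 U f -> memL2 U g ->
  `|ipL2 U f g| <= normL2 U f * normL2 U g.
Proof.
move=> mf mg; rewrite -ler_sqr ?nnegrE ?mulr_ge0 ?normL2_ge0//.
rewrite exprMn !normL2_sq real_normK ?num_real//.
have H c := ipL2_ge0 (fun x => f x + c * g x).
set a := ipL2 U f f; set b := ipL2 U f g; set d := ipL2 U g g.
have {}H c : 0 <= a + 2 * c * b + c ^+ 2 * d by rewrite -ipL2_expand.
have d0 : 0 <= d by exact: ipL2_ge0.
have [d0'|dn] := eqVneq d 0.
  (* When d = 0 the quadratic polynomial is affine in c; this value of c would make it equal to -1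
     unless b = 0. *)
  rewrite d0' mulr0; have := H (- (a + 1) / (2 * b)).
  rewrite d0' mulr0 addr0; have [->|b0] := eqVneq b 0; first by rewrite expr0n.
  by rewrite (_ : a + _ = -1); [lra|field; rewrite b0].
have := H (- b / d); rewrite (_ : a + _ + _ = (a * d - b ^+ 2) / d); last by field.
rewrite pmulr_lge0 ?subr_ge0// invr_gt0 lt_neqAle eq_sym dn//.
Qed.

Lemma normL2D f g : memL2 U f -> memL2 U g ->
  normL2 U (fun x => f x + g x) <= normL2 U f + normL2 U g.
Proof.
move=> mf mg; rewrite -ler_sqr ?nnegrE ?addr_ge0 ?normL2_ge0//.
have := ipL2_expand 1 mf mg.
rewrite (_ : (fun x => _) = (fun x => f x + g x)); last first.
  by apply/funext => x; rewrite mul1r.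
rewrite sqrrD !normL2_sq => ->.
have := cauchy_schwarz mf mg; have := ler_norm (ipL2 U f g); lra.
Qed.

Lemma normL2_le f g : memL2 U f -> memL2 U g ->
  {ae mu, forall x, U x -> `|f x| <= `|g x|} -> normL2 U f <= normL2 U g.
Proof.
move=> mf mg fg; rewrite ler_wsqrtr// /ipL2 /Rintegral fine_le//.
- by apply: integrable_fin_num => //; exact: memL2_integrableM.
- by apply: integrable_fin_num => //; exact: memL2_integrableM.
apply: ae_ge0_le_integral => //.
- by move=> x _; rewrite lee_fin -expr2 sqr_ge0.
- by apply/measurable_EFinP; apply: measurable_funM; case: mf.
- by move=> x _; rewrite lee_fin -expr2 sqr_ge0.
- by apply/measurable_EFinP; apply: measurable_funM; case: mg.
- apply: filterS fg => x fg /fg h; rewrite lee_fin -!expr2.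
  by rewrite -(real_normK (num_real (f x))) -(real_normK (num_real (g x))) ler_sqr ?nnegrE.
Qed.

Lemma normL2_ae f g : memL2 U f -> memL2 U g ->
  {ae mu, forall x, U x -> f x = g x} -> normL2 U f = normL2 U g.
Proof. by move=> mf mg fg; rewrite /normL2 (ipL2_ae2 fg fg). Qed.

(** Membership is carried along with the bound because [normL2] is defined through [fine], which
    sends an infinite integral to 0: a bound on the norm alone would say nothing. *)
Definition L2le f M := memL2 U f /\ normL2 U f <= M.

Lemma L2le_ge0 f M : L2le f M -> 0 <= M.
Proof. by move=> [_]; apply: le_trans (normL2_ge0 _). Qed.

Lemma L2le_ext f g M : (forall x, f x = g x) -> L2le f M -> L2le g M.
Proof. by move=> /funext ->. Qed.

Lemma L2le_trans f M N : M <= N -> L2le f M -> L2le f N.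
Proof. by move=> MN [mf fM]; split=> //; exact: le_trans MN. Qed.

Lemma L2leD f g M N : L2le f M -> L2le g N -> L2le (fun x => f x + g x) (M + N).
Proof.
move=> [mf fM] [mg gN]; split; first exact: memL2D.
by apply: (le_trans (normL2D mf mg)); exact: lerD.
Qed.

Lemma normL2Z c f : memL2 U f -> normL2 U (fun x => c * f x) = `|c| * normL2 U f.
Proof.
move=> mf; rewrite /normL2 ipL2Zl//; last exact: memL2Z.
rewrite ipL2C ipL2Zl// mulrA -expr2 sqrtrM ?sqr_ge0//.
by rewrite sqrtr_sqr.
Qed.

Lemma L2leZ c f M : L2le f M -> L2le (fun x => c * f x) (`|c| * M).
Proof.
move=> [mf fM]; split; first exact: memL2Z.
by rewrite normL2Z// ler_wpM2l.
Qed.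

Lemma L2le0 : L2le (fun=> 0) 0.
Proof.
split; first exact: memL20.
rewrite /normL2 /ipL2; under eq_Rintegral do rewrite mulr0.
by rewrite Rintegral_cst// mul0r sqrtr0.
Qed.

Lemma L2le_sum (I : Type) (s : seq I) (P : pred I) (F : I -> point -> R) (M : I -> R) :
  (forall i, L2le (F i) (M i)) ->
  L2le (fun x => \sum_(i <- s | P i) F i x) (\sum_(i <- s | P i) M i).
Proof.
move=> FM; elim: s => [|i s ih].
  by rewrite big_nil; apply: L2le_ext L2le0 => x; rewrite big_nil.
rewrite big_cons; have [Pi|Pi] := boolP (P i).
  by apply: L2le_ext (L2leD (FM i) ih) => x; rewrite big_cons Pi.
by apply: L2le_ext ih => x; rewrite big_cons (negbTE Pi).
Qed.

Lemma L2le_ae f g M : measurable_fun U g -> {ae mu, forall x, U x -> f x = g x} ->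
  L2le f M -> L2le g M.
Proof.
move=> mg fg [mf fM]; have mg2 : memL2 U g.
  split=> //; have [_] := mf; apply: le_lt_trans.
  rewrite le_eqVlt; apply/orP; left; apply/eqP; apply: ae_eq_integral => //.
  - by apply/measurable_EFinP; exact: measurable_funX.
  - by apply/measurable_EFinP; apply: measurable_funX; case: mf.
  - by apply: filterS fg => x fg /fg ->.
by split=> //; rewrite -(normL2_ae mf mg2 fg).
Qed.

(** The factor is bounded only almost everywhere, as weak derivatives are; truncating it at -C and C
    changes the product on a null set and reduces to a factor bounded everywhere. *)
Lemma L2leM (b : point -> R) f C M : measurable_fun U b -> 0 <= C ->
  {ae mu, forall x, U x -> `|b x| <= C} ->
  L2le f M -> L2le (fun x => b x * f x) (C * M).
Proof.
move=> mb C0 hb [mf fM].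
pose b' x := Num.max (- C) (Num.min C (b x)).
have mb' : measurable_fun U b'.
  by apply: measurable_maxr => //; apply: measurable_minr.
have hb' x : `|b' x| <= C.
  rewrite ler_norml /b' le_max lexx/= ge_max ge_min lexx/= andbT; lra.
have bb : {ae mu, forall x, U x -> b' x * f x = b x * f x}.
  apply: filterS hb => x hb /hb; rewrite ler_norml => /andP[h1 h2].
  by congr (_ * _); rewrite /b' min_r// max_r.
have mbf := memL2M_bounded mb' (fun x _ => hb' x) mf.
apply: (L2le_ae _ bb); first by apply: measurable_funM => //; case: mf.
split=> //; apply: (@le_trans _ _ (normL2 U (fun x => C * f x))).
  apply: normL2_le => //; first exact: memL2Z.
  by near=> x => _; rewrite !normrM (ger0_norm C0) ler_wpM2r.
by rewrite normL2Z// (ger0_norm C0) ler_wpM2l.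
Unshelve. all: by end_near. Qed.

Lemma memL2_cst c : (mu U < +oo)%E -> memL2 U (fun=> c).
Proof.
move=> muU; split=> //; rewrite integral_cst//.
by rewrite lte_mul_pinfty// lee_fin sqr_ge0.
Qed.

Lemma memL2_bounded f C : (mu U < +oo)%E -> measurable_fun U f ->
  (forall x, U x -> `|f x| <= C) -> memL2 U f.
Proof.
move=> muU mf fC; apply: memL2_ext (memL2M_bounded mf fC (memL2_cst 1 muU)) => x.
by rewrite mulr1.
Qed.

Lemma memL2_integrable f : (mu U < +oo)%E -> memL2 U f -> mu.-integrable U (EFin \o f).
Proof.
move=> muU mf; have := memL2_integrableM mf (memL2_cst 1 muU).
by rewrite (_ : (fun x => _) = f)//; apply/funext => x; rewrite mulr1.
Qed.

End L2.

(** * Test functions of product form *)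

Section TestFunctions.
Context (R : realType).

Lemma compact_support_bounded (T : topologicalType) (f : T -> R) (K : set T) :
  continuous f -> compact K -> (forall x, ~ K x -> f x = 0) ->
  exists2 M, 0 <= M & forall x, `|f x| <= M.
Proof.
move=> cf cK f0; have [K0|/set0P K0] := eqVneq K set0.
  by exists 0 => // x; rewrite f0 ?normr0// K0.
have cn : {within K, continuous (fun x => `|f x|)}.
  apply: continuous_subspaceT => x.
  by apply: continuous_comp; [exact: cf|exact: norm_continuous].
have [c _ hc] := compact_EVT_max K0 cK cn.
exists `|f c| => // x; have [Kx|nKx] := pselect (K x); first by apply: hc; rewrite inE.
by rewrite f0// normr0.
Qed.

Lemma cvg_bigprod (T : Type) (F : set_system T) (FF : Filter F) (I : Type) (s : seq I)
    (f : I -> T -> R) (l : I -> R) :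
  (forall i, f i x @[x --> F] --> l i) ->
  \prod_(i <- s) f i x @[x --> F] --> \prod_(i <- s) l i.
Proof.
move=> fl; elim: s => [|i s ih].
  rewrite big_nil; under eq_fun do rewrite big_nil; exact: cvg_cst.
by rewrite big_cons; under eq_fun do rewrite big_cons; exact: cvgM.
Qed.

Lemma continuous_prodf n (g : 'I_n -> R -> R) :
  (forall j, continuous (g j)) -> continuous (prodf g).
Proof.
move=> cg x; rewrite /prodf; apply: (@cvg_bigprod _ (nbhs x)) => j.
apply: (@continuous_comp _ _ _ (fun y : 'rV[R]_n => y 0 j) (g j)).
  exact: coord_continuous.
exact: cg.
Qed.

Lemma is_derive_line (V : normedModType R) (f : V -> R) (x v : V) (d : R) :
  is_derive (0 : R) 1 (fun h : R => f (h *: v + x)) d -> is_derive x v f d.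
Proof.
have E : (fun h : R => h^-1 *: ((f \o shift x) (h *: v) - f x)) =
  (fun h => h^-1 *: (((fun h : R => f (h *: v + x)) \o shift 0) (h *: (1 : R))
     - f (0 *: v + x))).
  by apply/funext => h /=; rewrite scale0r add0r addr0 [h *: 1]mulr1.
by move=> [d1 d2]; apply: DeriveDef; rewrite /derivable /derive E.
Qed.

Variable n : nat.
Notation point := 'rV[R]_n.+1.
Implicit Types g : 'I_n.+1 -> R -> R.

Lemma is_derive_prodf i g (x : point) : smooth1 (g i) ->
  is_derive x (delta_mx 0 i) (prodf g)
    (prodf (fun j => if j == i then derive1 (g j) else g j) x).
Proof.
move=> sg; apply: is_derive_line.
pose c := \prod_(j | j != i) g j (x 0 j).
rewrite (_ : (fun h : R => _) = (fun h => c * g i (1 * h + x 0 i))); last first.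
  apply/funext => h; rewrite /prodf (bigD1 i)//= mulrC; congr (_ * _).
    apply: eq_bigr => j ji; rewrite !mxE eqxx/=.
    by rewrite (negbTE ji) mulr0 add0r.
  by rewrite !mxE !eqxx mulr1 mul1r.
rewrite (_ : prodf _ x = c * (1 * derive1 (g i) (1 * 0 + x 0 i))); last first.
  rewrite /prodf (bigD1 i)//= eqxx mulrC mul1r mulr0 add0r; congr (_ * _).
  by apply: eq_bigr => j ji; rewrite (negbTE ji).
exact: (@is_deriveZ _ _ _ (fun h : R => g i (1 * h + x 0 i)) c 0 1 _
  (is_derive_affine (smooth1_is_derive _ sg))).
Qed.

Lemma partial_prodf i g : smooth1 (g i) ->
  partial i (prodf g) = prodf (fun j => if j == i then derive1 (g j) else g j).
Proof.
move=> sg; apply/funext => x; rewrite /partial.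
by have [] := is_derive_prodf x sg.
Qed.

(** On products a derivative depends only on how often each coordinate occurs in [s], so the order
    of differentiation is immaterial. *)
Lemma partials_prodf s g : (forall j, smooth1 (g j)) ->
  partials s (prodf g) = prodf (fun j => derive1n (count_mem j s) (g j)).
Proof.
move=> sg; elim: s => [//|i s ih].
rewrite [LHS]/= -/(partials s _) ih partial_prodf; last exact: smooth1_derive1n.
congr prodf; apply/funext => j; rewrite /= [i == j]eq_sym.
by case: eqVneq => _; rewrite ?add1n ?add0n ?derive1nS.
Qed.

Variables l u : 'I_n.+1 -> R.

Definition ptest g := (forall j, smooth1 (g j)) /\
  forall j, exists a b, [/\ l j < a, b < u j & forall y, ~ (a <= y <= b) -> g j y = 0].

Lemma ptest_support g : ptest g -> exists K, [/\ compact K, K `<=` obox l u &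
  forall x, ~ K x -> prodf g x = 0].
Proof.
move=> [sg /choice[a /choice[b ab]]].
exists (cbox (fun j => `[a j, b j]%classic)); split.
- by apply: rV_compact => j; exact: segment_compact.
- move=> x Kx j; have := Kx j; have [la bu _] := ab j; rewrite /= !in_itv/=.
  by move=> /andP[h1 h2]; apply/andP; split; lra.
- move=> x /existsNP[j xj]; rewrite /prodf (bigD1 j)//=.
  have [_ _ ->] := ab j; first by rewrite mul0r.
  by move=> h; apply: xj; rewrite /= in_itv.
Qed.

Lemma test_function_prodf g : ptest g -> test_function (obox l u) (prodf g).
Proof.
move=> pg; split; last exact: ptest_support.
have [sg _] := pg; move=> s; rewrite partials_prodf//; split.
  by apply: continuous_prodf => j; exact/smooth1_continuous/smooth1_derive1n.
move=> i x; have [//] := @is_derive_prodf i (fun j => derive1n (count_mem j s) (g j)) x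
  (smooth1_derive1n _ (sg i)).
Qed.

Lemma ptest_derive1n g (m : 'I_n.+1 -> nat) : ptest g -> ptest (fun j => derive1n (m j) (g j)).
Proof.
move=> [sg hg]; split=> [j|j]; first exact: smooth1_derive1n.
have [a [b [la bu g0]]] := hg j; exists a, b; split=> // y nab.
rewrite (@derive1n_local R (~` `[a, b]%classic) _ _ (fun=> 0)).
- by case: (m j) => // k; rewrite derive1n_cst.
- by rewrite openC; exact: interval_closed.
- by move=> x /= nx; apply: g0; rewrite in_itv in nx.
- by rewrite /= in_itv.
Qed.

Lemma ptest_bounded g : ptest g -> exists2 M, 0 <= M & forall x, `|prodf g x| <= M.
Proof.
move=> pg; have [K [cK _ K0]] := ptest_support pg.
apply: compact_support_bounded cK K0.
by apply: continuous_prodf => j; apply/smooth1_continuous; case: pg.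
Qed.

Lemma partial_local U i (f f' : point -> R) : open U ->
  (forall x, U x -> f x = f' x) -> forall x, U x -> partial i f x = partial i f' x.
Proof.
move=> oU ff x Ux; apply: near_eq_derive.
by near=> y; apply: ff; near: y; exact: open_nbhs_nbhs.
Unshelve. all: by end_near. Qed.

Lemma partial_cst i (c : R) : partial i (fun=> c : R) = (fun _ : point => 0).
Proof. by apply/funext => x; rewrite /partial derive_cst. Qed.

Lemma test_function_partials (U : set point) s f :
  test_function U f -> test_function U (partials s f).
Proof.
move=> [cf [K [cK KU f0]]]; split.
  by move=> s'; rewrite /partials -foldr_cat; exact: cf.
exists K; split=> //; elim: s => [//|i s ih] x nKx.
rewrite /= (@partial_local (~` K) i _ (fun=> 0))//; first by rewrite partial_cst.
rewrite openC; apply: compact_closed => //; exact: norm_hausdorff.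
Qed.

Lemma test_function_bounded (U : set point) f : test_function U f ->
  exists2 M, 0 <= M & forall x, `|f x| <= M.
Proof.
move=> [cf [K [cK _ f0]]]; apply: compact_support_bounded cK f0.
by have [] := cf [::].
Qed.

Lemma test_function_measurable (U D : set point) f : test_function U f ->
  measurable_fun D f.
Proof.
move=> [/(_ [::])[cf _] _]; apply: measurable_funTS.
exact: continuous_row_measurable.
Qed.

End TestFunctions.

(** * Smoothed indicators of boxes and the fundamental lemma *)

Section Fundamental.
Context (R : realType) (n : nat).
Notation point := 'rV[R]_n.+1.
Notation mu := (@lebesgue_row R n.+1).
Variables l u : 'I_n.+1 -> R.
Notation Ob := (obox l u).

Lemma obox_fin : (mu Ob < +oo)%E.
Proof.
rewrite lebesgue_row_cbox => [|j]; last exact: measurable_itv.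
rewrite (eq_bigr (fun j => (Num.max 0 (u j - l j))%:E)) ?prodEFin ?ltry// => j _.
rewrite lebesgue_measure_itv/= lte_fin; case: ltP => h; last by rewrite max_l// subr_le0.
by rewrite -EFinB max_r// subr_ge0 ltW.
Qed.

(** The transition lies in ]-1, 0[ when [s] is true and in ]0, 1[ otherwise, so E(0) is 1 or 0
    accordingly. This value decides which faces belong to the limiting box. *)
Definition is_step (s : bool) (E : R -> R) :=
  (forall y, y <= - s%:R + 1/16 -> E y = 0) /\ (forall y, - s%:R + 15/16 <= y -> E y = 1).

Lemma step_cvg s E (t : nat -> R) a z : is_step s E -> (forall k, 0 < t k) ->
  t @ \oo --> 0 ->
  E ((t k)^-1 * (z - a)) @[k --> \oo] --> ((if s then a <= z else a < z)%:R : R).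
Proof.
move=> [E0 E1] t0 tc.
have [za|za|->] := ltgtP z a.
- rewrite (_ : (if s then _ else _) = false); last by case: s {E0 E1}; lra.
  apply: cvg_near_cst; near=> k; apply: E0.
  suff : (t k)^-1 * (z - a) <= - 1 by case: (s); rewrite /=; lra.
  rewrite ler_pdivrMl//; suff : t k < a - z by lra.
  by near: k; apply: (cvgr_lt 0 tc); rewrite subr_gt0.
- rewrite (_ : (if s then _ else _) = true); last by case: s {E0 E1}; lra.
  apply: cvg_near_cst; near=> k; apply: E1.
  suff : 1 <= (t k)^-1 * (z - a) by case: (s); rewrite /=; lra.
  rewrite ler_pdivlMl//; suff : t k < z - a by lra.
  by near: k; apply: (cvgr_lt 0 tc); rewrite subr_gt0.
- apply: cvg_near_cst; near=> k; rewrite subrr mulr0.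
  by case: (s) E0 E1 => /= E0 E1; [rewrite E1//; lra|rewrite E0//; lra].
Unshelve. all: by end_near. Qed.

Definition stepbox (E : 'I_n.+1 -> R -> R) (t : R) (a b : 'I_n.+1 -> R)
    (j : 'I_n.+1) (z : R) : R :=
  E j (t^-1 * (z - a j)) - E j (t^-1 * (z - b j)).

Lemma stepbox_cvg s E (t : nat -> R) a b (x : point) : (forall j, is_step (s j) (E j)) ->
  (forall k, 0 < t k) -> t @ \oo --> 0 -> (forall j, a j < b j) ->
  prodf (stepbox E (t k) a b) x @[k --> \oo] --> (\1_(hbox s a b) x : R).
Proof.
move=> sE t0 tc ab.
rewrite (_ : \1_ _ x = \prod_j ((if s j then a j <= x 0 j else a j < x 0 j)%:R -
   (if s j then b j <= x 0 j else b j < x 0 j)%:R)); last first.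
  rewrite indicE; have [xh|xh] := pselect (hbox s a b x).
    rewrite mem_set//= big1// => j _; have := xh j; rewrite /= in_itv/=.
    by case: (s j) => /= /andP[-> h]; [rewrite leNgt h|rewrite ltNge h]; rewrite subr0.
  rewrite memNset//=; move/existsNP : xh => [j xj]; rewrite (bigD1 j)//=.
  rewrite (_ : _ - _ = 0) ?mul0r//; move: xj; rewrite /= in_itv/=; have := ab j.
  case: (s j) => /= abj /negP; rewrite negb_and => /orP[h|h].
  - by rewrite (negbTE h) (_ : (b j <= x 0 j) = false) ?subrr//; move: h; lra.
  - by rewrite -leNgt in h; rewrite h (_ : (a j <= x 0 j) = true) ?subrr//; move: h; lra.
  - by rewrite (negbTE h) (_ : (b j < x 0 j) = false) ?subrr//; move: h; lra.
  - by rewrite -ltNge in h; rewrite h (_ : (a j < x 0 j) = true) ?subrr//; move: h; lra.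
by apply: cvg_bigprod => j; apply: cvgB; exact: step_cvg.
Qed.

Lemma hbox_sub s (a b : 'I_n.+1 -> R) : (forall j, l j < a j) -> (forall j, b j < u j) ->
  hbox s a b `<=` Ob.
Proof.
move=> la bu x xh j; have := xh j; have := la j; have := bu j; rewrite /= !in_itv/=.
by case: (s j) => /= h1 h2 /andP[h3 h4]; apply/andP; split; lra.
Qed.

Lemma measurable_stepbox E t (a b : 'I_n.+1 -> R) : (forall j, measurable_fun setT (E j)) ->
  measurable_fun setT (prodf (stepbox E t a b)).
Proof.
move=> mE; apply: measurable_prodf => j; apply: measurable_funB.
  by apply: (measurableT_comp (mE j)); apply: measurable_funM => //; apply: measurable_funB.
by apply: (measurableT_comp (mE j)); apply: measurable_funM => //; apply: measurable_funB.
Qed.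

Lemma stepbox_bound E (M : R) t a b x : 0 <= M -> (forall j y, `|E j y| <= M) ->
  `|prodf (stepbox E t a b) x| <= (M + M) ^+ n.+1.
Proof.
move=> M0 EM; rewrite /prodf normr_prod.
rewrite -[X in _ <= _ ^+ X]card_ord -[leRHS]prodr_const.
apply: ler_prod => j _; rewrite normr_ge0/=.
by apply: (le_trans (ler_normB _ _)); apply: lerD.
Qed.

Lemma stepbox_integral_cvg s E (M : R) (t : nat -> R) a b (w : point -> R) :
  (forall j, is_step (s j) (E j)) -> (forall j, measurable_fun setT (E j)) ->
  (forall j y, `|E j y| <= M) ->
  (forall k, 0 < t k) -> t @ \oo --> 0 ->
  (forall j, [/\ l j < a j, a j < b j & b j < u j]) ->
  mu.-integrable Ob (EFin \o w) ->
  \int[mu]_(x in Ob) (w x * prodf (stepbox E (t k) a b) x) @[k --> \oo] -->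
    \int[mu]_(x in hbox s a b) w x.
Proof.
move=> sE mE EM t0 tc lab iw; have M0 : 0 <= M by exact: le_trans (EM ord0 0).
have mO : measurable Ob by exact: measurable_obox.
have mw : measurable_fun Ob w by apply/measurable_EFinP; exact: measurable_int iw.
have hO : hbox s a b `<=` Ob by apply: hbox_sub => j; have [] := lab j.
have -> : \int[mu]_(x in hbox s a b) w x = \int[mu]_(x in Ob) (w x * \1_(hbox s a b) x).
  rewrite -[in LHS](setIidr hO) Rintegral_mkcondr; apply: eq_Rintegral => x _.
  by rewrite /patch indicE; case: ifP => _; rewrite ?mulr1 ?mulr0.
have id : mu.-integrable Ob (fun x => ((M + M) ^+ n.+1)%:E * (`|(EFin \o w) x|))%E.
  by apply: integrableZl => //; exact: integrable_abse.
have md k : measurable_fun Ob (fun x => (w x * prodf (stepbox E (t k) a b) x)%:E).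
  apply/measurable_EFinP; apply: measurable_funM => //.
  by apply: measurable_funTS; exact: measurable_stepbox.
have dom k x : Ob x -> (`|(w x * prodf (stepbox E (t k) a b) x)%:E| <=
    ((M + M) ^+ n.+1)%:E * (`|(EFin \o w) x|))%E.
  move=> _; rewrite /= -EFinM lee_fin normrM mulrC ler_wpM2r//.
  exact: stepbox_bound.
have cv x : Ob x -> (w x * prodf (stepbox E (t k) a b) x)%:E @[k --> \oo] -->
    (w x * \1_(hbox s a b) x)%:E.
  move=> _; apply: cvg_EFin; first by near=> k.
  apply: cvgM; first exact: cvg_cst.
  by apply: stepbox_cvg => // j; have [] := lab j.
have mh : measurable_fun Ob (fun x => (w x * \1_(hbox s a b) x)%:E).
  apply/measurable_EFinP; apply: measurable_funM => //.
  by apply: measurable_funTS; apply: measurable_indic; exact: measurable_hbox.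
have [_ _ H] := @dominated_convergence _ _ _ mu Ob mO _ _ _ md mh
  (aeW _ cv) id (aeW _ (fun x k Ox => dom k x Ox)).
rewrite /Rintegral; apply: fine_cvg; rewrite fineK; first exact: H.
apply: integrable_fin_num => //; apply: (le_integrable mO mh _ iw) => x _ /=.
rewrite lee_fin normrM indicE -[leRHS]mulr1 ler_wpM2l//.
by case: (_ \in _); rewrite /= ?normr1 ?normr0.
Unshelve. all: by end_near. Qed.

Lemma smooth1_measurable (f : R -> R) : smooth1 f -> measurable_fun setT f.
Proof. by move=> /smooth1_continuous cf; exact: continuous_measurable_fun. Qed.

(** A step has no compact support, but E(y) - E(y - 2) vanishes outside [-1, 3] and coincides with
    E(y) for y <= 1; beyond 1 the step is constant. *)
Lemma step_bounded s (E : R -> R) : smooth1 E -> is_step s E ->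
  exists2 M, 0 <= M & forall y, `|E y| <= M.
Proof.
move=> sE [E0 E1].
have sB : smooth1 (fun y => E y - E (1 * y + - 2)).
  by apply: smooth1B => //; exact: smooth1_affine.
have [||M M0 hM] := @compact_support_bounded R R _ `[- 1, 3]%classic (smooth1_continuous sB).
- exact: segment_compact.
- move=> y; rewrite /= in_itv/= => /negP; rewrite negb_and -!ltNge => /orP[h|h].
    by rewrite !E0 ?subrr//; case: (s); rewrite /=; lra.
  by rewrite !E1 ?subrr//; case: (s); rewrite /=; lra.
exists (Num.max M 1); first by rewrite le_max M0.
move=> y; have [h|h] := leP y 1.
  by have := hM y; rewrite (E0 (1 * y - 2)) ?subr0 ?le_max => [->|]//; case: (s); rewrite /=; lra.
by rewrite E1 ?normr1 ?le_max ?lexx ?orbT//; case: (s); rewrite /=; lra.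
Qed.

Lemma smooth1_stepbox E t (a b : 'I_n.+1 -> R) j : smooth1 (E j) ->
  smooth1 (stepbox E t a b j).
Proof.
move=> sE; rewrite /stepbox; apply: smooth1B.
  rewrite (_ : (fun x => _) = (fun x => E j (t^-1 * x + - (t^-1 * a j)))).
    exact: smooth1_affine.
  by apply/funext => z; rewrite mulrBr.
rewrite (_ : (fun x => _) = (fun x => E j (t^-1 * x + - (t^-1 * b j)))).
  exact: smooth1_affine.
by apply/funext => z; rewrite mulrBr.
Qed.

Lemma is_step_smoothstep : is_step false (@smoothstep R).
Proof.
split=> y /=; first by move=> h; rewrite smoothstep0//; lra.
by move=> h; rewrite smoothstep1//; lra.
Qed.

(* The product test functions stepbox tend to the indicators of boxes. *)
Lemma fundamental_lemma (w : point -> R) : mu.-integrable Ob (EFin \o w) ->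
  (forall g, ptest l u g -> \int[mu]_(x in Ob) (w x * prodf g x) = 0) ->
  {ae mu, forall x, Ob x -> w x = 0}.
Proof.
move=> iw w0; apply: (@integral_boxes_eq0 _ _ _ _ (fun=> false)) => // a b lab.
have mO : measurable Ob by exact: measurable_obox.
have ih : mu.-integrable (hbox (fun=> false) a b) (EFin \o w).
  apply: integrableS iw => //; first exact: measurable_hbox.
  by apply: hbox_sub => j; have [] := lab j.
suff H : \int[mu]_(x in hbox (fun=> false) a b) w x = 0.
  rewrite -[LHS]fineK; first by rewrite [fine _]H.
  by apply: integrable_fin_num => //; exact: measurable_hbox.
have [M M0 hM] := step_bounded (smooth1_smoothstep R) is_step_smoothstep.
pose E (j : 'I_n.+1) := @smoothstep R.
(* All sides are [false], so the smoothed indicator spreads only to the right, over [a, b + t]; [d]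
   measures the room left between b and u. *)
have [d d0 hd] : exists2 d, 0 < d & forall j, d < u j - b j.
  exists (\big[Num.min/1]_j ((u j - b j) / 2)).
    by apply: lt_bigmin => // j _; have [_ _] := lab j; lra.
  move=> j; apply: le_lt_trans (bigmin_le_cond _ _ _) _ => //.
  by have [_ _] := lab j; lra.
pose t k : R := d / k.+1%:R.
have t0 k : 0 < t k by rewrite divr_gt0.
have td k : t k <= d by rewrite ler_pdivrMr// ler_peMr ?ler1n// ltW.
have tc : t @ \oo --> 0.
  rewrite -(mulr0 d); apply: cvgM; first exact: cvg_cst.
  exact: cvg_harmonic.
have C := @stepbox_integral_cvg (fun=> false) E M t a b w (fun=> is_step_smoothstep)
  (fun=> smooth1_measurable (smooth1_smoothstep R)) (fun=> hM) t0 tc lab iw.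
apply/esym; rewrite -(cvg_lim _ C)//.
rewrite (_ : (fun k => _) = (fun=> 0)); first by rewrite lim_cst.
apply/funext => k; apply: w0; split=> j; first exact/smooth1_stepbox/smooth1_smoothstep.
have [la ab bu] := lab j; have := hd j; have := td k => h1 h2.
exists (a j), (b j + t k); split=> //; first lra.
move=> y /negP; rewrite negb_and -!ltNge /stepbox /E => /orP[h|h].
  rewrite !smoothstep0 ?subrr//.
    by apply: (@le_trans _ _ 0); last lra; rewrite pmulr_rle0 ?invr_gt0//; lra.
  by apply: (@le_trans _ _ 0); last lra; rewrite pmulr_rle0 ?invr_gt0//; lra.
by rewrite !smoothstep1 ?subrr// ler_pdivlMl//; have := t0 k; lra.
Qed.

End Fundamental.

Lemma prod_telescope (R : comPzRingType) n (p q : 'I_n -> R) :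
  \prod_j p j - \prod_j q j =
  \sum_(i < n) \prod_(j < n) (if (j < i)%N then q j else if j == i then p j - q j else p j).
Proof.
elim: n p q => [|n ih] p q; first by rewrite !big_ord0 subrr.
rewrite !big_ord_recr/= (_ : \prod_(j < n) _ * p ord_max = (\prod_(j < n) p (widen_ord (leqnSn n) j)
  - \prod_(j < n) q (widen_ord (leqnSn n) j)) * p ord_max + \prod_(j < n) q (widen_ord (leqnSn n) j) * p ord_max); last by ring.
rewrite -addrA -mulrBr; congr (_ + _).
  rewrite ih mulr_suml; apply: eq_bigr => i _; rewrite big_ord_recr/=; congr (_ * _).
  by rewrite ltnNge ltnW//= -val_eqE/= gtn_eqF.
rewrite ltnn eqxx; congr (_ * _).
by apply: eq_bigr => j _; rewrite /= ltn_ord.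
Qed.

Lemma measurable_prodf_smooth (R : realType) n (g : 'I_n -> R -> R) :
  (forall j, smooth1 (g j)) -> measurable_fun setT (prodf g).
Proof. by move=> sg; apply: measurable_prodf => j; apply: smooth1_measurable. Qed.

Lemma smooth1_FTC (R : realType) (F : R -> R) (s : bool) a b : smooth1 F -> a < b ->
  \int[@lebesgue_measure R]_(x in [set` Interval (BSide s a) (BSide s b)]) derive1 F x = F b - F a.
Proof.
move=> sF ab; have cF : continuous F by exact: smooth1_continuous.
have cdF : continuous (derive1 F) by apply/smooth1_continuous/smooth1_derive1.
have iF : (@lebesgue_measure R).-integrable `[a, b] (EFin \o derive1 F).
  by apply: continuous_compact_integrable; [exact: segment_compact|exact: continuous_subspaceT].
rewrite (_ : Rintegral _ _ _ = \int[@lebesgue_measure R]_(x in `[a, b]) derive1 F x); last first.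
  case: s; first by rewrite Rintegral_itv_bndo_bndc//; apply: integrableS iF => //; exact: subset_itv_co_cc.
  by rewrite Rintegral_itv_obnd_cbnd//; apply: integrableS iF => //; exact: subset_itv_oc_cc.
rewrite /Rintegral (@continuous_FTC2 _ _ F)//.
- exact: continuous_subspaceT.
- split.
  + by move=> x _; exact: smooth1_derivable.
  + by apply: cvg_at_right_filter; exact: cF.
  + by apply: cvg_at_left_filter; exact: cF.
Qed.

Lemma integrable_prod_mul d1 d2 (T1 : measurableType d1) (T2 : measurableType d2) (R : realType)
    (m1 : {sigma_finite_measure set T1 -> \bar R}) (m2 : {sigma_finite_measure set T2 -> \bar R})
    (f : T1 -> R) (g : T2 -> R) :
  m1.-integrable setT (EFin \o f) -> m2.-integrable setT (EFin \o g) ->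
  (m1 \x m2)%E.-integrable setT (fun p => (f p.1 * g p.2)%:E).
Proof.
move=> fi gi.
have mf : measurable_fun setT f by apply/measurable_EFinP; exact: measurable_int fi.
have mg : measurable_fun setT g by apply/measurable_EFinP; exact: measurable_int gi.
apply/integrable12ltyP.
  apply/measurable_EFinP; apply: measurable_funM.
    exact: (measurableT_comp mf measurable_fst).
  exact: (measurableT_comp mg measurable_snd).
under eq_integral.
  move=> x _; under eq_integral do rewrite /= normrM EFinM.
  rewrite ge0_integralZl//; last by apply/measurable_EFinP; exact: measurableT_comp.
  over.
rewrite ge0_integralZr//; last 2 first.
- by apply/measurable_EFinP; exact: measurableT_comp.
- by apply: integral_ge0.
have /integrableP[_ i1] := fi; have /integrableP[_ i2] := gi.
by apply: lte_mul_pinfty => //; rewrite ?ge0_fin_numE//; exact: integral_ge0.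
Qed.

Lemma indic_hbox (R : realType) n s (a b : 'I_n -> R) x : \1_(hbox s a b) x =
  \prod_j \1_([set` Interval (BSide (s j) (a j)) (BSide (s j) (b j))]) (x 0 j) :> R.
Proof.
rewrite indicE; have [xQ|nQ] := pselect (hbox s a b x).
  rewrite (mem_set xQ) big1// => j _; rewrite indicE mem_set//; exact: xQ.
rewrite (memNset nQ); move/existsNP : nQ => [j xj].
by rewrite (bigD1 j)//= indicE (memNset xj) mul0r.
Qed.

(** The variable [r] is the base point of the kernel, [z] its argument. Averaging over base points
    in an interval turns the kernel into a difference of two scaled steps, one coordinate of
    [stepbox]. *)
Lemma integral_scaled_kernel (R : realType) (E : R -> R) (s : bool) t a b z :
  smooth1 E -> 0 < t -> a < b ->
  let g r := t^-1 * derive1 E (t^-1 * (z - r)) * \1_([set` Interval (BSide s a) (BSide s b)]) r in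
  (@lebesgue_measure R).-integrable setT (EFin \o g) /\
  \int[@lebesgue_measure R]_r g r = E (t^-1 * (z - a)) - E (t^-1 * (z - b)).
Proof.
move=> smE t0 ab g.
have sg : smooth1 (fun r => t^-1 * derive1 E (- t^-1 * r + t^-1 * z)).
  apply: smooth1M; first exact: smooth1_cst.
  exact: (smooth1_affine (- t^-1) (t^-1 * z) (smooth1_derive1 smE)).
have gS : g = (fun r => t^-1 * derive1 E (- t^-1 * r + t^-1 * z)) \_
     [set` Interval (BSide s a) (BSide s b)].
  apply/funext => x; rewrite /g /patch indicE (_ : - t^-1 * x + _ = t^-1 * (z - x)); last by ring.
  by case: ifP => _; rewrite ?mulr1 ?mulr0.
split.
  rewrite gS -restrict_EFin -integrable_mkcond//.
  have : (@lebesgue_measure R).-integrable `[a, b]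
      (EFin \o (fun r => t^-1 * derive1 E (- t^-1 * r + t^-1 * z))).
    apply: continuous_compact_integrable; first exact: segment_compact.
    by apply: continuous_subspaceT; exact: smooth1_continuous.
  apply: integrableS => //; case: s {g gS}; first exact: subset_itv_co_cc.
  exact: subset_itv_oc_cc.
rewrite gS -Rintegral_mkcond.
pose F r := - E (- t^-1 * r + t^-1 * z).
have sF : smooth1 F.
  rewrite (_ : F = (fun r => (-1) * E (- t^-1 * r + t^-1 * z))).
    apply: smooth1M; first exact: smooth1_cst.
    exact: (smooth1_affine (- t^-1) (t^-1 * z) smE).
  by apply/funext => x; rewrite mulN1r.
rewrite (_ : (fun r => _) = derive1 F); last first.
  apply/funext => x; apply/esym/derive1_val.
  have := is_derive_affine (smooth1_is_derive (- t^-1 * x + t^-1 * z) smE).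
  by move=> /is_deriveN; rewrite mulNr opprK.
rewrite smooth1_FTC// /F opprK addrC.
by congr (E _ - E _); ring.
Qed.

(** * The Sobolev bound on a box *)

Section Kernel.
Context (R : realType) (n : nat).
Notation point := 'rV[R]_n.+1.
Notation mu := (@lebesgue_row R n.+1).
Variables l u : 'I_n.+1 -> R.
Notation Ob := (obox l u).

Let mO : measurable Ob. Proof. exact: measurable_obox. Qed.

(** Cauchy-Schwarz: the L_2-norm of f is at most M times the root of the measure of a set carrying
    f. *)
Lemma ip_box_bound (v f : point -> R) (M m : R) (P : set point) : memL2 Ob v -> measurable_fun setT f ->
  measurable P -> 0 <= M -> (forall z, `|f z| <= M) -> (forall z, ~ P z -> f z = 0) ->
  mu P = m%:E -> `|\int[mu]_(z in Ob) (v z * f z)| <= normL2 Ob v * (M * Num.sqrt m).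
Proof.
move=> mv mf mP M0 fM f0 Pm.
have m0 : 0 <= m by rewrite -lee_fin -Pm.
have mf2 : memL2 Ob f.
  exact: (memL2_bounded mO (obox_fin _ _) (measurable_funTS mf) (fun x _ => fM x)).
apply: (le_trans (cauchy_schwarz mO mv mf2)); rewrite ler_wpM2l ?normL2_ge0//.
rewrite -ler_sqr ?nnegrE ?normL2_ge0 ?mulr_ge0 ?sqrtr_ge0// normL2_sq exprMn sqr_sqrtr//.
have mI : mu.-integrable Ob (EFin \o \1_P).
  apply: memL2_integrable => //; first exact: obox_fin.
  apply: (@memL2_bounded _ _ _ mO _ 1); first exact: obox_fin.
    by apply: measurable_funTS; exact: measurable_indic.
  by move=> x _; rewrite indicE; case: (_ \in _); rewrite /= ?normr1 ?normr0.
apply: (@le_trans _ _ (\int[mu]_(x in Ob) (M ^+ 2 * \1_P x))).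
  apply: le_Rintegral => //; first exact: memL2_integrableM.
    by apply: (integrableZl mO (M ^+ 2) mI).
  move=> x _; rewrite indicE; have [Px|nPx] := pselect (P x).
    by rewrite mem_set// mulr1 -expr2 -[f x ^+ 2]real_normK ?num_real// ler_sqr ?nnegrE.
  by rewrite memNset// f0// !mulr0.
rewrite RintegralZl// ler_wpM2l ?sqr_ge0// /Rintegral integral_indic//.
have PO : (mu (P `&` Ob) <= m%:E)%E by rewrite -Pm; apply: measureIl.
by rewrite -lee_fin fineK// ge0_fin_numE// (le_lt_trans PO) ?ltry.
Qed.

Variable S : nat.
(** The dimension is n + 1, so this reads S + 1 - (n + 1)/2 >= 1/2: derivatives of order S + 1 gain
    at least sqrt t at scale t. *)
Hypothesis nS : (n <= S.*2)%N.
Variable s : 'I_n.+1 -> bool.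
Variables E psi : 'I_n.+1 -> R -> R.
Hypothesis spec : forall j, dilation_spec S.+1 (- (s j)%:R) (E j) (psi j).
Variable B : R.
Hypothesis B1 : 1 <= B.
Hypothesis EB : forall j y, `|E j y| <= B.
Hypothesis etaB : forall j y, `|derive1 (E j) y| <= B.
Hypothesis psiB : forall j y, `|psi j y| <= B.
Variable d : R.
Hypothesis d0 : 0 < d.
Hypothesis d1 : d <= 1.
Hypothesis hd : forall j, d <= (u j - l j) / 4.

Implicit Types (x : point) (t : R) (v : point -> R).

Let c j : R := - (s j)%:R.
Let smE j : smooth1 (E j). Proof. by have [] := spec j. Qed.
Let smp j : smooth1 (psi j). Proof. by have [] := spec j. Qed.
Let B0 : 0 <= B. Proof. exact: le_trans B1. Qed.
Let cP j : c j = 0 \/ c j = -1.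
Proof. by rewrite /c; case: (s j); rewrite ?oppr0; [right|left]. Qed.

(** [Q0] takes two thirds of every edge, the right part when [s j] is true and the kernel averages
    to the left, the left part otherwise. A third of the edge is left free on the side of the
    averaging, while scales are at most [d], a quarter of the edge. *)
Let lq j := if s j then l j + (u j - l j) / 3 else l j.
Let uq j := if s j then u j else u j - (u j - l j) / 3.
Let Q0 := obox lq uq.

Lemma eta_off j y : ~ (c j + 1/16 <= y <= c j + 15/16) -> derive1 (E j) y = 0.
Proof.
have [_ _ E0 E1 _ _ _] := spec j.
move=> /negP; rewrite negb_and -!ltNge => /orP[h|h]; rewrite -derive1n1.
  rewrite (@derive1n_local R [set x | x < c j + 1/16] _ _ (fun=> 0))//.
  - by rewrite derive1n_cst.
  - by move=> x /= /ltW; exact: E0.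
rewrite (@derive1n_local R [set x | c j + 15/16 < x] _ _ (fun=> 1))//.
- by rewrite derive1n_cst.
- by move=> x /= /ltW; exact: E1.
Qed.

Lemma psi_off j y : ~ (c j + 1/16 <= y <= c j + 15/16) -> psi j y = 0.
Proof.
have [_ _ _ _ p0 p1 _] := spec j.
by move=> /negP; rewrite negb_and -!ltNge => /orP[/ltW|/ltW]; [exact: p0|exact: p1].
Qed.

Definition ker (t : R) (x : point) (j : 'I_n.+1) (z : R) : R :=
  t^-1 * derive1 (E j) (t^-1 * (z - x 0 j)).

(** The i-th term of the telescoping between scales t and t/4: coordinates before i are already at
    scale t/4, those after i still at scale t. The power t^S is what S + 1 derivatives, each
    producing 1/t, reduce to the normalization 1/t of [ker]. *)
Definition kerdiff (t : R) (x : point) (i j : 'I_n.+1) (z : R) : R :=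
  if (j < i)%N then ker (t / 4) x j z else
  if j == i then t ^+ S * psi j (t^-1 * (z - x 0 j)) else ker t x j z.

Let affE (f : R -> R) (a b : R) : (fun z => f (a * (z - b))) = (fun z => f (a * z + - (a * b))).
Proof. by apply/funext => z; rewrite mulrBr. Qed.

Lemma smooth1_ker t x j : smooth1 (ker t x j).
Proof.
apply: smooth1M; first exact: smooth1_cst.
by rewrite (affE (derive1 (E j))); apply: smooth1_affine; exact: smooth1_derive1.
Qed.

Lemma smooth1_kerdiff t x i j : smooth1 (kerdiff t x i j).
Proof.
rewrite /kerdiff; case: (j < i)%N => /=; first exact: smooth1_ker.
case: (j == i) => /=; last exact: smooth1_ker.
apply: smooth1M; first exact: smooth1_cst.
by rewrite affE; exact: smooth1_affine.
Qed.

Lemma scaled_range t (x z : R) a b : 0 < t ->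
  (a <= t^-1 * (z - x) <= b) = (x + t * a <= z <= x + t * b).
Proof.
move=> t0; rewrite ler_pdivlMl// ler_pdivrMl//.
by congr (_ && _); apply/idP/idP; lra.
Qed.

Lemma ker_off t x j (z : R) : 0 < t ->
  ~ (x 0 j + t * (c j + 1/16) <= z <= x 0 j + t * (c j + 15/16)) -> ker t x j z = 0.
Proof. by move=> t0; rewrite -scaled_range// => h; rewrite /ker eta_off ?mulr0. Qed.

(** The margin 1/64 is a quarter of 1/16: for c = 0 the factors at scale t/4 start at t/64, and for
    c = -1 they end at -t/64 = t (c + 63/64). *)
Lemma kerdiff_off t x i j (z : R) : 0 < t ->
  ~ (x 0 j + t * (c j + 1/64) <= z <= x 0 j + t * (c j + 63/64)) -> kerdiff t x i j z = 0.
Proof.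
move=> t0 h.
have h2 : ~ (x 0 j + t * (c j + 1/16) <= z <= x 0 j + t * (c j + 15/16)).
  by move=> /andP[h1 h2]; apply: h; case: (cP j) => cj; rewrite cj in h1 h2 *; apply/andP; split; lra.
rewrite /kerdiff; case: ifP => _; last case: ifP => _.
- apply: ker_off; first lra.
  by move=> /andP[h1 h3]; apply: h; case: (cP j) => cj; rewrite cj in h1 h3 *; apply/andP; split; lra.
- by rewrite psi_off ?mulr0// scaled_range.
- exact: ker_off.
Qed.

Lemma kernel_range t x j a b (z : R) : Q0 x -> 0 < t -> t <= d -> 0 < a -> b < 1 ->
  x 0 j + t * (c j + a) <= z <= x 0 j + t * (c j + b) -> l j < z < u j.
Proof.
move=> Qx t0 td a0 b1 /andP[h1 h2]; have := Qx j; have := hd j.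
have ta : 0 < t * a by rewrite mulr_gt0.
have tb : t * b < t by rewrite gtr_pMr.
rewrite /= in_itv/= /lq /uq; move: h1 h2; rewrite /c; case: (s j) => /= h1 h2 h3 /andP[h4 h5];
by apply/andP; split; lra.
Qed.

Lemma ptest_kerdiff t x i : Q0 x -> 0 < t -> t <= d -> ptest l u (kerdiff t x i).
Proof.
move=> Qx t0 td; split=> j; first exact: smooth1_kerdiff.
exists (x 0 j + t * (c j + 1/64)), (x 0 j + t * (c j + 63/64)); split.
- have /andP[] // := @kernel_range t x j (1/64) (63/64) (x 0 j + t * (c j + 1/64)) Qx t0 td
    ltac:(lra) ltac:(lra) ltac:(rewrite lexx/=; lra).
- have /andP[] // := @kernel_range t x j (1/64) (63/64) (x 0 j + t * (c j + 63/64)) Qx t0 td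
    ltac:(lra) ltac:(lra) ltac:(rewrite lexx andbT; lra).
- by move=> y; exact: kerdiff_off.
Qed.

Lemma derive1n_kerdiff t x i (z : R) : 0 < t ->
  derive1n S.+1 (kerdiff t x i i) z = ker t x i z - ker (t / 4) x i z.
Proof.
move=> t0; rewrite (_ : kerdiff t x i i = (fun z => t ^+ S * psi i (t^-1 * z + - (t^-1 * x 0 i)))).
  rewrite derive1nZ ?derive1n_affine//; last exact: smooth1_affine.
  have [_ _ _ _ _ _ ->] := spec i; rewrite /ker -mulrBr.
  rewrite (_ : (t / 4)^-1 = 4 * t^-1); last by field; rewrite gt_eqF.
  rewrite (_ : 4 * (t^-1 * (z - x 0 i)) = 4 / t * (z - x 0 i)); last by rewrite mulrA.
  move: (derive1 (E i) _) (derive1 (E i) _) => e1 e2.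
  rewrite exprS exprVn; field.
  by rewrite expf_neq0 gt_eqF.
by apply/funext => y; rewrite /kerdiff ltnn eqxx mulrBr.
Qed.

(** Each summand is a derivative of order S + 1, in the single coordinate i, of a product test
    function; only one unmixed derivative per direction is thus asked of the function being
    averaged. *)
Lemma ker_telescope t x z : 0 < t ->
  prodf (ker t x) z - prodf (ker (t / 4) x) z =
  \sum_i prodf (fun j => if j == i then derive1n S.+1 (kerdiff t x i j) else kerdiff t x i j) z.
Proof.
move=> t0; rewrite /prodf prod_telescope; apply: eq_bigr => i _; apply: eq_bigr => j _.
have [->|ji] := eqVneq j i; first by rewrite ltnn derive1n_kerdiff.
by rewrite /kerdiff (negbTE ji).
Qed.

Lemma ker_bound t x j (z : R) : 0 < t -> `|ker t x j z| <= B / t.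
Proof.
move=> t0; rewrite /ker normrM gtr0_norm ?invr_gt0// mulrC.
by rewrite ler_wpM2r// invr_ge0 ltW.
Qed.

Lemma kerdiff_bound t x i z : 0 < t ->
  `|prodf (kerdiff t x i) z| <= (t ^+ S * B) * (4 * B / t) ^+ n.
Proof.
move=> t0; rewrite /prodf normr_prod (bigD1 i)//=; apply: ler_pM => //.
- by apply: prodr_ge0.
- have tS : 0 <= t ^+ S by rewrite exprn_ge0// ltW.
  by rewrite /kerdiff ltnn eqxx normrM (ger0_norm tS) ler_wpM2l.
- have -> : (4 * B / t) ^+ n = \prod_(j | j != i) (4 * B / t).
    by rewrite prodr_const cardC1 card_ord.
  apply: ler_prod => j ji; rewrite normr_ge0 /kerdiff (negbTE ji)/=.
  have Bt : 0 <= B / t by rewrite divr_ge0// ltW.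
  case: ifP => _.
    apply: (le_trans (ker_bound _ _ _ _)); first lra.
    by rewrite (_ : B / (t / 4) = 4 * B / t)//; field; rewrite gt_eqF.
  by apply: (le_trans (ker_bound _ _ _ t0)); lra.
Qed.

Let cube t (x : point) : set point :=
  cbox (fun j => `[x 0 j + t * c j, x 0 j + t * (c j + 1)]%classic).

Lemma measure_cube t x : 0 < t -> mu (cube t x) = (t ^+ n.+1)%:E.
Proof.
move=> t0; rewrite lebesgue_row_cbox => [|j]; last exact: measurable_itv.
rewrite (eq_bigr (fun=> t%:E)) => [|j _].
  by rewrite prodEFin prodr_const card_ord.
rewrite lebesgue_measure_itv/= lte_fin ifT; last lra.
by rewrite -EFinB; congr EFin; lra.
Qed.

Lemma cube_off (g : 'I_n.+1 -> R -> R) t x a b : 0 < t -> 0 <= a -> b <= 1 ->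
  (forall j z, ~ (x 0 j + t * (c j + a) <= z <= x 0 j + t * (c j + b)) -> g j z = 0) ->
  forall z, ~ cube t x z -> prodf g z = 0.
Proof.
move=> t0 a0 b1 g0 z /existsNP[j zj]; rewrite /prodf (bigD1 j)//= g0 ?mul0r//.
move=> /andP[h1 h2]; apply: zj; rewrite /= in_itv/=.
have ta : 0 <= t * a by rewrite mulr_ge0// ltW.
have tb : t * b <= t by rewrite ger_pMr.
by apply/andP; split; lra.
Qed.

Lemma kerdiff_cube_off t x i z : 0 < t -> ~ cube t x z -> prodf (kerdiff t x i) z = 0.
Proof.
move=> t0; apply: (@cube_off (kerdiff t x i) t x (1/64) (63/64) t0); [lra|lra|].
by move=> j y; exact: kerdiff_off.
Qed.

Lemma ker_cube_off t x z : 0 < t -> ~ cube t x z -> prodf (ker t x) z = 0.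
Proof.
move=> t0; apply: (@cube_off (ker t x) t x (1/16) (15/16) t0); [lra|lra|].
by move=> j y; exact: ker_off.
Qed.

(** Counting powers of t: t^S from the distinguished factor, t^(-n) from the other n factors,
    t^((n+1)/2) from the root of the volume of the cube. The exponent S + 1 - (n + 1)/2 is at least
    1/2, and t <= 1. *)
Lemma kerdiff_ip t x i v : memL2 Ob v -> 0 < t -> t <= 1 ->
  `|\int[mu]_(z in Ob) (v z * prodf (kerdiff t x i) z)| <=
  (B * (4 * B) ^+ n) * Num.sqrt t * normL2 Ob v.
Proof.
move=> mv t0 t1.
have M0 : 0 <= (t ^+ S * B) * (4 * B / t) ^+ n.
  have t0' := ltW t0.
  by rewrite !mulr_ge0 ?exprn_ge0 ?divr_ge0 ?mulr_ge0.
have := @ip_box_bound v (prodf (kerdiff t x i)) _ _ (cube t x) mv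
  (measurable_prodf_smooth (smooth1_kerdiff t x i))
  ltac:(apply: measurable_cbox => j; exact: measurable_itv)
  M0 (fun z => kerdiff_bound x i z t0)
  (fun z => @kerdiff_cube_off t x i z t0)
  (measure_cube x t0).
move=> /le_trans; apply; rewrite mulrC ler_wpM2r ?normL2_ge0//.
have tn0 : 0 <= t ^+ n.+1 by rewrite exprn_ge0// ltW.
have h1 : 0 <= (t ^+ S * B) * (4 * B / t) ^+ n * Num.sqrt (t ^+ n.+1).
  by rewrite mulr_ge0// sqrtr_ge0.
have h2 : 0 <= B * (4 * B) ^+ n * Num.sqrt t.
  by rewrite !mulr_ge0 ?exprn_ge0 ?mulr_ge0 ?sqrtr_ge0.
rewrite -ler_sqr ?nnegrE// [leLHS]exprMn [leRHS]exprMn (sqr_sqrtr tn0) (sqr_sqrtr (ltW t0)).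
have tn : t != 0 by rewrite gt_eqF.
rewrite (_ : _ * t ^+ n.+1 = (B * (4 * B) ^+ n) ^+ 2 * (t ^+ (S.*2) * (t^-1 ^+ n) * t)); last first.
  rewrite expr_div_n (exprS t n) -muln2 (exprM t S 2) exprVn.
  have : t ^+ n != 0 by rewrite expf_neq0.
  by move: (t ^+ S) (t ^+ n) ((4 * B) ^+ n) => a p b p0; field.
rewrite ler_wpM2l ?sqr_ge0// ger_pMl// exprVn -(subnK nS) exprD mulfK ?expf_neq0 ?gt_eqF//.
by rewrite exprn_ile1// ltW.
Qed.

Lemma ker_ip t x v : memL2 Ob v -> 0 < t ->
  `|\int[mu]_(z in Ob) (v z * prodf (ker t x) z)| <=
  normL2 Ob v * ((B / t) ^+ n.+1 * Num.sqrt (t ^+ n.+1)).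
Proof.
move=> mv t0.
apply: (@ip_box_bound v (prodf (ker t x)) _ _ (cube t x) mv).
- exact: (measurable_prodf_smooth (smooth1_ker t x)).
- by apply: measurable_cbox => j; exact: measurable_itv.
- by rewrite exprn_ge0// divr_ge0// ltW.
- move=> z; rewrite /prodf normr_prod -[X in _ <= _ ^+ X]card_ord -[leRHS]prodr_const.
  by apply: ler_prod => j _; rewrite normr_ge0 ker_bound.
- by move=> z; exact: ker_cube_off.
- exact: measure_cube.
Qed.

Lemma prodf_ker_bound t x z : 0 < t -> `|prodf (ker t x) z| <= (B / t) ^+ n.+1.
Proof.
move=> t0; rewrite /prodf normr_prod -[X in _ <= _ ^+ X]card_ord -[leRHS]prodr_const.
by apply: ler_prod => j _; rewrite normr_ge0 ker_bound.
Qed.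

Lemma memL2_ker t x : 0 < t -> memL2 Ob (prodf (ker t x)).
Proof.
move=> t0; apply: (memL2_bounded mO (obox_fin _ _) _ (fun z _ => prodf_ker_bound x z t0)).
by apply: measurable_funTS; exact: (measurable_prodf_smooth (smooth1_ker t x)).
Qed.

Lemma memL2_ptest g : ptest l u g -> memL2 Ob (prodf g).
Proof.
move=> pg; have [M M0 hM] := ptest_bounded pg.
apply: (memL2_bounded mO (obox_fin _ _) _ (fun z _ => hM z)).
by apply: measurable_funTS; apply: measurable_prodf_smooth; case: pg.
Qed.

Lemma ptest_derive_at g i m : ptest l u g ->
  ptest l u (fun j => if j == i then derive1n m (g j) else g j).
Proof.
move=> pg; rewrite (_ : (fun j => _) = (fun j => derive1n (if j == i then m else 0%N) (g j))).
  exact: ptest_derive1n.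
by apply/funext => j; case: ifP.
Qed.

Lemma ipL2_sumr (I : Type) (r : seq I) (F : I -> point -> R) f : memL2 Ob f ->
  (forall i, memL2 Ob (F i)) ->
  ipL2 Ob f (fun z => \sum_(i <- r) F i z) = \sum_(i <- r) ipL2 Ob f (F i).
Proof.
move=> mf mF; elim: r => [|i r ih].
  rewrite big_nil /ipL2; under eq_Rintegral do rewrite big_nil mulr0.
  by rewrite Rintegral_cst// mul0r.
rewrite big_cons -ih ipL2C (_ : (fun z => _) = (fun z => F i z + \sum_(i <- r) F i z)).
  by rewrite ipL2Dl//; [rewrite ipL2C (ipL2C _ _ f)|exact: memL2_sum].
by apply/funext => z; rewrite big_cons.
Qed.

Variables (w : point -> R) (v : 'I_n.+1 -> point -> R).
Hypothesis mw : memL2 Ob w.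
Hypothesis mv : forall i, memL2 Ob (v i).
(** [v i] stands for the weak derivative of [w] of order S + 1 in direction i; the absolute values
    absorb the sign from integration by parts. As only pairings with products are compared, [w] may
    itself be a weak derivative. *)
Hypothesis wv : forall i g, ptest l u g ->
  `|\int[mu]_(z in Ob) (w z * prodf (fun j => if j == i then derive1n S.+1 (g j) else g j) z)| =
  `|\int[mu]_(z in Ob) (v i z * prodf g z)|.

Let K t x := \int[mu]_(z in Ob) (w z * prodf (ker t x) z).
Let V := \sum_i normL2 Ob (v i).
Let C1 := B * (4 * B) ^+ n.
Let V0 : 0 <= V. Proof. by apply: sumr_ge0 => i _; exact: normL2_ge0. Qed.
Let C10 : 0 <= C1. Proof. by rewrite mulr_ge0// exprn_ge0// mulr_ge0. Qed.

Let CV0 : 0 <= C1 * V. Proof. exact: mulr_ge0. Qed.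

Lemma K_step t x : Q0 x -> 0 < t -> t <= d -> `|K t x - K (t / 4) x| <= C1 * V * Num.sqrt t.
Proof.
move=> Qx t0 td; have t1 := le_trans td d1; have t40 : 0 < t / 4 by lra.
have -> : K t x - K (t / 4) x = \sum_i \int[mu]_(z in Ob) (w z *
    prodf (fun j => if j == i then derive1n S.+1 (kerdiff t x i j) else kerdiff t x i j) z).
  rewrite -[RHS](@ipL2_sumr _ _ (fun i =>
    prodf (fun j => if j == i then derive1n S.+1 (kerdiff t x i j) else kerdiff t x i j)))//; last first.
    by move=> i; apply: memL2_ptest; apply: ptest_derive_at; exact: ptest_kerdiff.
  rewrite /K -RintegralB//; [|exact: memL2_integrableM (memL2_ker _ _)..].
  by apply: eq_Rintegral => z _; rewrite -mulrBr ker_telescope.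
apply: (le_trans (ler_norm_sum _ _ _)); rewrite /V mulr_sumr mulr_suml.
apply: ler_sum => i _; rewrite wv; last exact: ptest_kerdiff.
by apply: (le_trans (kerdiff_ip x i (mv i) t0 t1)); rewrite mulrAC.
Qed.

Let tk k : R := d / 4 ^+ k.
Let tk0 k : 0 < tk k. Proof. by rewrite divr_gt0// exprn_gt0. Qed.
Let tkd k : tk k <= d.
Proof. by rewrite ler_pdivrMr ?exprn_gt0// ler_peMr ?(ltW d0)// exprn_ege1// ler1n. Qed.
Let tkS k : tk k.+1 = tk k / 4.
Proof. by rewrite /tk exprS; field; rewrite expf_neq0. Qed.

(** The ratio 4 of the scales becomes the ratio 1/2 after the square root, which makes the
    differences of means summable; d <= 1 removes the remaining factor. *)
Lemma sqrt_tk k : Num.sqrt (tk k) <= 2^-1 ^+ k.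
Proof.
rewrite -[leRHS]ger0_norm ?exprn_ge0 ?invr_ge0// -sqrtr_sqr ler_wsqrtr//.
rewrite -exprM mulnC exprM exprVn expr2 -natrM /tk exprVn ler_pdivrMr ?exprn_gt0//.
by rewrite mulVf ?expf_neq0.
Qed.

Lemma K_geometric x k : Q0 x -> `|K (tk k) x - K (tk k.+1) x| <= C1 * V * 2^-1 ^+ k.
Proof.
move=> Qx; rewrite tkS; apply: (le_trans (K_step Qx (tk0 k) (tkd k))).
by apply: ler_wpM2l => //; exact: sqrt_tk.
Qed.

Let M := normL2 Ob w * ((B / d) ^+ n.+1 * Num.sqrt (d ^+ n.+1)) + 2 * (C1 * V).

Lemma K_bound x k : Q0 x -> `|K (tk k) x| <= M.
Proof.
(* Strengthened for the induction: 2 - 2 * 2^-k is the sum of 2^-j over j < k, and the first term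
   bounds the mean at the initial scale d. *)
move=> Qx; suff : `|K (tk k) x| <= normL2 Ob w * ((B / d) ^+ n.+1 * Num.sqrt (d ^+ n.+1))
    + C1 * V * (2 - 2 * 2^-1 ^+ k).
  move=> /le_trans; apply; rewrite lerD2l mulrC ler_wpM2r//.
  have : 0 <= 2^-1 ^+ k :> R by rewrite exprn_ge0// invr_ge0.
  by move: (2^-1 ^+ k) => q; lra.
elim: k => [|k ih].
  rewrite expr0 mulr1 subrr mulr0 addr0 /tk expr0 divr1.
  exact: ker_ip.
have := K_geometric k Qx; have : 2^-1 ^+ k.+1 = 2^-1 * 2^-1 ^+ k :> R by rewrite exprS.
move: ih; move: (2^-1 ^+ k) (2^-1 ^+ k.+1) (C1 * V) => p q e h1 -> h2.
rewrite -[K (tk k.+1) x](subKr (K (tk k) x)) (le_trans (ler_normB _ _))//.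
apply: (le_trans (lerD h1 h2)); rewrite -addrA lerD2l; lra.
Qed.

Lemma K_cvg x : Q0 x -> cvgn (fun k => K (tk k) x).
Proof.
move=> Qx; pose D k := K (tk k.+1) x - K (tk k) x.
have cD : cvgn (series D).
  apply: normed_cvg; apply: (@series_le_cvg _ _ (geometric (C1 * V) 2^-1)).
  - by move=> k; rewrite /=.
  - by move=> k; rewrite /= mulr_ge0// exprn_ge0// invr_ge0.
  - by move=> k; rewrite /= /D distrC; exact: K_geometric.
  - by apply: is_cvg_geometric_series; rewrite ger0_norm; lra.
rewrite (_ : (fun k => _) = (fun k => series D k + K (tk 0) x)).
  by apply: is_cvgD => //; exact: is_cvg_cst.
by apply/funext => k; rewrite addrC; exact: (eq_sum_telescope (fun k => K (tk k) x)).
Qed.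

(** * Identification of the limit of the means *)

Let wO := w \_ Ob.

Lemma integrable_wO : mu.-integrable setT (EFin \o wO).
Proof.
have := memL2_integrable mO (obox_fin _ _) mw.
by rewrite (integrable_mkcond _ mO) (_ : (EFin \o w) \_ Ob = EFin \o wO)// /wO restrict_EFin.
Qed.

Lemma measurable_prodf_ker2 t :
  measurable_fun setT (fun p : point * point => prodf (ker t p.1) p.2).
Proof.
apply: measurable_prod => j _; apply: measurable_funM => //.
apply: (measurableT_comp (smooth1_measurable (smooth1_derive1 (smE j)))).
apply: measurable_funM => //; apply: measurable_funB.
  exact: (measurableT_comp (@measurable_row_coord R n.+1 j) measurable_snd).
exact: (measurableT_comp (@measurable_row_coord R n.+1 j) measurable_fst).
Qed.

Let Phi t (Q : set point) (p : point * point) : R :=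
  \1_Q p.1 * wO p.2 * prodf (ker t p.1) p.2.

Lemma integrable_Phi t Q : 0 < t -> measurable Q -> (mu Q < +oo)%E ->
  (mu \x mu)%E.-integrable setT (EFin \o Phi t Q).
Proof.
move=> t0 mQ Qoo.
have mwO : measurable_fun setT wO.
  by apply/measurable_EFinP; exact: measurable_int integrable_wO.
have iQ : mu.-integrable setT (EFin \o (fun x => (B / t) ^+ n.+1 * \1_Q x)).
  have iI : mu.-integrable setT (EFin \o (\1_Q : point -> R)).
    apply/integrableP; split; first by apply/measurable_EFinP; exact: measurable_indic.
    rewrite (eq_integral (fun x => (\1_Q x)%:E)); last by move=> y _; rewrite /= ger0_norm.
    by rewrite (integral_indic _ measurableT mQ) setIT.
  by apply: (integrableZl measurableT ((B / t) ^+ n.+1) iI).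
have H := integrable_prod_mul iQ integrable_wO.
apply: (le_integrable measurableT _ _ H).
  apply/measurable_EFinP; apply: measurable_funM; last exact: measurable_prodf_ker2.
  apply: measurable_funM; last exact: (measurableT_comp mwO measurable_snd).
  exact: (measurableT_comp (measurable_indic mQ) measurable_fst).
move=> [x z] _ /=; rewrite lee_fin /Phi/= mulrC !normrM -mulrA.
apply: ler_wpM2r; first by rewrite mulr_ge0.
by apply: (le_trans (prodf_ker_bound x z t0)); exact: ler_norm.
Qed.

Lemma fubini_F_Phi t Q x : 0 < t ->
  (\int[mu]_z (EFin \o Phi t Q) (x, z) = (\1_Q x * K t x)%:E)%E.
Proof.
move=> t0; rewrite EFinM; under eq_integral do rewrite /Phi/= -mulrA EFinM.
have H : mu.-integrable Ob (EFin \o (fun z => w z * prodf (ker t x) z)).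
  by apply: memL2_integrableM => //; exact: memL2_ker.
have E1 : (fun z => (wO z * prodf (ker t x) z)%:E) =
    (EFin \o (fun z => w z * prodf (ker t x) z)) \_ Ob.
  by apply/funext => z; rewrite /wO /patch/=; case: ifP => _//; rewrite mul0r.
rewrite integralZl//; last by rewrite E1 -integrable_mkcond.
congr (_ * _)%E; rewrite E1 -integral_mkcond /K /Rintegral fineK//.
exact: integrable_fin_num.
Qed.

Lemma measurable_K t : 0 < t -> measurable_fun Q0 (K t).
Proof.
move=> t0; have mQ : measurable Q0 by exact: measurable_obox.
have := measurable_fubini_F (integrable_Phi t0 mQ (obox_fin _ _)).
rewrite /fubini_F; under eq_fun do rewrite fubini_F_Phi//.
move=> /measurable_EFinP H; apply: (eq_measurable_fun (fun x => \1_Q0 x * K t x)).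
  by move=> x xQ; rewrite indicE xQ mul1r.
exact: measurable_funTS.
Qed.

(** After Fubini the inner integral runs over base points; for fixed z its integrand is a product
    over the coordinates, each factor being given by [integral_scaled_kernel]. *)
Lemma integral_K_hbox t a b : 0 < t -> (forall j, a j < b j) ->
  \int[mu]_(x in hbox s a b) K t x = \int[mu]_(z in Ob) (w z * prodf (stepbox E t a b) z).
Proof.
move=> t0 ab; set Q := hbox s a b; have mQ : measurable Q by exact: measurable_hbox.
have Qoo : (mu Q < +oo)%E.
  apply: (@le_lt_trans _ _ (mu (obox (fun j => a j - 1) (fun j => b j + 1)))); last exact: obox_fin.
  apply: le_measure; rewrite ?inE//; first exact: measurable_obox.
  by apply: hbox_sub => j; lra.
have -> : \int[mu]_(x in Q) K t x = fine (\int[mu]_x \int[mu]_z (EFin \o Phi t Q) (x, z))%E.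
  transitivity (fine (\int[mu]_x (\1_Q x * K t x)%:E)%E); last first.
    by congr fine; apply: eq_integral => x _; exact/esym/fubini_F_Phi.
  rewrite /Rintegral integral_mkcond; congr fine; apply: eq_integral => x _.
  by rewrite /patch indicE; case: ifP => _; rewrite ?mul1r ?mul0r.
rewrite (Fubini (integrable_Phi t0 mQ Qoo)) /Rintegral integral_mkcond; congr fine; apply: eq_integral => z _.
pose g (j : 'I_n.+1) (x : R) := t^-1 * derive1 (E j) (t^-1 * (z 0 j - x)) *
  \1_([set` Interval (BSide (s j) (a j)) (BSide (s j) (b j))]) x.
have gE x : prodf g x = \1_Q x * prodf (ker t x) z.
  rewrite /prodf big_split/= mulrC; congr (_ * _).
  exact/esym/indic_hbox.
have ig j : (@lebesgue_measure R).-integrable setT (EFin \o g j).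
  by have [] := integral_scaled_kernel (s j) (z 0 j) (smE j) t0 (ab j).
have [_ Ig] := integral_prodf ig.
transitivity ((wO z)%:E * \int[mu]_x (prodf g x)%:E)%E.
  rewrite -(integralZl measurableT (integral_prodf ig).1).
  by apply: eq_integral => x _; rewrite /= gE -EFinM /Phi/= mulrCA mulrA.
rewrite Ig -EFinM (_ : \prod_j _ = prodf (stepbox E t a b) z).
  by rewrite /wO /patch; case: ifP => _; rewrite ?mul0r.
apply: eq_bigr => j _.
by have [_ ->] := integral_scaled_kernel (s j) (z 0 j) (smE j) t0 (ab j).
Qed.

(** The means converge at every point of [Q0] to a limit bounded by [M]. Over a half-open box with
    sides [s], their integrals tend to that of the limit by domination by [M], and to that of [w] by
    [integral_K_hbox] and the convergence of smoothed indicators. The limit and [w] thus agree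
    almost everywhere. *)
Lemma sup_quadrant : {ae mu, forall x, Q0 x -> `|w x| <= M}.
Proof.
pose Ki x := limn (fun k => K (tk k) x).
have mQ0 : measurable Q0 by exact: measurable_obox.
have mKi : measurable_fun Q0 Ki.
  apply: (measurable_fun_cvg (fun k => measurable_K (tk0 k))) => x Qx.
  exact: K_cvg.
have KiM x : Q0 x -> `|Ki x| <= M.
  move=> Qx; have cK := K_cvg Qx.
  have cn : (fun k => `|K (tk k) x|) @ \oo --> `|Ki x| by exact: cvg_norm.
  rewrite -(cvg_lim _ cn)//; apply: limr_le; first exact: cvgP cn.
  by near=> k; exact: K_bound.
have Q0O : Q0 `<=` Ob.
  move=> x Qx j; have := Qx j; have := hd j; have := d0; rewrite /= !in_itv/= /lq /uq.
  by case: (s j) => h1 h2 /andP[h3 h4]; apply/andP; split; lra.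
have iw : mu.-integrable Q0 (EFin \o w).
  by apply: integrableS (memL2_integrable mO (obox_fin _ _) mw).
have iK : mu.-integrable Q0 (EFin \o Ki).
  apply: memL2_integrable => //; first exact: obox_fin.
  exact: (memL2_bounded mQ0 (obox_fin _ _) mKi KiM).
suff : {ae mu, forall x, Q0 x -> w x - Ki x = 0}.
  by apply: filterS => x H Qx; have /eqP := H Qx; rewrite subr_eq0 => /eqP ->; exact: KiM.
have iwK : mu.-integrable Q0 (EFin \o (fun x => w x - Ki x)).
  by rewrite (_ : EFin \o _ = ((EFin \o w) \- (EFin \o Ki))%E)//; exact: integrableB.
apply: (integral_boxes_eq0 (s := s) iwK) => a b lab.
have hQ : hbox s a b `<=` Q0 by apply: hbox_sub => j; have [] := lab j.
have mh : measurable (hbox s a b) by exact: measurable_hbox.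
have ab j : a j < b j by have [] := lab j.
have iwh : mu.-integrable (hbox s a b) (EFin \o w) by apply: integrableS iw.
have iKh : mu.-integrable (hbox s a b) (EFin \o Ki) by apply: integrableS iK.
rewrite -[LHS]fineK; last first.
  by apply: integrable_fin_num => //; apply: integrableS iwK.
congr EFin; rewrite -/(Rintegral _ _ _) RintegralB//; apply/eqP; rewrite subr_eq0; apply/eqP.
have tc : tk @ \oo --> 0.
  rewrite -(mulr0 d); apply: cvgM; first exact: cvg_cst.
  under eq_fun do rewrite -exprVn; apply: cvg_expr.
  by rewrite ger0_norm; lra.
have sE j : is_step (s j) (E j) by have [_ _ e0 e1 _ _ _] := spec j.
have lab' j : [/\ l j < a j, a j < b j & b j < u j].
  have [h1 h2 h3] := lab j; split=> //; move: h1 h3; rewrite /lq /uq; have := hd j; have := d0;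
  by case: (s j); lra.
have c1 := stepbox_integral_cvg sE (fun j => smooth1_measurable (smE j)) EB tk0 tc lab'
  (memL2_integrable mO (obox_fin _ _) mw).
have c2 : \int[mu]_(x in hbox s a b) K (tk k) x @[k --> \oo] --> \int[mu]_(x in hbox s a b) Ki x.
  have mKk k : measurable_fun (hbox s a b) (EFin \o K (tk k)).
    by apply/measurable_EFinP; apply: measurable_funS (measurable_K (tk0 k)).
  have mKi' : measurable_fun (hbox s a b) (EFin \o Ki) by exact: measurable_int iKh.
  have iM : mu.-integrable (hbox s a b) (EFin \o cst M).
    apply: (integrableS mQ0) => //.
    by apply: memL2_integrable => //; [exact: obox_fin|apply: memL2_cst => //; exact: obox_fin].
  have cv x : hbox s a b x -> (K (tk k) x)%:E @[k --> \oo] --> (Ki x)%:E.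
    by move=> Hx; apply: cvg_EFin; [near=> k|exact: K_cvg (hQ x Hx)].
  have dm x k : hbox s a b x -> (`|(K (tk k) x)%:E| <= (EFin \o cst M) x)%E.
    by move=> Hx; rewrite lee_fin; exact: K_bound (hQ x Hx).
  have [_ _ H] := @dominated_convergence _ _ _ mu (hbox s a b) mh _ _ _ mKk mKi'
    (aeW _ cv) iM (aeW _ dm).
  by rewrite /Rintegral; apply: fine_cvg; rewrite fineK//; apply: integrable_fin_num.
have c3 : \int[mu]_(x in hbox s a b) K (tk k) x @[k --> \oo] --> \int[mu]_(x in hbox s a b) w x.
  under eq_fun do rewrite integral_K_hbox//.
  exact: c1.
exact: cvg_unique c3 c2.
Unshelve. all: by end_near. Qed.

End Kernel.

Lemma dilation_data (R : realType) (S : nat) :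
  exists (E psi : bool -> R -> R) (B : R), 1 <= B /\ forall b : bool,
    [/\ dilation_spec S.+1 (- b%:R) (E b) (psi b),
        forall y, `|E b y| <= B, forall y, `|derive1 (E b) y| <= B & forall y, `|psi b y| <= B].
Proof.
have H (b : bool) : exists Ep : (R -> R) * (R -> R), exists B, 
    [/\ dilation_spec S.+1 (- b%:R) Ep.1 Ep.2, forall y, `|Ep.1 y| <= B,
        forall y, `|derive1 Ep.1 y| <= B & forall y, `|Ep.2 y| <= B].
  have [E [psi sp]] : exists E, exists psi, @dilation_spec R S.+1 (- b%:R) E psi.
    by apply: dilation_exists; case: b; rewrite ?oppr0; [right|left].
  have [sE sp' E0 E1 p0 p1 _] := sp.
  have [M1 M10 h1] : exists2 M, 0 <= M & forall y, `|E y| <= M by exact: step_bounded sE (conj E0 E1 : is_step b E).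
  pose K := `[- b%:R + 1 / 16, - b%:R + 15 / 16]%classic : set R.
  have cK : compact K by exact: segment_compact.
  have K0 y : ~ K y -> ~ (- b%:R + 1 / 16 <= y <= - b%:R + 15 / 16).
    by move=> nK h; apply: nK; rewrite /K /= in_itv.
  (* The support lemmas for kernels are reused in dimension one, with constant families. *)
  have d0 y : ~ K y -> derive1 E y = 0.
    by move=> /K0; exact: (@eta_off _ 0 S (fun=> b) (fun=> E) (fun=> psi) (fun=> sp) ord0).
  have ps0 y : ~ K y -> psi y = 0.
    by move=> /K0; exact: (@psi_off _ 0 S (fun=> b) (fun=> E) (fun=> psi) (fun=> sp) ord0).
  have [M2 M20 h2] := compact_support_bounded (smooth1_continuous (smooth1_derive1 sE)) cK d0.
  have [M3 M30 h3] := compact_support_bounded (smooth1_continuous sp') cK ps0.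
  exists (E, psi), (M1 + M2 + M3); split=> // y /=.
  - by apply: (le_trans (h1 y)); lra.
  - by apply: (le_trans (h2 y)); lra.
  - by apply: (le_trans (h3 y)); lra.
have [Ep /choice[B hB]] := choice H.
have B0 b : 0 <= B b by have [_ h _ _] := hB b; apply: le_trans (h 0).
exists (fun b => (Ep b).1), (fun b => (Ep b).2), (1 + B true + B false).
split; first by have := B0 true; have := B0 false; lra.
have Bb b : B b <= 1 + B true + B false.
  by have := B0 true; have := B0 false; case: b; lra.
by move=> b; have [h1 h2 h3 h4] := hB b; split=> // y; apply: le_trans (Bb b).
Qed.

(* Comparing averages over the scales d, d/4, d/16, ... : each difference costs t^(S+1-N/2)
   times the L2 norm of the derivatives of order S+1. *)
Lemma sobolev_box (R : realType) n (l u : 'I_n.+1 -> R) (S : nat) :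
  (forall j, l j < u j) -> (n <= S.*2)%N ->
  exists2 C, 0 <= C & forall (w : 'rV[R]_n.+1 -> R) (v : 'I_n.+1 -> 'rV[R]_n.+1 -> R),
    memL2 (obox l u) w -> (forall i, memL2 (obox l u) (v i)) ->
    (forall i g, ptest l u g ->
      `|\int[@lebesgue_row R n.+1]_(z in obox l u)
          (w z * prodf (fun j => if j == i then derive1n S.+1 (g j) else g j) z)| =
      `|\int[@lebesgue_row R n.+1]_(z in obox l u) (v i z * prodf g z)|) ->
    {ae @lebesgue_row R n.+1, forall x, obox l u x ->
      `|w x| <= C * (normL2 (obox l u) w + \sum_i normL2 (obox l u) (v i))}.
Proof.
move=> lu nS; have [E [psi [B [B1 hB]]]] := dilation_data R S.
pose d := \big[Num.min/1]_j ((u j - l j) / 4).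
have d0 : 0 < d by apply: lt_bigmin => // j _; have := lu j; lra.
have d1 : d <= 1 by exact: bigmin_le_id.
have hd j : d <= (u j - l j) / 4 by exact: bigmin_le_cond.
have B0 : 0 <= B by lra.
pose X := (B / d) ^+ n.+1 * Num.sqrt (d ^+ n.+1).
have X0 : 0 <= X by rewrite mulr_ge0 ?sqrtr_ge0// exprn_ge0// divr_ge0// ltW.
pose C1 := B * (4 * B) ^+ n.
have C10 : 0 <= C1 by rewrite mulr_ge0// exprn_ge0// mulr_ge0.
exists (X + 2 * C1); first by lra.
move=> w v mw mv wv.
have H (s : {ffun 'I_n.+1 -> bool}) := @sup_quadrant R n l u S nS (fun j => s j)
  (fun j => E (s j)) (fun j => psi (s j)) (fun j => let: And4 p _ _ _ := hB (s j) in p) B B1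
  (fun j => let: And4 _ p _ _ := hB (s j) in p) (fun j => let: And4 _ _ p _ := hB (s j) in p)
  (fun j => let: And4 _ _ _ p := hB (s j) in p) d d0 d1 hd w v mw mv wv.
have {H} := filter_forall (ae_filter_ringOfSetsType (@lebesgue_row R n.+1)) H; apply: filterS => x Hx xO.
(* Every point lies in the quadrant selected by comparison with the midpoints, since each quadrant
   covers two thirds of the edges. There are finitely many quadrants, so their exceptional null sets
   combine into one. *)
pose s : {ffun 'I_n.+1 -> bool} := [ffun j => (l j + u j) / 2 < x 0 j].
apply: (le_trans (Hx s _)).
  move=> j; have := xO j; have := lu j; rewrite /= !in_itv/= !ffunE.
  by case: (ltP ((l j + u j) / 2) (x 0 j)) => h h1 /andP[h2 h3]; apply/andP; split; lra.
rewrite -/X -/C1; set V := \sum_i _; have V0 : 0 <= V by apply: sumr_ge0 => i _; exact: normL2_ge0.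
rewrite mulrDr !mulrDl [normL2 _ _ * X]mulrC -!addrA lerD2l.
have h1 := mulr_ge0 X0 V0; have h2 := mulr_ge0 C10 (normL2_ge0 (obox l u) w).
by rewrite -!mulrA in h1 h2 *; lra.
Qed.

(** * Weak derivatives and the spaces H^m *)

Section WeakDerivatives.
Context (R : realType) (n : nat).
Notation point := 'rV[R]_n.+1.
Notation mu := (@lebesgue_row R n.+1).
Variables (Ob : set point) (l u : 'I_n.+1 -> R).
Hypothesis ObE : Ob = obox l u.
Implicit Types (f g v w : point -> R) (s : seq 'I_n.+1).

Let mO : measurable Ob. Proof. by rewrite ObE; exact: measurable_obox. Qed.

Let fin_Ob : (mu Ob < +oo)%E. Proof. by rewrite ObE; exact: obox_fin. Qed.

Let test_Ob (g : 'I_n.+1 -> R -> R) : ptest l u g -> test_function Ob (prodf g).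
Proof. by rewrite ObE; exact: test_function_prodf. Qed.

Lemma memL2_partials s f : test_function Ob f -> memL2 Ob (partials s f).
Proof.
move=> /(test_function_partials s) tf; have [M _ hM] := test_function_bounded tf.
apply: (memL2_bounded mO fin_Ob _ (fun z _ => hM z)).
exact: test_function_measurable tf.
Qed.

Lemma is_wderiv_lin s v1 w1 v2 w2 c : memL2 Ob v1 -> memL2 Ob v2 ->
  is_wderiv Ob s v1 w1 -> is_wderiv Ob s v2 w2 ->
  is_wderiv Ob s (fun x => v1 x + c * v2 x) (fun x => w1 x + c * w2 x).
Proof.
move=> mv1 mv2 [mw1 h1] [mw2 h2]; split; first exact/memL2D/memL2Z.
move=> f tf; have mf := memL2_partials s tf; have mf0 := memL2_partials [::] tf.
have E (a b p : point -> R) : memL2 Ob a -> memL2 Ob b -> memL2 Ob p ->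
    \int[mu]_(x in Ob) ((a x + c * b x) * p x) =
    \int[mu]_(x in Ob) (a x * p x) + c * \int[mu]_(x in Ob) (b x * p x).
  move=> ma mb mp; rewrite -[LHS]/(ipL2 Ob (fun x => a x + c * b x) p).
  by rewrite ipL2Dl//; [rewrite ipL2Zl|exact: memL2Z].
by rewrite E// h1// h2// E//; ring.
Qed.

Lemma is_wderiv_uniq s v w w' : is_wderiv Ob s v w -> is_wderiv Ob s v w' ->
  {ae mu, forall x, Ob x -> w x = w' x}.
Proof.
move=> [mw hw] [mw' hw']; have mN := memL2Z mO (-1) mw'.
have mB := memL2D mO mw mN.
have : {ae mu, forall x, Ob x -> w x + -1 * w' x = 0}.
  rewrite ObE; apply: fundamental_lemma; rewrite -ObE; first exact: (memL2_integrable mO fin_Ob mB).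
  move=> g pg; have tg := test_Ob pg; have mg := memL2_partials [::] tg.
  rewrite -[LHS]/(ipL2 Ob (fun x => w x + -1 * w' x) (prodf g)) ipL2Dl// ipL2Zl// mulN1r.
  apply/eqP; rewrite subr_eq0; apply/eqP.
  apply: (mulfI (_ : (-1) ^+ size s != 0)); first by rewrite expf_neq0// oppr_eq0 oner_eq0.
  by rewrite /ipL2 -hw// -hw'.
by apply: filterS => x H /H /eqP; rewrite mulN1r subr_eq0 => /eqP.
Qed.

Lemma wderivP s v : (exists w, is_wderiv Ob s v w) -> is_wderiv Ob s v (wderiv Ob s v).
Proof. exact: xgetPex. Qed.

Lemma wderiv_ae s v w : is_wderiv Ob s v w -> {ae mu, forall x, Ob x -> wderiv Ob s v x = w x}.
Proof. by move=> h; apply: (is_wderiv_uniq _ h); apply: wderivP; exists w. Qed.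

Lemma is_wderiv_nil v : memL2 Ob v -> is_wderiv Ob [::] v v.
Proof. by move=> mv; split=> // f tf; rewrite expr0 mul1r. Qed.

(** [is_wderiv] asks square integrability of the derivative only; that of the function is added
    because linearity of its pairings with test functions requires integrability. *)
Definition has_wderiv s v := memL2 Ob v /\ exists w, is_wderiv Ob s v w.

Lemma has_wderiv_memL2 s v : has_wderiv s v -> memL2 Ob (wderiv Ob s v).
Proof. by move=> [_ /wderivP[]]. Qed.

Lemma has_wderiv_lin s v1 v2 c : has_wderiv s v1 -> has_wderiv s v2 ->
  has_wderiv s (fun x => v1 x + c * v2 x).
Proof.
move=> [m1 [w1 h1]] [m2 [w2 h2]]; split; first exact/memL2D/memL2Z.
by exists (fun x => w1 x + c * w2 x); exact: is_wderiv_lin.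
Qed.

(** [wderiv] picks a representative arbitrarily, so that even linearity holds only almost
    everywhere, through uniqueness. *)
Lemma wderiv_lin s v1 v2 c : has_wderiv s v1 -> has_wderiv s v2 ->
  {ae mu, forall x, Ob x -> wderiv Ob s (fun x => v1 x + c * v2 x) x =
    wderiv Ob s v1 x + c * wderiv Ob s v2 x}.
Proof.
by move=> [m1 h1] [m2 h2]; apply: wderiv_ae; apply: is_wderiv_lin => //; exact: wderivP.
Qed.

Lemma has_wderiv0 s : has_wderiv s (fun=> 0).
Proof.
split; first exact: memL20.
exists (fun=> 0); split=> [|f tf]; first exact: memL20.
by rewrite /Rintegral; under eq_integral do rewrite mul0r;
   under [in RHS]eq_integral do rewrite mul0r; rewrite integral0 mulr0.
Qed.

Lemma has_wderiv_sum s (I : Type) (r : seq I) (P : pred I) (F : I -> point -> R) :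
  (forall i, has_wderiv s (F i)) -> has_wderiv s (fun x => \sum_(i <- r | P i) F i x).
Proof.
move=> hF; elim: r => [|i r ih].
  by rewrite (_ : (fun x => _) = (fun=> 0)); [exact: has_wderiv0|apply/funext => x; rewrite big_nil].
have [Pi|Pi] := boolP (P i); last first.
  by rewrite (_ : (fun x => _) = (fun x => \sum_(i <- r | P i) F i x))//;
     apply/funext => x; rewrite big_cons (negbTE Pi).
rewrite (_ : (fun x => _) = (fun x => F i x + 1 * \sum_(i <- r | P i) F i x)).
  exact: has_wderiv_lin.
by apply/funext => x; rewrite big_cons Pi mul1r.
Qed.

Lemma wderiv0 s : {ae mu, forall x, Ob x -> wderiv Ob s (fun=> 0) x = 0}.
Proof.
apply: wderiv_ae; split=> [|f tf]; first exact: memL20.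
by rewrite /Rintegral; under eq_integral do rewrite mul0r;
   under [in RHS]eq_integral do rewrite mul0r; rewrite integral0 mulr0.
Qed.

Lemma wderiv_sum s (I : Type) (r : seq I) (P : pred I) (F : I -> point -> R) :
  (forall i, has_wderiv s (F i)) ->
  {ae mu, forall x, Ob x -> wderiv Ob s (fun x => \sum_(i <- r | P i) F i x) x =
    \sum_(i <- r | P i) wderiv Ob s (F i) x}.
Proof.
move=> hF; elim: r => [|i r ih].
  rewrite (_ : (fun x => \sum_(i <- [::] | P i) _) = (fun=> 0)); last first.
    by apply/funext => x; rewrite big_nil.
  by apply: filterS (wderiv0 s) => x h /h ->; rewrite big_nil.
have [Pi|Pi] := boolP (P i); last first.
  rewrite (_ : (fun x => \sum_(i <- _ :: _ | P i) _) = (fun x => \sum_(i <- r | P i) F i x)).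
    by apply: filterS ih => x h /h ->; rewrite big_cons (negbTE Pi).
  by apply/funext => x; rewrite big_cons (negbTE Pi).
rewrite (_ : (fun x => \sum_(i <- _ :: _ | P i) _) = (fun x => F i x + 1 * \sum_(i <- r | P i) F i x)).
  have h1 := wderiv_lin 1 (hF i) (has_wderiv_sum r P hF).
  by apply: filterS2 ih h1 => x h h1 Ox; rewrite h1// h// big_cons Pi mul1r.
by apply/funext => x; rewrite big_cons Pi mul1r.
Qed.

Lemma size_mi_seq m (a : {ffun 'I_n.+1 -> 'I_m.+1}) : size (mi_seq a) = mi_order a.
Proof.
rewrite /mi_seq size_flatten /shape -map_comp sumnE big_map /mi_order.
by rewrite big_enum; apply: eq_bigr => i _ /=; rewrite size_nseq.
Qed.

Lemma count_mi_seq m (a : {ffun 'I_n.+1 -> 'I_m.+1}) j : count_mem j (mi_seq a) = a j.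
Proof.
rewrite /mi_seq count_flatten -map_comp sumnE big_map big_enum (bigD1 j)//= big1 ?addn0.
  by rewrite count_nseq/= eqxx mul1n.
by move=> i ij; rewrite count_nseq/= (negbTE ij).
Qed.

Lemma mi_seq_single m (p : nat) i : (p <= m)%N ->
  exists2 a : {ffun 'I_n.+1 -> 'I_m.+1}, (mi_order a <= m)%N & mi_seq a = nseq p i.
Proof.
move=> pm; pose a : {ffun 'I_n.+1 -> 'I_m.+1} := [ffun j => inord (if j == i then p else 0%N)].
have aE j : a j = (if j == i then p else 0%N) :> nat.
  by rewrite ffunE inordK// ltnS; case: ifP.
have E : mi_seq a = nseq p i.
  rewrite /mi_seq (_ : [seq _ | _ <- _] = [seq nseq (if j == i then p else 0%N) j | j <- enum 'I_n.+1]).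
    have H (r : seq 'I_n.+1) : uniq r -> flatten [seq nseq (if j == i then p else 0%N) j | j <- r] =
        if i \in r then nseq p i else [::].
      elim: r => //= j r ih /andP[jr ur]; rewrite in_cons ih// eq_sym.
      have [->|ji] := eqVneq i j; last by [].
      by rewrite (negbTE jr) cats0.
    by rewrite H ?enum_uniq// mem_enum.
  by apply: eq_map => j; rewrite aE.
by exists a => //; rewrite -size_mi_seq E size_nseq.
Qed.

Lemma memH_has_wderiv m v (a : {ffun 'I_n.+1 -> 'I_m.+1}) : memH Ob m v -> (mi_order a <= m)%N ->
  has_wderiv (mi_seq a) v.
Proof. by move=> [mv h] am; split=> //; exact: h. Qed.

Lemma memH_nseq m v p i : memH Ob m v -> (p <= m)%N -> has_wderiv (nseq p i) v.
Proof. by move=> mv /(mi_seq_single i)[a am <-]; exact: memH_has_wderiv. Qed.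

Lemma memH_lin m v1 v2 c : memH Ob m v1 -> memH Ob m v2 -> memH Ob m (fun x => v1 x + c * v2 x).
Proof.
move=> h1 h2; split; first by apply: memL2D => //; [case: h1|apply: memL2Z => //; case: h2].
move=> a am.
by have [] := has_wderiv_lin c (memH_has_wderiv h1 am) (memH_has_wderiv h2 am).
Qed.

Lemma ipH_ge m v (a : {ffun 'I_n.+1 -> 'I_m.+1}) : (mi_order a <= m)%N ->
  normL2 Ob (wderiv Ob (mi_seq a) v) ^+ 2 <= ipH Ob m v v.
Proof.
move=> am; rewrite normL2_sq /ipH (bigD1 a am)/= lerDl.
by apply: sumr_ge0 => b _; exact: ipL2_ge0.
Qed.

Lemma ipH_ge0 m v : 0 <= ipH Ob m v v.
Proof. by apply: sumr_ge0 => b _; exact: ipL2_ge0. Qed.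

Lemma normH_ge m v p i : (p <= m)%N -> normL2 Ob (wderiv Ob (nseq p i) v) <= normH Ob m v.
Proof.
move=> /(mi_seq_single i)[a am <-].
by rewrite -[leLHS]ger0_norm ?normL2_ge0// -sqrtr_sqr ler_wsqrtr// ipH_ge.
Qed.

Lemma discriminant_le (a b d : R) : 0 <= d -> (forall c, 0 <= a + 2 * c * b + c ^+ 2 * d) ->
  b ^+ 2 <= a * d.
Proof.
move=> d0 H; have [d0'|dn] := eqVneq d 0.
  rewrite d0' mulr0; have := H (- (a + 1) / (2 * b)).
  rewrite d0' mulr0 addr0; have [->|b0] := eqVneq b 0; first by rewrite expr0n.
  by rewrite (_ : a + _ = -1); [lra|field; rewrite b0].
have := H (- b / d); rewrite (_ : a + _ + _ = (a * d - b ^+ 2) / d); last by field.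
by rewrite pmulr_lge0 ?subr_ge0// invr_gt0 lt_neqAle eq_sym dn.
Qed.

Lemma minkowski_sum (I : finType) (P : pred I) (a b : I -> R) :
  Num.sqrt (\sum_(i | P i) (a i + b i) ^+ 2) <=
  Num.sqrt (\sum_(i | P i) a i ^+ 2) + Num.sqrt (\sum_(i | P i) b i ^+ 2).
Proof.
set A := \sum_(i | P i) a i ^+ 2; set B := \sum_(i | P i) b i ^+ 2.
have A0 : 0 <= A by apply: sumr_ge0 => i _; exact: sqr_ge0.
have B0 : 0 <= B by apply: sumr_ge0 => i _; exact: sqr_ge0.
pose C := \sum_(i | P i) a i * b i.
have E c : \sum_(i | P i) (a i + c * b i) ^+ 2 = A + 2 * c * C + c ^+ 2 * B.
  rewrite /A /B /C !mulr_sumr -!big_split/=; apply: eq_bigr => i _; ring.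
have := @discriminant_le A C B B0 (fun c => _); move=> H.
have {}H : C ^+ 2 <= A * B.
  by apply: H => c; rewrite -E; apply: sumr_ge0 => i _; exact: sqr_ge0.
rewrite -ler_sqr ?nnegrE ?addr_ge0 ?sqrtr_ge0// sqrrD !sqr_sqrtr//; last first.
  by apply: sumr_ge0 => i _; exact: sqr_ge0.
have -> : \sum_(i | P i) (a i + b i) ^+ 2 = A + 2 * C + B.
  by have := E 1; rewrite expr1n mulr1 mul1r => <-; apply: eq_bigr => i _; rewrite mul1r.
have : C <= Num.sqrt A * Num.sqrt B.
  rewrite -sqrtrM// (le_trans (ler_norm _))// -sqrtr_sqr ler_wsqrtr//.
by move: (Num.sqrt A * Num.sqrt B) => q; lra.
Qed.

Lemma normHE m v : normH Ob m v =
  Num.sqrt (\sum_(a : {ffun 'I_n.+1 -> 'I_m.+1} | (mi_order a <= m)%N)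
    normL2 Ob (wderiv Ob (mi_seq a) v) ^+ 2).
Proof. by rewrite /normH /ipH; under eq_bigr do rewrite -normL2_sq. Qed.

Lemma normH_lin m v1 v2 c : memH Ob m v1 -> memH Ob m v2 ->
  normH Ob m (fun x => v1 x + c * v2 x) <= normH Ob m v1 + `|c| * normH Ob m v2.
Proof.
move=> h1 h2; rewrite !normHE.
pose a1 (a : {ffun 'I_n.+1 -> 'I_m.+1}) := normL2 Ob (wderiv Ob (mi_seq a) v1).
pose a2 (a : {ffun 'I_n.+1 -> 'I_m.+1}) := `|c| * normL2 Ob (wderiv Ob (mi_seq a) v2).
apply: (@le_trans _ _ (Num.sqrt (\sum_(a : {ffun 'I_n.+1 -> 'I_m.+1} | (mi_order a <= m)%N)
   (a1 a + a2 a) ^+ 2))).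
  rewrite ler_wsqrtr//; apply: ler_sum => a am.
  have m1 := memH_has_wderiv h1 am; have m2 := memH_has_wderiv h2 am.
  have ml1 := has_wderiv_memL2 m1; have ml2 := has_wderiv_memL2 m2.
  rewrite ler_sqr ?nnegrE ?normL2_ge0 ?addr_ge0 ?mulr_ge0 ?normL2_ge0//.
  rewrite (normL2_ae mO _ _ (wderiv_lin c m1 m2)).
  - by rewrite /a1 /a2 -normL2Z//; apply: normL2D => //; exact: memL2Z.
  - exact: has_wderiv_memL2 (has_wderiv_lin c m1 m2).
  - by apply: memL2D => //; exact: memL2Z.
apply: (le_trans (minkowski_sum _ _ _)); rewrite lerD2l /a2.
under eq_bigr do rewrite exprMn.
by rewrite -mulr_sumr sqrtrM ?sqr_ge0// sqrtr_sqr normr_id.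
Qed.

Lemma ipH_lin m f v1 v2 c : memH Ob m f -> memH Ob m v1 -> memH Ob m v2 ->
  ipH Ob m f (fun x => v1 x + c * v2 x) = ipH Ob m f v1 + c * ipH Ob m f v2.
Proof.
move=> hf h1 h2; rewrite /ipH mulr_sumr -big_split; apply: eq_bigr => a am /=.
have m1 := memH_has_wderiv h1 am; have m2 := memH_has_wderiv h2 am.
have ml1 := has_wderiv_memL2 m1; have ml2 := has_wderiv_memL2 m2.
have mf := has_wderiv_memL2 (memH_has_wderiv hf am).
have mcl : memL2 Ob (fun x => c * wderiv Ob (mi_seq a) v2 x) by exact: memL2Z.
have E := ipL2_ae mO (wderiv_lin c m1 m2) (has_wderiv_memL2 (has_wderiv_lin c m1 m2))
  (memL2D mO ml1 mcl) mf.
rewrite ipL2C E (ipL2Dl mO ml1 mcl mf) (ipL2Zl mO c ml2 mf).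
by rewrite ipL2C (ipL2C _ _ (wderiv Ob (mi_seq a) v2)).
Qed.

Lemma ipH0 m f : memH Ob m f -> ipH Ob m f (fun=> 0) = 0.
Proof.
move=> hf; rewrite /ipH big1// => a am.
have mf := has_wderiv_memL2 (memH_has_wderiv hf am).
rewrite ipL2C (ipL2_ae mO (wderiv0 (mi_seq a)) (has_wderiv_memL2 (has_wderiv0 _)) (memL20 _) mf).
by rewrite /ipL2 /Rintegral; under eq_integral do rewrite mul0r; rewrite integral0.
Qed.

Lemma ler_sum_term (I : finType) (F : I -> R) i : (forall j, 0 <= F j) -> F i <= \sum_j F j.
Proof. by move=> F0; rewrite (bigD1 i)//= lerDl; apply: sumr_ge0. Qed.

(** Multi-indices of order at most one are bounded by the H^1-norm, those of order two by one of the
    second derivatives; the constant counts all exponent functions with values in {0, 1, 2}. The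
    right side has the form in which strong convexity controls a difference. *)
Lemma ipH2_le v : ipH Ob 2 v v <= (\sum_(a : {ffun 'I_n.+1 -> 'I_3}) 1) *
  (ipH Ob 1 v v + \sum_i \sum_j normL2 Ob (wderiv Ob [:: i; j] v) ^+ 2).
Proof.
set X := ipH Ob 1 v v; set Y := \sum_i _.
have X0 : 0 <= X by exact: ipH_ge0.
have Y0 : 0 <= Y by do 2 (apply: sumr_ge0 => ? _); exact: sqr_ge0.
rewrite mulr_suml /ipH big_mkcond/=; apply: ler_sum => a _; rewrite mul1r; case: ifP => a2; last exact: addr_ge0.
rewrite -normL2_sq; have := size_mi_seq a; case: (mi_seq a) => [|i [|j [|k t]]]/=.
- move=> _; have [b b1 E] := @mi_seq_single 1 0 ord0 isT.
  by rewrite -[[::]]E; apply: (le_trans (ipH_ge v b1)); rewrite lerDl.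
- move=> _; have [b b1 E] := @mi_seq_single 1 1 i isT.
  by rewrite -[[:: i]]E; apply: (le_trans (ipH_ge v b1)); rewrite lerDl.
- move=> _; apply: (@le_trans _ _ Y); last by rewrite lerDr.
  pose F p q := normL2 Ob (wderiv Ob [:: p; q] v) ^+ 2.
  have F0 p q : 0 <= F p q by exact: sqr_ge0.
  apply: (le_trans (ler_sum_term j (F0 i))).
  exact: (@ler_sum_term _ (fun p => \sum_q F p q) i (fun p => sumr_ge0 _ (fun q _ => F0 p q))).
- by move=> E; rewrite -E in a2.
Qed.

(** [sobolev_box] is applied to a first derivative with S + 1 = m - 1, so that only derivatives of
    total order m of [v] occur; the hypothesis on m is then exactly n <= 2S. *)
Lemma sobolev_grad (lu : forall j, l j < u j) m : (n.+1 < (m.-1).*2)%N ->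
  exists2 C, 0 <= C & forall v i, memH Ob m v ->
    {ae mu, forall x, Ob x -> `|wderiv Ob [:: i] v x| <= C * normH Ob m v}.
Proof.
move=> hm; pose S := m.-2.
have mE : m = S.+2 by case: m hm @S => [|[|m]].
have nS : (n <= S.*2)%N by move: hm; rewrite mE/= doubleS !ltnS.
have [C C0] := sobolev_box lu nS; rewrite -ObE => hC.
(* One term for the first derivative itself and n + 1 for its derivatives of order S + 1, each at
   most the H^m-norm. *)
exists (C * n.+2%:R); first by rewrite mulr_ge0.
move=> v i hv.
have m1 : (1 <= m)%N by rewrite mE.
have hw : has_wderiv [:: i] v := memH_nseq i hv m1.
(* The multi-index of one derivative in direction i followed by S + 1 in direction j, the two
   exponents being added when i = j. *)
pose fa (j : 'I_n.+1) : {ffun 'I_n.+1 -> 'I_m.+1} :=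
  [ffun q => inord ((q == i) + (if q == j then S.+1 else 0%N))].
have faE j q : fa j q = ((q == i) + (if q == j then S.+1 else 0))%N :> nat.
  rewrite ffunE inordK// ltnS mE.
  by case: (q == i); case: (q == j); rewrite ?addn0 ?add1n ?add0n.
have fam j : (mi_order (fa j) <= m)%N.
  rewrite /mi_order (eq_bigr _ (fun q _ => faE j q)) big_split/=.
  have e1 : (\sum_(q < n.+1) (q == i) = 1)%N.
    by rewrite (bigD1 i)//= eqxx big1// => q /negbTE ->.
  have e2 : (\sum_(q < n.+1) (if q == j then S.+1 else 0) = S.+1)%N.
    by rewrite -big_mkcond/= big_pred1_eq.
  by rewrite e1 e2 add1n -mE.
have hv' j := memH_has_wderiv hv (fam j).
have H := hC (wderiv Ob [:: i] v) (fun j => wderiv Ob (mi_seq (fa j)) v)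
  (has_wderiv_memL2 hw) (fun j => has_wderiv_memL2 (hv' j)).
have wid j (g : 'I_n.+1 -> R -> R) : ptest l u g ->
   `|\int[mu]_(z in Ob) (wderiv Ob [:: i] v z *
       prodf (fun q => if q == j then derive1n S.+1 (g q) else g q) z)| =
   `|\int[mu]_(z in Ob) (wderiv Ob (mi_seq (fa j)) v z * prodf g z)|.
  move=> pg; have [sg _] := pg.
  pose g' q := if q == j then derive1n S.+1 (g q) else g q.
  have pg' : ptest l u g' by exact: ptest_derive_at.
  have [_ /wderivP[_ h1]] := hw; have [_ /wderivP[_ h2]] := hv' j.
  have := h1 _ (test_Ob pg'); have := h2 _ (test_Ob pg).
  rewrite !partials_prodf//; last by case: pg'.
  set a1 := \int[mu]_(x in Ob) _; set a2 := \int[mu]_(x in Ob) _.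
  set b1 := \int[mu]_(x in Ob) _; set b2 := \int[mu]_(x in Ob) _.
  (* Both weak derivatives are tested so that [v] is paired with the same derivative of the product
     [g]; only the signs differ, and the absolute values remove them. *)
  suff -> : b1 = a1.
    move=> -> /(congr1 Num.norm); rewrite !normrM !normrX !normrN1 !expr1n !mul1r => ->//.
  congr (Rintegral _ _ _); apply/funext => x; congr (_ * prodf _ _); apply/funext => q.
  rewrite count_mi_seq faE /g' /= addn0 eq_sym.
  case: (q == i) => /=; case: (q == j); rewrite ?addn0 ?add0n ?add1n//.
have {}H := H wid.
apply: filterS H => x H /H /le_trans; apply; rewrite -mulrA ler_wpM2l// mulrC.
rewrite -[n.+2%:R]natr1 mulrDr mulr1 [leRHS]addrC; apply: lerD.
  exact: (@normH_ge m v 1 i).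
apply: (@le_trans _ _ (\sum_(j < n.+1) normH Ob m v)).
  by apply: ler_sum => j _; rewrite -[leLHS]ger0_norm ?normL2_ge0// -sqrtr_sqr ler_wsqrtr// ipH_ge.
by rewrite sumr_const card_ord mulr_natr.
Qed.

End WeakDerivatives.

(** * Integration by parts *)

Section LineIntegrals.
Context (R : realType).
Notation mu n := (@lebesgue_row R n).
Notation leb := (@lebesgue_measure R).

Lemma bounded_support_integrable n (H : 'rV[R]_n -> R) M K : measurable_fun setT H ->
  (forall x, `|H x| <= M) -> (forall x, ~ cbox (fun=> `[- K, K]%classic) x -> H x = 0) ->
  (mu n).-integrable setT (EFin \o H).
Proof.
move=> mH HM H0.
pose g (j : 'I_n) : R -> R := \1_`[- K, K]%classic.
have [ig _] : (mu n).-integrable setT (EFin \o prodf g) /\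
    (\int[mu n]_x (prodf g x)%:E = (\prod_j (\int[leb]_x (g j x))%R)%:E)%E.
  apply: integral_prodf => j; apply: integrable_indic_itv.
apply: (@le_integrable _ _ _ _ _ measurableT _ (fun x => M%:E * (prodf g x)%:E)%E).
- exact/measurable_EFinP.
- move=> x _; rewrite /= lee_fin.
  have [xK|/H0 ->] := pselect (cbox (fun=> `[- K, K]%classic) x); last by rewrite normr0.
  rewrite (_ : prodf g x = 1) ?mulr1; first exact: (le_trans (HM x) (ler_norm _)).
  by rewrite /prodf big1// => j _; rewrite /g indicE mem_set//; exact: xK.
- exact: integrableZl.
Qed.

Lemma integrable_row_consP n (f : 'rV[R]_n.+1 -> \bar R) : (mu n.+1).-integrable setT f ->
  (mu n \x leb)%E.-integrable setT (f \o @row_cons R n).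
Proof.
move=> /integrableP[mf fi]; apply/integrableP; split.
  by apply: measurableT_comp => //; exact: measurable_row_cons.
by rewrite -(@ge0_integral_row_cons _ _ (fun x => `|f x|)%E)//; exact: measurableT_comp.
Qed.

Lemma row_cons_shift0 n (x : 'rV[R]_n) (t : R) :
  row_cons (x, t : measurableTypeR R) = row_cons (x, 0 : measurableTypeR R) + t *: delta_mx 0 ord0.
Proof.
apply/rowP => j; rewrite !mxE !eqxx/=; case: unliftP => [j' ->|->] /=.
  by rewrite mulr0 addr0.
by rewrite mulr1 add0r.
Qed.

Lemma row_cons_shift_lift n (x : 'rV[R]_n) (s t : R) (l : 'I_n) :
  row_cons (x + s *: delta_mx 0 l, t : measurableTypeR R) =
  row_cons (x, t : measurableTypeR R) + s *: delta_mx 0 (lift ord0 l).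
Proof.
apply/rowP => j; rewrite !mxE !eqxx/=; case: unliftP => [j' ->|->] /=.
  by rewrite !mxE eqxx/= (inj_eq (@lift_inj _ ord0)).
by rewrite mulr0 addr0.
Qed.

(** Fubini with the direction l integrated first. Peeling off the coordinate [ord0], either l is
    that coordinate, or it is frozen and the induction hypothesis applies to the slice. *)
Lemma integral_lines0 n (l : 'I_n) (H : 'rV[R]_n -> R) M K : measurable_fun setT H ->
  (forall x, `|H x| <= M) -> (forall x, ~ cbox (fun=> `[- K, K]%classic) x -> H x = 0) ->
  (forall x, \int[leb]_t (H (x + t *: delta_mx 0 l))%:E = 0)%E ->
  (\int[mu n]_x (H x)%:E = 0)%E.
Proof.
elim: n l H => [[]//|n ih] l H mH HM H0 Hl.
have iH := bounded_support_integrable mH HM H0.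
have mE : measurable_fun setT (EFin \o H) by exact/measurable_EFinP.
rewrite (@integral_row_cons R n (EFin \o H) mE (integrable_row_consP iH)).
case: (unliftP ord0 l) => [l' lE|lE].
  rewrite -integral21_prod_meas1; last exact: integrable_row_consP.
  rewrite /fubini_G; under eq_integral => t _.
    have -> : (\int[mu n]_x ((EFin \o H) (row_cons (x, t))) = 0)%E; last over.
    apply: (ih l' (fun x => H (row_cons (x, t)))).
  - apply: measurableT_comp => //; apply: measurableT_comp; first exact: measurable_row_cons.
    exact: measurable_pair2.
  - by move=> x; exact: HM.
  - move=> x nx; apply: H0 => xK; apply: nx => j; have := xK (lift ord0 j).
    by rewrite row_cons_lift.
  - by move=> x; under eq_integral do rewrite row_cons_shift_lift; rewrite -lE Hl.
  by rewrite integral0.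
rewrite -integral12_prod_meas1; last exact: integrable_row_consP.
rewrite /fubini_F; under eq_integral => x _.
  rewrite /=; under eq_integral do rewrite row_cons_shift0.
  rewrite -lE Hl.
  over.
by rewrite integral0.
Qed.

Lemma integral_derive1_eq0 (g : R -> R) K : 0 < K -> (forall t, derivable g t 1) ->
  continuous (derive1 g) -> (forall t, K <= `|t| -> g t = 0) ->
  (\int[leb]_t (derive1 g t)%:E = 0)%E.
Proof.
move=> K0 dg cdg g0.
have d0 (t : R) : ~ `[- K, K]%classic t -> derive1 g t = 0.
  move=> nt; have Kt : K < `|t|.
    by rewrite ltNge; apply/negP => tK; apply: nt; rewrite /= in_itv/= -ler_norml.
  rewrite derive1E (@near_eq_derive _ _ _ g (cst 0)) ?derive_cst//.
  near=> y; apply: g0; apply: ltW.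
  near: y; apply: (@open_nbhs_nbhs _ t [set y : R | K < `|y|]); split=> //.
  apply: (@open_comp _ _ (fun y : R => `|y|) [set z | K < z]); last exact: open_gt.
  by move=> y _; exact: norm_continuous.
transitivity (\int[leb]_(t in `[(- K)%R, K]) (derive1 g t)%:E)%E.
  rewrite [RHS]integral_mkcond; apply: eq_integral => t _.
  rewrite patchE; case: ifPn => // /negP nt; rewrite d0//.
  by move=> h; apply: nt; rewrite inE.
have cg : continuous g by move=> t; apply: differentiable_continuous; apply/derivable1_diffP.
rewrite (@continuous_FTC2 _ _ g).
- by rewrite !g0 ?subee// ?normrN ger0_norm// ltW.
- by apply: (@lt_trans _ _ 0); rewrite ?oppr_lt0.
- exact: continuous_subspaceT.
- split.
  + by move=> x _; exact: dg.
  + by apply: cvg_at_right_filter; exact: cg.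
  + by apply: cvg_at_left_filter; exact: cg.
- by [].
Unshelve. all: by end_near. Qed.

End LineIntegrals.

Section Classical.
Context (R : realType) (n : nat).
Notation point := 'rV[R]_n.+1.
Notation mu := (@lebesgue_row R n.+1).
Notation leb := (@lebesgue_measure R).
Variables (Ob : set point) (l u : 'I_n.+1 -> R).
Hypothesis ObE : Ob = obox l u.
Implicit Types (f g v w : point -> R) (s : seq 'I_n.+1).

Let mO : measurable Ob. Proof. by rewrite ObE; exact: measurable_obox. Qed.

Let fin_Ob : (mu Ob < +oo)%E. Proof. by rewrite ObE; exact: obox_fin. Qed.

Lemma line_derivable f (v x : point) (t : R) : derivable f (x + t *: v) v ->
  derivable (fun r : R => f (x + r *: v)) t 1 /\
  derive1 (fun r : R => f (x + r *: v)) t = 'D_v f (x + t *: v).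
Proof.
rewrite derive1E /derivable /derive.
suff -> : (fun h : R => h^-1 *: (((fun r : R => f (x + r *: v)) \o shift t) (h *: (1 : R)) - f (x + t *: v))) =
  (fun h => h^-1 *: ((f \o shift (x + t *: v)) (h *: v) - f (x + t *: v))) by [].
apply/funext => h /=; congr (_ *: (f _ - _)).
by rewrite [h *: 1]mulr1 scalerDl addrCA.
Qed.

Lemma integral_partial_eq0 (i : 'I_n.+1) f : continuous f -> (forall x, derivable f x (delta_mx 0 i)) ->
  continuous (partial i f) -> (exists K, [/\ compact K, K `<=` Ob & forall x, ~ K x -> f x = 0]) ->
  \int[mu]_(x in Ob) partial i f x = 0.
Proof.
move=> cf df cpf [K [cK KO f0]].
have d0 x : ~ K x -> partial i f x = 0.
  move=> nKx; rewrite (@partial_local _ _ (~` K) i _ (fun=> 0))//; first by rewrite partial_cst.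
  rewrite openC; apply: compact_closed => //; exact: norm_hausdorff.
have [M _ hM] := compact_support_bounded cpf cK d0.
pose B := 1 + \sum_j (`|l j| + `|u j|).
have B0 : 0 < B by rewrite ltr_wpDr// sumr_ge0.
have KB x j : Ob x -> `|x 0 j| < B.
  rewrite ObE => /(_ j) /=; rewrite in_itv/= => /andP[lx xu].
  have h : `|l j| + `|u j| <= \sum_j (`|l j| + `|u j|).
    by rewrite (bigD1 j)//= lerDl sumr_ge0.
  have := ler_norm (u j); have := lerNnormlW (lexx `|l j|).
  rewrite ltr_norml /B; move: h; move: (\sum_j _) => S; move: (normr_ge0 (l j)) (normr_ge0 (u j)); lra.
rewrite Rintegral_mkcond (_ : _ \_ _ = partial i f); last first.
  apply/funext => x; rewrite patchE; case: ifPn => // /negP nx; rewrite d0// => /KO Ox.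
  by apply: nx; rewrite inE.
rewrite /Rintegral (@integral_lines0 R n.+1 i (partial i f) M B)//.
- exact: continuous_row_measurable.
- move=> x nx; apply: d0 => /KO Ox; apply: nx => j /=.
  by rewrite in_itv/= -ler_norml ltW// KB.
- move=> x; have E t : partial i f (x + t *: delta_mx 0 i) = derive1 (fun r : R => f (x + r *: delta_mx 0 i)) t.
    by have [_ ->] := line_derivable (df (x + t *: delta_mx 0 i)).
  under eq_integral do rewrite E.
  (* The line is parametrized from x itself, so t = 0 corresponds to the coordinate [x 0 i]; this
     shifts the radius of the support by at most its absolute value. *)
  apply: (@integral_derive1_eq0 R _ (B + `|x 0 i|)).
  + by rewrite ltr_wpDr.
  + by move=> t; have [] := line_derivable (df (x + t *: delta_mx 0 i)).
  + rewrite (_ : derive1 _ = (partial i f) \o (fun t : R => x + t *: delta_mx 0 i)); last first.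
      by apply/funext => t; rewrite -E.
    move=> t; apply: continuous_comp; last exact: cpf.
    by apply: cvgD; [exact: cvg_cst|apply: cvgZr_tmp; exact: cvg_id].
  + move=> t tB; apply: f0 => /KO /(KB _ i); rewrite !mxE !eqxx mulr1 ltNge => /negP; apply.
    have : `|t| <= `|x 0 i + t| + `|x 0 i|.
      by rewrite -[X in `|X| <= _](addrK (x 0 i)) [t + _]addrC; exact: ler_normB.
    lra.
Qed.

Lemma memL2_continuous f : continuous f -> memL2 Ob f.
Proof.
move=> cf.
have cl : compact [set x : point | forall j, `[l j, u j]%classic (x 0 j)].
  exact: (@rV_compact _ _ (fun j => `[l j, u j]%classic)) (fun j => @segment_compact _ _ _).
have [x0|/set0P x0] := eqVneq [set x : point | forall j, `[l j, u j]%classic (x 0 j)] set0.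
  apply: (memL2_bounded mO fin_Ob (measurable_funTS (continuous_row_measurable cf)) (C := 0)).
  move=> x; rewrite ObE => Ox; exfalso; suff : set0 x by [].
  by rewrite -x0 => j; apply: subset_itv_oo_cc; exact: Ox.
have cn : {within [set x : point | forall j, `[l j, u j]%classic (x 0 j)], continuous (fun x => `|f x|)}.
  apply: continuous_subspaceT => x.
  by apply: continuous_comp; [exact: cf|exact: norm_continuous].
have [c _ hc] := compact_EVT_max x0 cl cn.
apply: (memL2_bounded mO fin_Ob (measurable_funTS (continuous_row_measurable cf)) (C := `|f c|)).
move=> x; rewrite ObE => Ox; apply: hc; rewrite inE => j.
by apply: subset_itv_oo_cc; exact: Ox.
Qed.

(** The product of [f] with a test function has compact support in the box, so the integral of its
    partial derivative vanishes; the product rule gives the weak formula. *)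
Lemma is_wderiv_partial i f : continuous f -> (forall x, derivable f x (delta_mx 0 i)) ->
  continuous (partial i f) -> is_wderiv Ob [:: i] f (partial i f).
Proof.
move=> cf df cpf; split=> [|g tg]; first exact: memL2_continuous.
have [hg [K [cK KO g0]]] := tg.
have [cg dg] := hg [::]; have [cpg _] := hg [:: i].
have pE : partial i (f * g) = (fun x => f x * partial i g x + partial i f x * g x).
  by apply/funext => x; rewrite /partial (deriveM (df x) (dg i x)); congr (_ + _); exact: mulrC.
have mf := memL2_continuous cf; have mg := memL2_continuous cg.
have mpf := memL2_continuous cpf; have mpg := memL2_continuous cpg.
have H : \int[mu]_(x in Ob) partial i (f * g) x = 0.
  apply: integral_partial_eq0.
  - by move=> x; exact: (continuousM (cf x) (cg x)).
  - by move=> x; apply: derivableM; [exact: df|exact: dg].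
  - by rewrite pE => x; exact: (continuousD (continuousM (cf x) (cpg x)) (continuousM (cpf x) (cg x))).
  - by exists K; split=> // x nx; rewrite [LHS]/GRing.mul/= g0 ?mulr0.
move: H; rewrite pE RintegralD//; last 2 first.
- exact: memL2_integrableM.
- exact: memL2_integrableM.
by move=> /eqP; rewrite addr_eq0 => /eqP ->; rewrite expr1 mulN1r.
Qed.

Lemma is_wderiv_cons i s v w z : is_wderiv Ob [:: i] v w -> is_wderiv Ob s w z ->
  is_wderiv Ob (i :: s) v z.
Proof.
move=> [mw h1] [mz h2]; split=> // f tf.
rewrite [partials (i :: s) f]/(partials [:: i] (partials s f)).
by rewrite h1 ?h2//; [rewrite mulrA -exprD|exact: test_function_partials].
Qed.

End Classical.

(** * Derivatives of the background function [w_eps] *)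

Section Background.
Context (R : realType) (n : nat).
Notation point := 'rV[R]_n.+1.
Variables (Ob : set point) (l u : 'I_n.+1 -> R) (eps : R).
Hypothesis ObE : Ob = obox l u.
Hypothesis eps0 : 0 < eps.

Lemma is_derive_w_eps (x : point) i :
  is_derive x (delta_mx 0 i) (@w_eps R n eps) (- x 0 i / (2 * eps)).
Proof.
apply: is_derive_line.
pose c := (\sum_(j | j != i) x 0 j ^+ 2) / (4 * eps) + ln ((2 * Num.sqrt (pi * eps)) ^+ n.+1).
rewrite (_ : (fun h : R => _) = (fun h => - ((h + x 0 i) ^+ 2 / (4 * eps)) - c)); last first.
  apply/funext => h; rewrite /w_eps /sqnorm (bigD1 i)//= !mxE !eqxx mulr1 mulrDl opprD /c opprD addrA.
  congr (_ - _ / _ - _); apply: eq_bigr => j ji.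
  by rewrite !mxE eqxx/= (negbTE ji) mulr0 add0r.
pose F (r : R) := - (r ^+ 2 / (4 * eps)) - c.
rewrite (_ : (fun h : R => _) = (fun h => F (1 * h + x 0 i))); last first.
  by apply/funext => h; rewrite mul1r.
have e0 := lt0r_neq0 eps0.
rewrite (_ : - x 0 i / (2 * eps) = 1 * (- (2 * (x 0 i) / (4 * eps)))); last by field.
apply: is_derive_affine; rewrite mulr0 add0r.
have h : is_derive (x 0 i) 1 (fun r : R => (- (4 * eps)^-1) * (r ^+ 2)) ((- (4 * eps)^-1) * (2 * x 0 i)).
  have h2 := @is_deriveM _ _ _ _ _ _ _ _ (is_derive_id (x 0 i) (1 : R)) (is_derive_id (x 0 i) 1).
  have h3 := @is_deriveZ _ _ _ _ (- (4 * eps)^-1) _ _ _ h2.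
  have E : (x 0 i)%:A + (x 0 i)%:A = 2 * x 0 i.
    transitivity (x 0 i * 1 + x 0 i * 1); first by [].
    ring.
  rewrite E in h3.
  exact: h3.
rewrite (_ : F = (fun r : R => (- (4 * eps)^-1) * (r ^+ 2) - c)); last first.
  by apply/funext => r; rewrite /F mulNr mulrC.
have h4 := is_deriveB h (is_derive_cst c (x 0 i) 1).
by rewrite subr0 mulNr [_^-1 * _]mulrC in h4; exact: h4.
Qed.

Lemma partial_w_eps i : partial i (@w_eps R n eps) = (fun x => - x 0 i / (2 * eps)).
Proof. by apply/funext => x; rewrite /partial; have [] := is_derive_w_eps x i. Qed.

Lemma continuous_mul (f g : point -> R) : continuous f -> continuous g ->
  continuous (fun x => f x * g x).
Proof. by move=> cf cg x; exact: (continuousM (cf x) (cg x)). Qed.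

Lemma continuous_coordZ i (a : R) : continuous (fun x : point => a * x 0 i).
Proof. by apply: continuous_mul; [move=> x; exact: cst_continuous|exact: coord_continuous]. Qed.

Lemma continuous_w_eps : continuous (@w_eps R n eps).
Proof.
have cs : continuous (fun x : point => \sum_j x 0 j ^+ 2).
  rewrite (_ : (fun x : point => _) = \sum_j (fun x : point => x 0 j ^+ 2)); last first.
    by apply/funext => x; rewrite fct_sumE.
  elim/big_ind: _ => [x|f g cf cg x|j _ x]; first exact: cst_continuous.
    exact: (continuousD (cf x) (cg x)).
  by apply: (@continuous_mul (fun x => x 0 j) (fun x => x 0 j)); exact: coord_continuous.
have cq : continuous (fun x : point => sqnorm x * (4 * eps)^-1).
  by apply: continuous_mul => // x; exact: cst_continuous.
move=> x; exact: (continuousB (continuousN (cq x)) (@cst_continuous _ _ _ _)).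
Qed.

(** [recon] differentiates [wV] weakly, background included, so the classical derivatives of [w_eps]
    have to be recognized as weak ones. *)
Lemma is_wderiv_w_eps1 i : is_wderiv Ob [:: i] (@w_eps R n eps) (fun x => - x 0 i / (2 * eps)).
Proof.
rewrite -partial_w_eps; apply: (is_wderiv_partial ObE).
- exact: continuous_w_eps.
- by move=> x; have [] := is_derive_w_eps x i.
- rewrite partial_w_eps (_ : (fun x => _) = (fun x : point => - (2 * eps)^-1 * x 0 i)).
    exact: continuous_coordZ.
  by apply/funext => x; rewrite mulNr mulrC mulNr.
Qed.

Lemma is_wderiv_w_eps2 i : is_wderiv Ob [:: i; i] (@w_eps R n eps) (fun=> - (2 * eps)^-1).
Proof.
apply: (is_wderiv_cons (is_wderiv_w_eps1 i)).
have E (x : point) : is_derive x (delta_mx 0 i) (fun x : point => - x 0 i / (2 * eps)) (- (2 * eps)^-1).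
  apply: is_derive_line.
  rewrite (_ : (fun h : R => _) = (fun h => (- (2 * eps)^-1) * h + - x 0 i / (2 * eps))); last first.
    apply/funext => h; rewrite !mxE !eqxx mulr1; ring.
  rewrite -[X in is_derive _ _ _ X]mulr1; apply: (@is_derive_affine R (fun r => r)).
have E2 : partial i (fun x : point => - x 0 i / (2 * eps)) = (fun=> - (2 * eps)^-1).
  by apply/funext => x; rewrite /partial; have [] := E x.
rewrite -E2; apply: (is_wderiv_partial ObE).
- rewrite (_ : (fun x => _) = (fun x : point => - (2 * eps)^-1 * x 0 i)).
    exact: continuous_coordZ.
  by apply/funext => x; rewrite mulNr mulrC mulNr.
- by move=> x; have [] := E x.
- by rewrite E2 => x; exact: cst_continuous.
Qed.

End Background.

(** * Stability estimates *)

Section Estimates.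
Context (R : realType) (n : nat).
Variables (A B D eps h : R) (k : nat).
Hypotheses (hA : 0 < A) (hAB : A < B) (hD : 0 < D) (eps0 : 0 < eps) (h_gt0 : 0 < h).
Notation point := 'rV[R]_n.+1.
Notation mu := (@lebesgue_row R n.+1).
Notation tup := ('I_k.+1 -> point -> R).
Notation Om := (@Omega R n A B D).
Notation m := (mn n).
Implicit Types (v w : point -> R) (V W E : tup) (i j : 'I_k.+1) (l : 'I_n.+1).

Lemma OmegaE : Om = obox (fun l => if l == 0 then A else - D) (fun l => if l == 0 then B else D).
Proof.
apply/seteqP; split=> x /=.
  move=> [x0 xj] l; rewrite /= in_itv/=; case: eqVneq => [->//|l0].
  by rewrite -ltr_norml; exact: xj.
move=> H; split; first by have := H 0; rewrite /= in_itv.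
by move=> l l0; have := H l; rewrite /= in_itv/= (negbTE l0) -ltr_norml.
Qed.

Let OE := OmegaE.

Let mO : measurable Om. Proof. by rewrite OE; exact: measurable_obox. Qed.

Let m2 : (2 <= m)%N. Proof. by rewrite /mn leq_addl. Qed.

Lemma Omega_coord x l : Om x -> `|x 0 l| <= B + D.
Proof.
move=> [/andP[xA xB] xj]; have [->|l0] := eqVneq l 0.
  by rewrite ger0_norm; [move: xB hD; lra|move: xA hA; lra].
by have := xj _ l0; move: hAB hA; lra.
Qed.

Lemma L2le_wderiv v N p l : memH Om m v -> normH Om m v <= N -> (p <= 2)%N ->
  L2le Om (wderiv Om (nseq p l) v) N.
Proof.
move=> hv vN p2; have pm : (p <= m)%N by exact: leq_trans m2.
split; first exact: has_wderiv_memL2 (memH_nseq l hv pm).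
by apply: le_trans vN; exact: normH_ge.
Qed.

Lemma L2le_self q v N : memH Om q v -> normH Om q v <= N -> L2le Om v N.
Proof.
move=> hv vN; have [mv _] := hv; split=> //; apply: le_trans vN.
have h0 := memH_nseq ord0 hv (leq0n q).
rewrite (normL2_ae mO mv (has_wderiv_memL2 h0)); first exact: normH_ge.
by apply: filterS (wderiv_ae OE (is_wderiv_nil mv)) => x H /H.
Qed.

Lemma sobolev_Omega : exists2 C, 0 <= C & forall v l, memH Om m v ->
  {ae mu, forall x, Om x -> `|wderiv Om [:: l] v x| <= C * normH Om m v}.
Proof.
apply: (sobolev_grad OE); first by move=> l; case: ifP => _ //; move: hD; lra.
(* With N = n + 1 this is N < 2 ([N/2] + 1), the reason for the value of [mn]. *)
rewrite /mn addn2/= doubleS !ltnS -addnn.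
by rewrite -{1}(odd_double_half n) uphalf_half -addnn addnACA leq_add2r leq_addr.
Qed.

Lemma L2le_sumc (I : finType) (P : pred I) (F : I -> point -> R) M : 0 <= M ->
  (forall a, L2le Om (F a) M) -> L2le Om (fun x => \sum_(a | P a) F a x) (#|I|%:R * M).
Proof.
move=> M0 hF; have := L2le_sum mO (index_enum I) P hF; apply: L2le_trans.
apply: (@le_trans _ _ (\sum_(a : I) M)); last by rewrite sumr_const mulr_natl.
by rewrite big_mkcond; apply: ler_sum => i _; case: ifP.
Qed.

(** * Increments of the operators L_i *)

Definition time_quotient V i x : R :=
  let v (j : nat) := V (inord j) in
  if i == 0%N :> nat then (v 0%N x - v 1%N x) / h
  else if (i < k)%N then (V i x - v i.+1 x) / h
  else (v (k - 1)%N x + v (k - 2)%N x + v (k - 3)%N x - 3 * v k x) / (6 * h).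

Definition quad V W i x : R :=
  \sum_l wderiv Om [:: l] (V i) x * \sum_(j < k.+1 | (j <= i)%N) wderiv Om [:: l] (W j) x.

(** The boolean factor merges the case i = 0, without quadratic term, with the others, so that a
    single formula serves all increments. *)
Lemma LopE V i x : Lop A B D eps h V i x = wlap Om (V i) x
  + 2 * (\sum_l - x 0 l / (2 * eps) * wderiv Om [:: l] (V i) x)
  + (i != 0%N :> nat)%:R * (2 * h) * quad V V i x + time_quotient V i x.
Proof.
rewrite /Lop /time_quotient /quad.
have -> : \sum_l wderiv Om [:: l] (V i) x * partial l (@w_eps R n eps) x =
  \sum_l - x 0 l / (2 * eps) * wderiv Om [:: l] (V i) x.
  by apply: eq_bigr => l _; rewrite (partial_w_eps eps0) mulrC.
by case: (i == 0%N :> nat) => /=; rewrite ?mul0r ?addr0 ?mul1r//; case: ifP.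
Qed.

Lemma time_quotientD V E i x : time_quotient (V + E) i x = time_quotient V i x + time_quotient E i x.
Proof.
have VE (j : 'I_k.+1) : (V + E) j x = V j x + E j x by [].
rewrite /time_quotient !VE; case: ifP => _; first by rewrite opprD addrACA mulrDl.
case: ifP => _; first by rewrite opprD addrACA mulrDl.
by rewrite -mulrDl; congr (_ / _); ring.
Qed.

Lemma L2le_time_quotient E s : (forall i, L2le Om (E i) s) -> forall i, L2le Om (time_quotient E i) (2 / h * s).
Proof.
move=> hE i; have s0 := L2le_ge0 (hE i).
have hB j j' : L2le Om (fun x => (E j x - E j' x) / h) (2 / h * s).
  apply: (@L2le_ext _ _ _ (fun x => h^-1 * (E j x + -1 * E j' x))).
    by move=> x; rewrite mulN1r mulrC.
  apply: L2le_trans (L2leZ mO _ (L2leD mO (hE j) (L2leZ mO _ (hE j')))).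
  by rewrite normrN1 gtr0_norm ?invr_gt0//; rewrite le_eqVlt; apply/orP; left; apply/eqP; ring.
rewrite /time_quotient; case: (i == 0%N :> nat); first exact: hB.
case: (i < k)%N; first exact: hB.
(* In the last component the coefficients add up to 6 in absolute value, which gives 1/h, below the
   common constant 2/h. *)
apply: (@L2le_ext _ _ _ (fun x => (6 * h)^-1 * (E (inord (k - 1)) x + E (inord (k - 2)) x +
   E (inord (k - 3)) x + - 3 * E (inord k) x))).
  by move=> x; rewrite mulNr mulrC.
apply: L2le_trans (L2leZ mO _ (L2leD mO (L2leD mO (L2leD mO (hE _) (hE _)) (hE _)) (L2leZ mO _ (hE _)))).
rewrite normrN gtr0_norm ?invr_gt0 ?mulr_gt0// ger0_norm//.
have : 0 <= h^-1 * s by rewrite mulr_ge0// invr_ge0 ltW.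
rewrite invfM; move: h^-1 => H; lra.
Qed.

Lemma memL2_wderiv v p l : memH Om m v -> (p <= 2)%N -> memL2 Om (wderiv Om (nseq p l) v).
Proof. by move=> hv p2; exact: has_wderiv_memL2 (memH_nseq l hv (leq_trans p2 m2)). Qed.

(** Components and directions are finite in number, so one null set serves all of them; the
    pointwise algebra of the increments can then be done at a single point. *)
Lemma wderivD_tuple V E : memHk Om m V -> memHk Om m E ->
  {ae mu, forall x, Om x -> forall i l,
    wderiv Om [:: l] ((V + E) i) x = wderiv Om [:: l] (V i) x + wderiv Om [:: l] (E i) x /\
    wderiv Om [:: l; l] ((V + E) i) x = wderiv Om [:: l; l] (V i) x + wderiv Om [:: l; l] (E i) x}.
Proof.
move=> hV hE.
have H p i l : (p <= 2)%N -> {ae mu, forall x, Om x -> wderiv Om (nseq p l) ((V + E) i) x =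
    wderiv Om (nseq p l) (V i) x + wderiv Om (nseq p l) (E i) x}.
  move=> p2; have pm := leq_trans p2 m2.
  have := wderiv_lin OE 1 (memH_nseq l (hV i) pm) (memH_nseq l (hE i) pm).
  rewrite (_ : (fun x => V i x + 1 * E i x) = (V + E) i); last by apply/funext => x; rewrite mul1r.
  by apply: filterS => x K /K ->; rewrite mul1r.
have H' : \forall x \ae mu, forall (q : 'I_k.+1 * 'I_n.+1), Om x ->
    wderiv Om [:: q.2] ((V + E) q.1) x = wderiv Om [:: q.2] (V q.1) x + wderiv Om [:: q.2] (E q.1) x /\
    wderiv Om [:: q.2; q.2] ((V + E) q.1) x = wderiv Om [:: q.2; q.2] (V q.1) x + wderiv Om [:: q.2; q.2] (E q.1) x.
  apply: filter_forall => -[i l]; have h1 := H 1 i l isT; have h2' := H 2 i l isT.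
  by apply: filterS2 h1 h2' => x a1 a2 Ox; split; [exact: a1|exact: a2].
by apply: filterS H' => x K Ox i l; exact: (K (i, l) Ox).
Qed.

(** The quadratic part follows (a + e)(b + f) - ab = a f + (b + f) e: every product keeps one
    derivative of [E], to be measured in L_2, while the other factor is bounded uniformly. *)
Definition Lop_incr V E i x : R := wlap Om (E i) x
  + 2 * (\sum_l - x 0 l / (2 * eps) * wderiv Om [:: l] (E i) x)
  + (i != 0%N :> nat)%:R * (2 * h) * (\sum_l (
       \sum_(j < k.+1 | (j <= i)%N) wderiv Om [:: l] (V i) x * wderiv Om [:: l] (E j) x
     + \sum_(j < k.+1 | (j <= i)%N)
         (wderiv Om [:: l] (V j) x + wderiv Om [:: l] (E j) x) * wderiv Om [:: l] (E i) x))
  + time_quotient E i x.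

Lemma LopD V E i : memHk Om m V -> memHk Om m E ->
  {ae mu, forall x, Om x -> Lop A B D eps h (V + E) i x =
    Lop A B D eps h V i x + Lop_incr V E i x}.
Proof.
move=> hV hE; apply: filterS (wderivD_tuple hV hE) => x H Ox.
rewrite !LopE /Lop_incr time_quotientD.
have -> : wlap Om ((V + E) i) x = wlap Om (V i) x + wlap Om (E i) x.
  by rewrite /wlap -big_split; apply: eq_bigr => l _; case: (H Ox i l).
have -> : \sum_l - x 0 l / (2 * eps) * wderiv Om [:: l] ((V + E) i) x =
   \sum_l - x 0 l / (2 * eps) * wderiv Om [:: l] (V i) x +
   \sum_l - x 0 l / (2 * eps) * wderiv Om [:: l] (E i) x.
  by rewrite -big_split; apply: eq_bigr => l _; case: (H Ox i l) => -> _; rewrite mulrDr.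
set S := \sum_l (_ + _).
have -> : quad (V + E) (V + E) i x = quad V V i x + S.
  rewrite /quad /S -big_split; apply: eq_bigr => l _; case: (H Ox i l) => -> _ /=.
  rewrite -mulr_sumr -mulr_suml big_split/=.
  under eq_bigr => j _ do rewrite (H Ox j l).1.
  rewrite big_split/=; ring.
by move: (quad _ _ _ _) S (\sum_l _) (\sum_l _) (time_quotient _ _ _) (time_quotient _ _ _) (wlap _ _ _) (wlap _ _ _) (_ * (2 * h)) => *; ring.
Qed.

Lemma measurable_coordZ l : measurable_fun Om (fun x : point => - x 0 l / (2 * eps)).
Proof.
apply: measurable_funTS; apply: (@measurable_coord R n.+1 l (fun t => - t / (2 * eps))).
by apply: measurable_funM => //; exact: measurable_funN.
Qed.

Lemma measurable_Lop V i : memHk Om m V -> measurable_fun Om (Lop A B D eps h V i).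
Proof.
move=> hV; rewrite (_ : Lop _ _ _ _ _ _ _ = fun x => wlap Om (V i) x
  + 2 * (\sum_l - x 0 l / (2 * eps) * wderiv Om [:: l] (V i) x)
  + (i != 0%N :> nat)%:R * (2 * h) * quad V V i x + time_quotient V i x); last by apply/funext => x; exact: LopE.
have m1 l j : measurable_fun Om (wderiv Om [:: l] (V j)) by case: (memL2_wderiv l (hV j) (isT : 1 <= 2)%N).
apply: measurable_funD; first apply: measurable_funD; first apply: measurable_funD.
- by apply: measurable_sum => l; case: (memL2_wderiv l (hV i) (isT : 2 <= 2)%N).
- apply: measurable_funM => //; apply: measurable_sum => l; apply: measurable_funM => //.
  exact: measurable_coordZ.
- apply: measurable_funM => //; apply: measurable_sum => l; apply: measurable_funM => //.
  have [] := memL2_sum mO (index_enum 'I_k.+1) (fun j : 'I_k.+1 => (j <= i)%N)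
    (fun j => memL2_wderiv l (hV j) (isT : 1 <= 2)%N); by [].
- have hL j : L2le Om (V j) (\sum_j normL2 Om (V j)).
    split; first by case: (hV j).
    by apply: (@ler_sum_term R _ (fun j => normL2 Om (V j)) j) => a; exact: normL2_ge0.
  by have [[]] := L2le_time_quotient hL i.
Qed.

(** The assumption s <= 1 bounds the gradient of [E] by a constant, so the terms quadratic in [E]
    are also of order s. The constant is chosen before V, E and s. *)
Lemma L2le_Lop_incr rho : 0 <= rho -> exists2 K, 0 <= K & forall V E s,
  memHk Om m V -> (forall i, normH Om m (V i) <= rho) ->
  memHk Om m E -> (forall i, normH Om m (E i) <= s) -> s <= 1 ->
  forall i, L2le Om (Lop_incr V E i) (K * s).
Proof.
move=> rho0; have [C C0 hC] := sobolev_Omega.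
pose N : R := #|'I_n.+1|%:R; pose M : R := #|'I_k.+1|%:R.
pose X := (B + D) / (2 * eps).
have N0 : 0 <= N by []. have M0 : 0 <= M by [].
have BD0 : 0 <= B + D by move: hA hAB hD; lra.
have X0 : 0 <= X by rewrite divr_ge0// mulr_ge0// ltW.
have hi : 0 <= h^-1 by rewrite invr_ge0 ltW.
have h0 : 0 <= h by exact: ltW.
exists (N + 2 * (N * X) + 2 * h * (N * (M * (C * rho) + M * (C * rho + C))) + 2 / h).
  by do ![assumption | exact: ler0n | apply: addr_ge0 | apply: mulr_ge0].
move=> V E s hV Vr hE Es s1 i.
have s0 : 0 <= s by apply: le_trans (Es ord0); exact: sqrtr_ge0.
have mw v l : memH Om m v -> measurable_fun Om (wderiv Om [:: l] v).
  by move=> hv; case: (memL2_wderiv l hv (isT : 1 <= 2)%N).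
have E1 j l : L2le Om (wderiv Om [:: l] (E j)) s := L2le_wderiv l (hE j) (Es j) (isT : 1 <= 2)%N.
have E2 j l : L2le Om (wderiv Om [:: l; l] (E j)) s := L2le_wderiv l (hE j) (Es j) (isT : 2 <= 2)%N.
have bV j l : {ae mu, forall x, Om x -> `|wderiv Om [:: l] (V j) x| <= C * rho}.
  by apply: filterS (hC _ l (hV j)) => x H /H /le_trans; apply; rewrite ler_wpM2l.
have bE j l : {ae mu, forall x, Om x -> `|wderiv Om [:: l] (E j) x| <= C}.
  apply: filterS (hC _ l (hE j)) => x H /H /le_trans; apply.
  by rewrite -[leRHS]mulr1 ler_wpM2l// (le_trans (Es j)).
have T1 : L2le Om (wlap Om (E i)) (N * s) by apply: L2le_sumc.
have T2 : L2le Om (fun x => 2 * (\sum_l - x 0 l / (2 * eps) * wderiv Om [:: l] (E i) x)) (`|2| * (N * (X * s))).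
  apply: L2leZ => //; apply: L2le_sumc; first exact: mulr_ge0.
  move=> l; apply: L2leM => //; first exact: measurable_coordZ.
  apply: aeW => x Ox; rewrite normrM normrN normfV (ger0_norm (_ : 0 <= 2 * eps)); last by rewrite mulr_ge0// ltW.
  by rewrite ler_wpM2r ?invr_ge0 ?mulr_ge0 ?(ltW eps0)// Omega_coord.
have T3 : L2le Om (fun x => (i != 0%N :> nat)%:R * (2 * h) * (\sum_l (
       \sum_(j < k.+1 | (j <= i)%N) wderiv Om [:: l] (V i) x * wderiv Om [:: l] (E j) x
     + \sum_(j < k.+1 | (j <= i)%N)
         (wderiv Om [:: l] (V j) x + wderiv Om [:: l] (E j) x) * wderiv Om [:: l] (E i) x)))
    (`|(i != 0%N :> nat)%:R * (2 * h)| * (N * (M * (C * rho * s) + M * ((C * rho + C) * s)))).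
  apply: L2leZ => //; apply: L2le_sumc.
    by do ![assumption | exact: ler0n | apply: addr_ge0 | apply: mulr_ge0].
  move=> l; apply: L2leD => //; apply: L2le_sumc; rewrite ?mulr_ge0 ?addr_ge0 ?mulr_ge0//.
  - by move=> j; apply: L2leM => //; [exact: mw|exact: mulr_ge0].
  - move=> j; apply: L2leM => //.
    + by apply: measurable_funD; exact: mw.
    + by rewrite addr_ge0 ?mulr_ge0.
    + apply: filterS2 (bV j l) (bE j l) => x a b Ox.
      by apply: (le_trans (ler_normD _ _)); apply: lerD; [exact: a|exact: b].
have T4 := L2le_time_quotient (fun j => L2le_self (hE j) (Es j)) i.
apply: L2le_trans (L2leD mO (L2leD mO (L2leD mO T1 T2) T3) T4).
have d1 : `|(i != 0%N :> nat)%:R * (2 * h)| <= 2 * h.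
  by case: (i != 0%N :> nat); rewrite ?mul1r ?mul0r ?normr0 ?ger0_norm// ?mulr_ge0.
have Z0 : 0 <= N * (M * (C * rho * s) + M * ((C * rho + C) * s)).
  by do ![assumption | exact: ler0n | apply: addr_ge0 | apply: mulr_ge0].
have d2 := ler_wpM2r Z0 d1.
rewrite (ger0_norm (_ : 0 <= 2))//; apply: (@le_trans _ _ (N * s + 2 * (N * (X * s)) + 2 * h * (N * (M * (C * rho * s) + M * ((C * rho + C) * s))) + 2 / h * s)).
  by rewrite lerD2r lerD2l.
by rewrite le_eqVlt; apply/orP; left; apply/eqP; move: (h^-1) => H; ring.
Qed.

Lemma integral_Lop_le c lambda V E K s i : memHk Om m V -> memHk Om m E -> 0 <= lambda ->
  {ae mu, forall x, Om x -> Lop A B D eps h V i x = 0} ->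
  L2le Om (Lop_incr V E i) (K * s) ->
  expR (- (2 * lambda * c)) * \int[mu]_(x in Om) (Lop A B D eps h (V + E) i x ^+ 2 * carleman_weight lambda x)
    <= expR (2 * lambda * (B ^+ 2 - c)) * (K * s) ^+ 2.
Proof.
move=> hV hE l0 hL hI; have mVE : memHk Om m (V + E).
  move=> j; have := memH_lin OE 1 (hV j) (hE j).
  by rewrite (_ : (fun x => _) = (V + E) j)//; apply/funext => x; rewrite mul1r.
have hLE : L2le Om (Lop A B D eps h (V + E) i) (K * s).
  apply: L2le_ae hI => //; first exact: measurable_Lop.
  by apply: filterS2 hL (LopD i hV hE) => x a b Ox; rewrite b// a// add0r.
(* The square root of the Carleman weight, which makes the weighted integral a squared L_2-norm; on
   the domain it is at most e^(lambda B^2), as 0 < A < x_1 < B. *)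
pose b (x : point) := expR (lambda * x 0 0 ^+ 2).
have mb : measurable_fun Om b.
  apply: measurable_funTS; apply: (@measurable_coord R n.+1 0 (fun t => expR (lambda * t ^+ 2))).
  apply: measurableT_comp => //; apply: measurable_funM => //.
have hb : L2le Om (fun x => b x * Lop A B D eps h (V + E) i x) (expR (lambda * B ^+ 2) * (K * s)).
  apply: L2leM => //.
  apply: aeW => x [/andP[xA xB] _]; rewrite ger0_norm ?expR_ge0// ler_expR ler_wpM2l//.
  by rewrite ler_sqr ?nnegrE; move: xA xB hA; lra.
have -> : \int[mu]_(x in Om) (Lop A B D eps h (V + E) i x ^+ 2 * carleman_weight lambda x) =
    normL2 Om (fun x => b x * Lop A B D eps h (V + E) i x) ^+ 2.
  rewrite normL2_sq /ipL2; congr (Rintegral _ _ _); apply/funext => x.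
  rewrite /carleman_weight (_ : expR (2 * _ * _) = b x ^+ 2); first by ring.
  by rewrite [b x ^+ 2]expr2 /b -expRD; congr expR; ring.
have [_ hb2] := hb.
apply: (@le_trans _ _ (expR (- (2 * lambda * c)) * (expR (lambda * B ^+ 2) * (K * s)) ^+ 2)).
  rewrite ler_wpM2l ?expR_ge0// ler_sqr ?nnegrE ?normL2_ge0//.
  exact: (le_trans (normL2_ge0 _ _) hb2).
rewrite exprMn mulrA le_eqVlt; apply/orP; left; apply/eqP; congr (_ * _).
by rewrite [expR (lambda * _) ^+ 2]expr2 -!expRD; congr expR; ring.
Qed.

Lemma memHkD V E : memHk Om m V -> memHk Om m E -> memHk Om m (V + E).
Proof.
move=> hV hE j; have := memH_lin OE 1 (hV j) (hE j).
by rewrite (_ : (fun x => _) = (V + E) j)//; apply/funext => x; rewrite mul1r.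
Qed.

(** * The reconstruction formula *)

Lemma wVE V i : wV eps h V i = (fun x => w_eps eps x + h * \sum_(j < k.+1 | (j <= i)%N) V j x).
Proof. by apply/funext => x; rewrite /wV addrC. Qed.

Lemma has_wderiv_w_eps p l : (p <= 2)%N -> has_wderiv Om (nseq p l) (@w_eps R n eps).
Proof.
have mw : memL2 Om (@w_eps R n eps) by apply: (memL2_continuous OE); exact: continuous_w_eps.
case: p => [|[|[|//]]] _; split=> //; eexists.
- exact: is_wderiv_nil.
- exact: (is_wderiv_w_eps1 OE eps0 l).
- exact: (is_wderiv_w_eps2 OE eps0 l).
Qed.

Lemma has_wderiv_wV V i p l : memHk Om m V -> (p <= 2)%N -> has_wderiv Om (nseq p l) (wV eps h V i).
Proof.
move=> hV p2; rewrite wVE; apply: (has_wderiv_lin OE); first exact: has_wderiv_w_eps.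
by apply: (has_wderiv_sum OE) => j; exact: memH_nseq (hV j) (leq_trans p2 m2).
Qed.

Lemma wderiv_wV V : memHk Om m V -> {ae mu, forall x, Om x -> forall i l,
    wderiv Om [:: l] (wV eps h V i) x =
      - x 0 l / (2 * eps) + h * \sum_(j < k.+1 | (j <= i)%N) wderiv Om [:: l] (V j) x /\
    wderiv Om [:: l; l] (wV eps h V i) x =
      - (2 * eps)^-1 + h * \sum_(j < k.+1 | (j <= i)%N) wderiv Om [:: l; l] (V j) x}.
Proof.
move=> hV.
have H p i l : (p <= 2)%N -> {ae mu, forall x, Om x -> wderiv Om (nseq p l) (wV eps h V i) x =
    wderiv Om (nseq p l) (w_eps eps) x + h * \sum_(j < k.+1 | (j <= i)%N) wderiv Om (nseq p l) (V j) x}.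
  move=> p2; have hj j := memH_nseq l (hV j) (leq_trans p2 m2).
  have h1 := wderiv_lin OE h (has_wderiv_w_eps l p2)
    (has_wderiv_sum OE (index_enum 'I_k.+1) (fun j : 'I_k.+1 => (j <= i)%N) hj).
  rewrite wVE; apply: filterS2 h1 (wderiv_sum OE (index_enum 'I_k.+1) (fun j : 'I_k.+1 => (j <= i)%N) hj) => x a b Ox.
  by rewrite a// b.
have H' : \forall x \ae mu, forall (q : 'I_k.+1 * 'I_n.+1), Om x ->
    wderiv Om [:: q.2] (wV eps h V q.1) x =
      - x 0 q.2 / (2 * eps) + h * \sum_(j < k.+1 | (j <= q.1)%N) wderiv Om [:: q.2] (V j) x /\
    wderiv Om [:: q.2; q.2] (wV eps h V q.1) x =
      - (2 * eps)^-1 + h * \sum_(j < k.+1 | (j <= q.1)%N) wderiv Om [:: q.2; q.2] (V j) x.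
  apply: filter_forall => -[i l].
  have a1 := H 1 i l isT; have a2 := H 2 i l isT.
  have b1 := wderiv_ae OE (is_wderiv_w_eps1 OE eps0 l).
  have b2 := wderiv_ae OE (is_wderiv_w_eps2 OE eps0 l).
  apply: filterS2 (filterI a1 b1) (filterI a2 b2) => x [c1 d1] [c2 d2] Ox; split.
    by rewrite [LHS](c1 Ox) [X in X + _](d1 Ox).
  by rewrite [LHS](c2 Ox) [X in X + _](d2 Ox).
by apply: filterS H' => x K Ox i l; exact: (K (i, l) Ox).
Qed.

Lemma measurable_recon V : memHk Om m V -> measurable_fun Om (recon A B D eps h V).
Proof.
move=> hV; have mW p i l : (p <= 2)%N -> measurable_fun Om (wderiv Om (nseq p l) (wV eps h V i)).
  by move=> p2; have [] := has_wderiv_memL2 (has_wderiv_wV i l hV p2).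
have m0 : measurable_fun Om (wV eps h V ord_max).
  by have [[]] := has_wderiv_wV ord_max ord0 hV (isT : 0 <= 2)%N.
have mw : measurable_fun Om (@w_eps R n eps) by have [[]] := @has_wderiv_w_eps 0 ord0 isT.
apply: measurable_funB; apply: measurable_funM => //; first exact: measurable_funB.
apply: measurable_sum => i; apply: measurable_funD; apply: measurable_sum => l.
  exact: (mW 2).
by apply: measurable_funX; exact: (mW 1).
Qed.

(** The squared gradients are handled by a^2 - b^2 = (a + b)(a - b): the sum is bounded through the
    H^m-norms of both arguments, and the difference is linear in the first derivatives of [Z]. All
    other terms are linear in [Z]. *)
Lemma L2le_recon rho : 0 <= rho -> exists2 K, 0 <= K & forall V Z t,
  memHk Om m V -> memHk Om m Z -> (forall i, normH Om m (V i) <= rho) ->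
  (forall i, normH Om m ((V + Z) i) <= rho) ->
  (forall i, L2le Om (Z i) t) -> (forall i l, L2le Om (wderiv Om [:: l] (Z i)) t) ->
  (forall i l, L2le Om (wderiv Om [:: l; l] (Z i)) t) ->
  L2le Om (recon A B D eps h (V + Z) - recon A B D eps h V) (K * t).
Proof.
move=> rho0; have [C C0 hC] := sobolev_Omega.
pose N : R := #|'I_n.+1|%:R; pose M : R := #|'I_k.+1|%:R.
pose X := (B + D) / (2 * eps); pose T := (Tfin eps k h - eps)^-1.
have N0 : 0 <= N by []. have M0 : 0 <= M by [].
have BD0 : 0 <= B + D by move: hA hAB hD; lra.
have X0 : 0 <= X by rewrite divr_ge0// mulr_ge0// ltW.
have h0 : 0 <= h by exact: ltW.
have T0 : 0 <= `|T| by [].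
pose b := 2 * X + h * (M * (C * rho + C * rho)).
have b0 : 0 <= b by do ![assumption | exact: ler0n | apply: addr_ge0 | apply: mulr_ge0].
exists (`|T| * (h * M) + `|T| * (M * (N * (h * M) + N * (b * (h * M))))).
  by do ![assumption | exact: ler0n | apply: addr_ge0 | apply: mulr_ge0].
move=> V Z t hV hZ Vr VZr Z0 Z1 Z2; have t0 := L2le_ge0 (Z0 ord0).
have hVZ := memHkD hV hZ.
have bd W j l : memHk Om m W -> (forall i, normH Om m (W i) <= rho) ->
    {ae mu, forall x, Om x -> `|wderiv Om [:: l] (W j) x| <= C * rho}.
  move=> hW Wr; apply: filterS (hC _ l (hW j)) => x H /H /le_trans; apply.
  by rewrite ler_wpM2l.
(* The sum of the first derivatives of [wV] at V and at V + Z; the background contributes twice. *)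
pose p l i (x : point) := 2 * (- x 0 l / (2 * eps)) + h * \sum_(j < k.+1 | (j <= i)%N)
  (wderiv Om [:: l] (V j) x + wderiv Om [:: l] ((V + Z) j) x).
have hp l i : {ae mu, forall x, Om x -> `|p l i x| <= b}.
  have H : \forall x \ae mu, forall j : 'I_k.+1, Om x ->
      `|wderiv Om [:: l] (V j) x + wderiv Om [:: l] ((V + Z) j) x| <= C * rho + C * rho.
    apply: filter_forall => j; apply: filterS2 (bd V j l hV Vr) (bd (V + Z) j l hVZ VZr) => x a1 a2 Ox.
    by apply: (le_trans (ler_normD _ _)); apply: lerD; [exact: a1|exact: a2].
  apply: filterS H => x H Ox; apply: (le_trans (ler_normD _ _)); rewrite /b !normrM.
  rewrite (ger0_norm h0) (ger0_norm (_ : 0 <= 2))//; apply: lerD; last rewrite ler_wpM2l//.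
    rewrite ler_wpM2l// normrN normfV (ger0_norm (_ : 0 <= 2 * eps)); last by rewrite mulr_ge0// ltW.
    by rewrite ler_wpM2r ?invr_ge0 ?mulr_ge0 ?(ltW eps0)// Omega_coord.
  apply: (le_trans (ler_norm_sum _ _ _)).
  apply: (@le_trans _ _ (\sum_(j : 'I_k.+1) (C * rho + C * rho))); last by rewrite sumr_const mulr_natl.
  rewrite big_mkcond; apply: ler_sum => j _; case: ifP => _; last by rewrite addr_ge0 ?mulr_ge0.
  exact: H.
have mp l i : measurable_fun Om (p l i).
  apply: measurable_funD; apply: measurable_funM => //; first exact: measurable_coordZ.
  have mm j := memL2D mO (memL2_wderiv l (hV j) (isT : 1 <= 2)%N) (memL2_wderiv l (hVZ j) (isT : 1 <= 2)%N).
  by have [] := memL2_sum mO (index_enum 'I_k.+1) (fun j : 'I_k.+1 => (j <= i)%N) mm.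
pose F (x : point) := T * (h * \sum_(j < k.+1 | (j <= @ord_max k)%N) Z j x) + - T * \sum_(i < k.+1) (
  \sum_(l < n.+1) h * \sum_(j < k.+1 | (j <= i)%N) wderiv Om [:: l; l] (Z j) x +
  \sum_(l < n.+1) p l i x * (h * \sum_(j < k.+1 | (j <= i)%N) wderiv Om [:: l] (Z j) x)).
have hF : L2le Om F (`|T| * (`|h| * (M * t)) + `|- T| * (M * (N * (`|h| * (M * t)) + N * (b * (`|h| * (M * t)))))).
  have hs (G : tup) i : (forall j, L2le Om (G j) t) ->
      L2le Om (fun x => h * \sum_(j < k.+1 | (j <= i)%N) G j x) (`|h| * (M * t)).
    by move=> hG; apply: L2leZ => //; exact: L2le_sumc.
  have u0 : 0 <= `|h| * (M * t) by do ![assumption | exact: normr_ge0 | apply: mulr_ge0].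
  apply: L2leD => //; apply: L2leZ => //; first exact: hs.
  apply: L2le_sumc => [|i].
    by do ![assumption | exact: ler0n | apply: addr_ge0 | apply: mulr_ge0].
  apply: L2leD => //.
    by apply: L2le_sumc => // l; apply: hs => j; exact: Z2.
  apply: L2le_sumc => [|l]; first exact: mulr_ge0.
  by apply: L2leM => //; apply: hs => j; exact: Z1.
apply: (@L2le_trans _ _ _ _ (`|T| * (`|h| * (M * t)) + `|- T| * (M * (N * (`|h| * (M * t)) + N * (b * (`|h| * (M * t))))))).
  by rewrite normrN (ger0_norm h0) le_eqVlt; apply/orP; left; apply/eqP; move: (`|T|) => q; ring.
apply: L2le_ae hF => //.
  by apply: measurable_funB; exact: measurable_recon.
apply: filterS2 (wderivD_tuple hV hZ) (filterI (wderiv_wV hV) (wderiv_wV hVZ)) => x H [H1 H2] Ox.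
transitivity (recon A B D eps h (V + Z) x - recon A B D eps h V x); last by [].
rewrite /recon -/T /F.
have e0 : wV eps h (V + Z) ord_max x - w_eps eps x - (wV eps h V ord_max x - w_eps eps x) =
    h * \sum_(j < k.+1 | (j <= @ord_max k)%N) Z j x.
  rewrite /wV !addrK -mulrBr -sumrB; congr (_ * _); apply: eq_bigr => j _.
  by rewrite [(V + Z) j x]/(V j x + Z j x) addrC addKr.
have e1 i : wlap Om (wV eps h (V + Z) i) x + \sum_l wderiv Om [:: l] (wV eps h (V + Z) i) x ^+ 2
   - (wlap Om (wV eps h V i) x + \sum_l wderiv Om [:: l] (wV eps h V i) x ^+ 2) =
   \sum_(l < n.+1) h * \sum_(j < k.+1 | (j <= i)%N) wderiv Om [:: l; l] (Z j) x +
   \sum_(l < n.+1) p l i x * (h * \sum_(j < k.+1 | (j <= i)%N) wderiv Om [:: l] (Z j) x).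
  rewrite /wlap opprD addrACA -!sumrB; congr (_ + _); apply: eq_bigr => l _.
    rewrite (H2 Ox i l).2 (H1 Ox i l).2.
    under eq_bigr => j _ do rewrite (H Ox j l).2.
    by rewrite big_split/=; ring.
  rewrite (H2 Ox i l).1 (H1 Ox i l).1 /p.
  under eq_bigr => j _ do rewrite (H Ox j l).1.
  under [in RHS]eq_bigr => j _ do rewrite (H Ox j l).1.
  by rewrite !big_split/=; ring.
rewrite -(eq_bigr _ (fun i _ => e1 i)).
rewrite -e0 sumrB.
move: (\sum_(i < k.+1) _) (\sum_(i < k.+1) _) => S1 S2.
move: (wV eps h (V + Z) ord_max x) (wV eps h V ord_max x) (w_eps eps x) => a1 a2 a3.
ring.
Qed.

(** * The ball, the functional and strong convexity *)

Lemma memH_widen q v : (q <= m)%N -> memH Om m v -> memH Om q v.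
Proof.
move=> qm [mv hv]; split=> // a aq; have qm1 : (q.+1 <= m.+1)%N by [].
pose b : {ffun 'I_n.+1 -> 'I_m.+1} := [ffun i => widen_ord qm1 (a i)].
have E : mi_seq b = mi_seq a.
  by congr flatten; apply: eq_map => i; rewrite ffunE.
by rewrite -E; apply: hv; rewrite -size_mi_seq E size_mi_seq (leq_trans aq).
Qed.

Lemma normH_opp q v : memH Om q v -> normH Om q (- v) <= normH Om q v.
Proof.
move=> hv; have h0 : memH Om q (fun=> 0).
  split; first exact: memL20.
  by move=> a _; case: (has_wderiv0 Om (mi_seq a)).
have := normH_lin OE (-1) h0 hv; rewrite normrN1 mul1r {2}/normH (ipH0 OE h0) sqrtr0 add0r.
by rewrite (_ : (fun x => _) = - v)//; apply/funext => x; rewrite add0r mulN1r.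
Qed.

Lemma has_trace_ae v w (S : set point) g : {ae mu, forall x, Om x -> v x = w x} ->
  has_trace Om v S g -> has_trace Om w S g.
Proof.
move=> vw [f [cf fv fg]]; exists f; split=> //.
by apply: filterS2 vw fv => x a b Ox; rewrite b// a.
Qed.

Lemma has_traceB v w (S : set point) g : has_trace Om v S g -> has_trace Om w S g ->
  has_trace Om (fun x => v x + -1 * w x) S (fun=> 0).
Proof.
move=> [f [cf fv fg]] [f' [cf' fv' fg']]; exists (f - f'); split=> //.
- exact: within_continuousB.
- by apply: filterS2 fv fv' => x a b Ox; rewrite mulN1r -a// -b.
- by move=> x Sx; rewrite (_ : (f - f') x = f x - f' x)// fg// fg'// subrr.
Qed.

Lemma subE v w : (fun x => v x + -1 * w x) = v - w.
Proof. by apply/funext => x; rewrite mulN1r. Qed.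

(** Equal boundary data cancel, which places Q = V' - G' in the ball of radius 2r. For the normal
    derivative the trace has to pass from the difference of the chosen derivatives to the chosen
    derivative of the difference, which agree only almost everywhere. *)
Lemma B0bar_sub g0 g1 r V W : Bset A B D eps h g0 g1 r V -> Bset A B D eps h g0 g1 r W ->
  B0bar A B D (2 * r) (V - W).
Proof.
move=> [mV Vr bV] [mW Wr bW].
have E i : (V - W) i = (fun x => V i x + -1 * W i x) by rewrite subE.
split=> [i|i]; rewrite E; last first.
  apply: (le_trans (normH_lin OE _ (mV i) (mW i))); rewrite normrN1 mul1r.
  by rewrite mulr_natl mulr2n lerD// ltW.
have [tV sV] := bV i; have [tW sW] := bW i; split.
- exact: memH_lin OE _ _ _ _ (mV i) (mW i).
- exact: has_traceB tV tW.
- apply: has_trace_ae (has_traceB sV sW).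
  have h1 := memH_nseq 0 (mV i) (leq_trans (isT : 1 <= 2)%N m2).
  have h2 := memH_nseq 0 (mW i) (leq_trans (isT : 1 <= 2)%N m2).
  by apply: filterS (wderiv_lin OE (-1) h1 h2) => x H /H ->.
Qed.

Lemma normHk_sq q V : normHk Om q V ^+ 2 = \sum_i ipH Om q (V i) (V i).
Proof. by rewrite /normHk sqr_sqrtr// /ipHk sumr_ge0// => i _; exact: ipH_ge0. Qed.

Lemma normH_sq q v : normH Om q v ^+ 2 = ipH Om q v v.
Proof. by rewrite /normH sqr_sqrtr// ipH_ge0. Qed.

Lemma normH_le_normHk q V i : normH Om q (V i) <= normHk Om q V.
Proof.
rewrite /normH /normHk ler_wsqrtr// /ipHk.
by apply: (@ler_sum_term R _ (fun j => ipH Om q (V j) (V j))) => j; exact: ipH_ge0.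
Qed.

Lemma normL2k_sq V : normL2k Om V ^+ 2 = \sum_i normL2 Om (V i) ^+ 2.
Proof. by rewrite /normL2k sqr_sqrtr// sumr_ge0// => i _; exact: sqr_ge0. Qed.

Definition mi2 : R := \sum_(a : {ffun 'I_n.+1 -> 'I_3}) 1.

Lemma normHk2_le V : normHk Om 2 V ^+ 2 <= mi2 * (normHk Om 1 V ^+ 2 +
  \sum_i \sum_j normL2k Om (fun q => wderiv Om [:: i; j] (V q)) ^+ 2).
Proof.
rewrite !normHk_sq.
have -> : \sum_i \sum_j normL2k Om (fun q => wderiv Om [:: i; j] (V q)) ^+ 2 =
    \sum_q \sum_i \sum_j normL2 Om (wderiv Om [:: i; j] (V q)) ^+ 2.
  rewrite [RHS]exchange_big; apply: eq_bigr => i _ /=.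
  rewrite [RHS]exchange_big; apply: eq_bigr => j _ /=; exact: normL2k_sq.
by rewrite -big_split mulr_sumr; apply: ler_sum => q _; exact: ipH2_le.
Qed.

Lemma Jfun_ge0 c lambda alpha V : 0 <= alpha -> 0 <= Jfun A B D eps h c lambda alpha V.
Proof.
move=> a0; apply: addr_ge0; apply: mulr_ge0; rewrite ?expR_ge0 ?sqr_ge0//.
apply: sumr_ge0 => i _.
by apply: Rintegral_ge0 => x _; rewrite mulr_ge0 ?sqr_ge0 ?expR_ge0.
Qed.

Lemma Jfun_le c lambda alpha r s K V E : 0 <= lambda -> 0 <= alpha -> 0 <= r -> s <= 1 ->
  memHk Om m V -> (forall i, normH Om m (V i) <= r) ->
  memHk Om m E -> (forall i, normH Om m (E i) <= s) ->
  (forall i, {ae mu, forall x, Om x -> Lop A B D eps h V i x = 0}) ->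
  (forall i, L2le Om (Lop_incr V E i) (K * s)) ->
  Jfun A B D eps h c lambda alpha (V + E) <=
    k.+1%:R * (expR (2 * lambda * (B ^+ 2 - c)) * (K * s) ^+ 2 + alpha * (r + 1) ^+ 2).
Proof.
move=> l0 a0 r0 s1 hV Vr hE Es hL hI; rewrite /Jfun mulrDr; apply: lerD.
  rewrite mulr_sumr; apply: (@le_trans _ _ (\sum_(i < k.+1) expR (2 * lambda * (B ^+ 2 - c)) * (K * s) ^+ 2)).
    by apply: ler_sum => i _; exact: integral_Lop_le.
  by rewrite sumr_const card_ord -[leLHS]mulr_natl.
rewrite [leRHS]mulrCA; apply: ler_wpM2l => //; rewrite normHk_sq.
apply: (@le_trans _ _ (\sum_(i < k.+1) (r + 1) ^+ 2)); last by rewrite sumr_const card_ord -[leLHS]mulr_natl.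
apply: ler_sum => i _; rewrite -normH_sq ler_sqr ?nnegrE ?sqrtr_ge0 ?addr_ge0//.
have := normH_lin OE 1 (hV i) (hE i); rewrite normr1 mul1r.
rewrite (_ : (fun x => _) = (V + E) i); last by apply/funext => x; rewrite mul1r.
by move=> /le_trans; apply; apply: lerD => //; exact: le_trans s1.
Qed.

Lemma memHkB V W : memHk Om m V -> memHk Om m W -> memHk Om m (V - W).
Proof.
move=> hV hW i; rewrite (_ : (V - W) i = V i - W i)// -subE.
exact: memH_lin OE _ _ _ _ (hV i) (hW i).
Qed.

Lemma ipHkB_opp P V W : memHk Om m P -> memHk Om m V -> memHk Om m W ->
  ipHk Om m P (V - W) = - ipHk Om m P (W - V).
Proof.
move=> hP hV hW; rewrite /ipHk -sumrN; apply: eq_bigr => i _.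
rewrite (_ : (V - W) i = V i - W i)// (_ : (W - V) i = W i - V i)// -!subE.
rewrite (ipH_lin OE (-1) (hP i) (hV i) (hW i)) (ipH_lin OE (-1) (hP i) (hW i) (hV i)).
by move: (ipH _ _ _ (V i)) (ipH _ _ _ (W i)) => p q; rewrite 2!mulN1r opprB.
Qed.

Lemma ipH_opp q v : memH Om q v -> ipH Om q (- v) (- v) <= ipH Om q v v.
Proof.
move=> /normH_opp H; rewrite -(normH_sq q v) -(normH_sq q (- v)).
by apply: lerXn2r H; rewrite nnegrE; exact: sqrtr_ge0.
Qed.

Lemma ler_normHk_sq q V W : (forall i, ipH Om q (V i) (V i) <= ipH Om q (W i) (W i)) ->
  normHk Om q V ^+ 2 <= normHk Om q W ^+ 2.
Proof. by move=> H; rewrite [leLHS]normHk_sq [leRHS]normHk_sq; apply: ler_sum => i _; exact: H. Qed.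

(** Convexity taken at the minimizer controls Q - Wmin, while the theorem measures Wmin - Q. *)
Lemma normHk2_sym V W : memHk Om m V -> memHk Om m W ->
  normHk Om 2 (V - W) ^+ 2 <= normHk Om 2 (W - V) ^+ 2.
Proof.
move=> hV hW; have hWV := memHkB hW hV.
have E : V - W = - (W - V) by rewrite opprB.
rewrite E; move: (W - V) hWV => P hP.
by apply: ler_normHk_sq => i; exact: ipH_opp (memH_widen m2 (hP i)).
Qed.

(** Three terms are dropped by sign: the pairing with the derivative at the minimizer, the value of
    the functional there, and the alpha-term of the convexity inequality. Since lambda >= 1, the
    weaker weight, divided by lambda, serves for the H^1-term too, and [ipH2_le] assembles the
    H^2-norm. *)
Lemma convexity_H2 c lambda alpha r C (G Wmin Q : tup) : 0 < C -> 1 <= lambda -> 0 <= alpha ->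
  strongly_convex A B D eps h c lambda alpha r C G ->
  is_minimizer (Ifun A B D eps h c lambda alpha G) (B0bar A B D (2 * r)) Wmin ->
  B0bar A B D (2 * r) Q ->
  C * (expR (2 * lambda * (A ^+ 2 - c)) / lambda) * normHk Om 2 (Wmin - Q) ^+ 2 <=
    mi2 * Ifun A B D eps h c lambda alpha G Q.
Proof.
have aux (y1 x1 x2 p f1 f2 f3 : R) : y1 + x2 + f3 <= f1 - f2 - (- p) -> 0 <= f2 ->
  0 <= f3 -> p <= 0 -> x1 <= x2 -> x1 + y1 <= f1 by lra.
move=> C0 l1 a0 [dF [hd hcv _ _ hvar]] hmin hQ.
have [hW _] := hmin.
have [mW0 _] := hW; have [mQ0 _] := hQ; have [hdF _] := hd _ hW.
have mW : memHk Om m Wmin by move=> i; case: (mW0 i).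
have mQ : memHk Om m Q by move=> i; case: (mQ0 i).
have mdF : memHk Om m (dF Wmin) by move=> i; case: (hdF i).
have ip0 := hvar _ hmin _ hQ.
have cv := hcv _ _ hW hQ.
rewrite (ipHkB_opp mdF mQ mW) in cv.
have F0 : 0 <= Ifun A B D eps h c lambda alpha G Wmin by exact: Jfun_ge0.
have a2 : 0 <= alpha * normHk Om m (Q - Wmin) ^+ 2 by apply: mulr_ge0 a0 (sqr_ge0 _).
have N2 := le_trans (normHk2_sym mW mQ) (normHk2_le (Q - Wmin)).
have N20 : 0 <= mi2 by exact: sumr_ge0.
clear hd hcv hvar hmin hQ hW mW0 mQ0 hdF.
have l0 : 0 < lambda by apply: lt_le_trans l1.
set e := expR _ in cv *.
have e0 : 0 < e by exact: expR_gt0.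
have Ce : C * (e / lambda) <= C * e.
  by rewrite ler_pM2l// ler_pdivrMr// ler_peMr// ltW.
have Ce0 : 0 <= C * (e / lambda) by apply: mulr_ge0 (ltW C0) (divr_ge0 (ltW e0) (ltW l0)).
apply: (le_trans (ler_wpM2l Ce0 N2)); rewrite mulrCA; apply: (ler_wpM2l N20).
move: cv; set X := normHk _ 1 _ ^+ 2; set Y := \sum_i _ => cv.
have X0 : 0 <= X by exact: sqr_ge0.
rewrite mulrDr; exact: aux cv F0 a2 ip0 (ler_wpM2r X0 Ce).
Qed.

Lemma le_sqrt_add (y a b : R) : 0 <= a -> 0 <= b -> y ^+ 2 <= a ^+ 2 + b ^+ 2 -> y <= a + b.
Proof.
move=> a0 b0 H; have ab : 0 <= a * b by exact: mulr_ge0.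
have [y0|y0] := leP y 0; first by apply: (le_trans y0); rewrite addr_ge0.
rewrite -ler_sqr ?nnegrE ?addr_ge0 ?(ltW y0)// sqrrD.
by move: H ab; rewrite mulr2n; lra.
Qed.

(** The quotient of the two exponentials is e^(2 lambda (B^2 - A^2)), free of c, whereas the
    alpha-term keeps e^(-2 lambda (A^2 - c)). The square root of sigma appears because s^2 is
    replaced by the larger s before roots are taken; the two constants K and r + 1 are then merged
    into their sum. *)
Lemma error_absorb (C lambda c alpha s K r M Y2 y : R) : 0 < C -> 1 <= lambda -> 0 < alpha ->
  0 < s < 1 -> 0 <= K -> 0 <= r -> 0 <= M ->
  C * (expR (2 * lambda * (A ^+ 2 - c)) / lambda) * y ^+ 2 <=
    M * (expR (2 * lambda * (B ^+ 2 - c)) * (K * s) ^+ 2 + alpha * (r + 1) ^+ 2) ->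
  y <= Num.sqrt (M / C) * (K + r + 1) *
    (Num.sqrt lambda * Num.sqrt s * expR (lambda * (B ^+ 2 - A ^+ 2))
     + Num.sqrt (lambda * alpha) * expR (- (lambda * (A ^+ 2 - c)))).
Proof.
move=> C0 l1 al0 /andP[s0 s1] K0 r0 M0 H.
have l0 : 0 < lambda by apply: lt_le_trans l1.
set q := Num.sqrt (M / C); set a := Num.sqrt lambda * _ * _; set b := Num.sqrt (lambda * alpha) * _.
have q0 : 0 <= q by exact: sqrtr_ge0.
have a0 : 0 <= a by rewrite !mulr_ge0 ?sqrtr_ge0 ?expR_ge0.
have b0 : 0 <= b by rewrite !mulr_ge0 ?sqrtr_ge0 ?expR_ge0.
apply: (@le_trans _ _ (q * K * a + q * (r + 1) * b)); last first.
  have h1 : 0 <= q * (r + 1) * a by rewrite !mulr_ge0// addr_ge0.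
  have h2 : 0 <= q * K * b by rewrite !mulr_ge0.
  by rewrite -subr_ge0 (_ : _ - _ = q * (r + 1) * a + q * K * b) ?addr_ge0//; ring.
have r1 : 0 <= r + 1 by rewrite addr_ge0.
apply: le_sqrt_add; rewrite ?mulr_ge0//.
have qE : q ^+ 2 = M / C by rewrite sqr_sqrtr// divr_ge0// ltW.
set eA := expR (2 * lambda * (A ^+ 2 - c)) in H.
set eB := expR (2 * lambda * (B ^+ 2 - c)) in H.
have eA0 : 0 < eA by exact: expR_gt0.
have eB0 : 0 < eB by exact: expR_gt0.
have aE : a ^+ 2 = lambda * s * (eB / eA).
  rewrite /a !exprMn !sqr_sqrtr ?ltW//; congr (_ * _).
  by rewrite [LHS]expr2 -expRD /eA -expRN /eB -expRD; congr expR; ring.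
have bE : b ^+ 2 = lambda * alpha / eA.
  rewrite /b !exprMn !sqr_sqrtr ?mulr_ge0 ?ltW//; congr (_ * _).
  by rewrite [LHS]expr2 -expRD /eA -expRN; congr expR; ring.
have -> : (q * K * a) ^+ 2 + (q * (r + 1) * b) ^+ 2 =
  q ^+ 2 * K ^+ 2 * a ^+ 2 + q ^+ 2 * (r + 1) ^+ 2 * b ^+ 2 by ring.
rewrite qE aE bE.
have ss : s ^+ 2 <= s by rewrite expr2 ler_piMr// ltW.
have -> : M / C * K ^+ 2 * (lambda * s * (eB / eA)) + M / C * (r + 1) ^+ 2 * (lambda * alpha / eA) =
  (M * (eB * (K ^+ 2 * s) + alpha * (r + 1) ^+ 2)) / (C * (eA / lambda)).
  by field; rewrite !gt_eqF.
rewrite ler_pdivlMr ?mulr_gt0 ?invr_gt0// [y ^+ 2 * _]mulrC.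
apply: (le_trans H); rewrite ler_wpM2l// lerD2r ler_wpM2l ?(ltW eB0)// exprMn.
by rewrite ler_wpM2l// sqr_ge0.
Qed.

(** * The error term and the two estimates *)

Definition error c alpha lambda s : R :=
  Num.sqrt lambda * Num.sqrt s * expR (lambda * (B ^+ 2 - A ^+ 2))
  + Num.sqrt (lambda * alpha) * expR (- (lambda * (A ^+ 2 - c))).

(** The reconstruction error contains the noise level itself, through G - G'; it is absorbed because
    lambda >= 1 and B > A make the factors of sqrt s at least 1. *)
Lemma le_error c alpha lambda s : 1 <= lambda -> 0 < s < 1 -> s <= error c alpha lambda s.
Proof.
move=> l1 /andP[s0 s1]; have l0 : 0 <= lambda by apply: le_trans l1.
apply: (@le_trans _ _ (Num.sqrt s)).
  rewrite -[leLHS]ger0_norm ?(ltW s0)// -sqrtr_sqr ler_wsqrtr//.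
  by rewrite expr2 ler_piMr// ltW.
have b0 : 0 <= Num.sqrt (lambda * alpha) * expR (- (lambda * (A ^+ 2 - c))).
  by rewrite mulr_ge0 ?sqrtr_ge0 ?expR_ge0.
apply: (@le_trans _ _ (Num.sqrt lambda * Num.sqrt s * expR (lambda * (B ^+ 2 - A ^+ 2)))); last by rewrite lerDl.
have q1 : 1 <= Num.sqrt lambda by rewrite -[leLHS]sqrtr1 ler_wsqrtr.
have e1 : 1 <= expR (lambda * (B ^+ 2 - A ^+ 2)).
  rewrite -expR0 ler_expR mulr_ge0// subr_ge0 ler_sqr ?nnegrE; move: hA hAB; lra.
have q0 : 0 <= Num.sqrt s by exact: sqrtr_ge0.
rewrite mulrAC; apply: ler_peMl => //; rewrite -[leLHS]mulr1.
by apply: ler_pM.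
Qed.

Lemma normHk_lt_normH (E : tup) s : normHk Om m E < s -> forall i, normH Om m (E i) <= s.
Proof. by move=> Es i; apply: (le_trans (normH_le_normHk m E i)); exact: ltW. Qed.

(** The constant is fixed before c, lambda, the data and the noise level: it depends on them neither
    through the Sobolev constant nor through the convexity constant [C]. *)
Lemma H2_estimate r alpha C : 0 < r -> 0 < alpha -> 0 < C ->
  exists2 CH, 0 <= CH & forall c g0 g1 g0s g1s Vs G Gs s lambda Wmin,
  Bset A B D eps h g0s g1s r Vs ->
  (forall i, {ae mu, forall x, Om x -> Lop A B D eps h Vs i x = 0}) ->
  0 < s < 1 -> Bset A B D eps h g0 g1 r G -> Bset A B D eps h g0s g1s r Gs ->
  normHk Om m (G - Gs) < s -> 1 <= lambda ->
  strongly_convex A B D eps h c lambda alpha r C G ->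
  is_minimizer (Ifun A B D eps h c lambda alpha G) (B0bar A B D (2 * r)) Wmin ->
  normHk Om 2 (Wmin - (Vs - Gs)) <= CH * error c alpha lambda s.
Proof.
move=> r0 al0 C0; have [K K0 hK] := L2le_Lop_incr (ltW r0).
have mi20 : 0 <= mi2 by exact: sumr_ge0.
exists (Num.sqrt (mi2 * k.+1%:R / C) * (K + r + 1)).
  by rewrite mulr_ge0 ?sqrtr_ge0// !addr_ge0// ltW.
move=> c g0 g1 g0s g1s Vs G Gs s lambda Wmin hVs hL s01 hG hGs Gs_s l1 hcv hmin.
have hQ := B0bar_sub hVs hGs.
have := convexity_H2 C0 l1 (ltW al0) hcv hmin hQ.
have [mVs Vs_r _] := hVs; have [mG _ _] := hG; have [mGs _ _] := hGs.
have Vr i : normH Om m (Vs i) <= r by exact: ltW.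
have mE := memHkB mG mGs.
have Es := normHk_lt_normH Gs_s.
have /andP[s0 s1] := s01.
rewrite /Ifun (_ : Vs - Gs + G = Vs + (G - Gs)); last by rewrite -addrA [- Gs + G]addrC.
have hI := hK _ _ _ mVs Vr mE Es (ltW s1).
have l0 : 0 <= lambda by apply: le_trans l1.
have HJ := Jfun_le c l0 (ltW al0) (ltW r0) (ltW s1) mVs Vr mE Es hL hI.
move=> H; have {H} := le_trans H (ler_wpM2l mi20 HJ).
rewrite [leRHS]mulrA; apply: error_absorb => //; first exact: ltW.
exact: mulr_ge0.
Qed.

(** [L2le_recon] is applied at V' with increment (Wmin - Q) + (G - G'): the first part is measured
    by its H^2-norm, the second by the noise. The radius 3r covers the minimizer, at most 2r, plus
    G. *)
Lemma recon_estimate r : 0 < r -> exists2 K, 0 <= K &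
  forall (Vs G Gs Wmin : tup) s,
  memHk Om m Vs -> (forall i, normH Om m (Vs i) < r) ->
  memHk Om m G -> (forall i, normH Om m (G i) < r) -> memHk Om m Gs ->
  normHk Om m (G - Gs) < s -> B0bar A B D (2 * r) Wmin ->
  L2le Om (recon A B D eps h (Wmin + G) - recon A B D eps h Vs)
    (K * (normHk Om 2 (Wmin - (Vs - Gs)) + s)).
Proof.
move=> r0; have r30 : 0 <= 3 * r by rewrite mulr_ge0// ltW.
have aux (a b : R) : a <= 2 * r -> b < r -> a + b <= 3 * r by lra.
have r3 : r <= 3 * r by lra.
have [K K0 hK] := L2le_recon r30; exists K => //.
move=> Vs G Gs Wmin s mV Vr mG Gr mGs Es [mW0 Wr].
have mW : memHk Om m Wmin by move=> i; case: (mW0 i).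
have mE := memHkB mG mGs; have mQ := memHkB mV mGs; have mP := memHkB mW mQ.
(* Since Q = V' - G', the approximate solution Wmin + G differs from V' by the error of the
   minimizer plus the error in the data. *)
have EWG : Wmin + G = Vs + ((Wmin - (Vs - Gs)) + (G - Gs)).
  by rewrite opprB addrACA [Gs - Vs - Gs]addrAC subrr add0r [RHS]addrC subrK.
have WGr i : normH Om m ((Wmin + G) i) <= 3 * r.
  have := normH_lin OE 1 (mW i) (mG i); rewrite normr1 mul1r.
  rewrite (_ : (fun x => _) = (Wmin + G) i); last by apply/funext => x; rewrite mul1r.
  by move=> H; exact: le_trans H (aux _ _ (Wr i) (Gr i)).
rewrite EWG in WGr *.
move: (Wmin - (Vs - Gs)) (G - Gs) mP mE Es WGr => P E mP mE /normHk_lt_normH Es WGr.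
have mP2 i : memH Om 2 (P i) := memH_widen m2 (mP i).
have PE := wderivD_tuple mP mE.
have mPE := memHkD mP mE.
have nP q l i : (q <= 2)%N -> L2le Om (wderiv Om (nseq q l) (P i)) (normHk Om 2 P).
  move=> q2; split; first exact: memL2_wderiv (mP i) q2.
  apply: (@le_trans _ _ (normH Om 2 (P i))); last exact: normH_le_normHk.
  exact: normH_ge.
have T q l i : (q <= 2)%N ->
    {ae mu, forall x, Om x -> wderiv Om (nseq q l) (P i) x + wderiv Om (nseq q l) (E i) x =
       wderiv Om (nseq q l) ((P + E) i) x} ->
    L2le Om (wderiv Om (nseq q l) ((P + E) i)) (normHk Om 2 P + s).
  move=> q2 H; have h1 := nP q l i q2; have h2 := L2le_wderiv l (mE i) (Es i) q2.
  apply: L2le_ae H (L2leD mO h1 h2) => //.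
  by case: (memL2_wderiv l (mPE i) q2).
have Vr3 i : normH Om m (Vs i) <= 3 * r by exact: ltW (lt_le_trans (Vr i) r3).
apply: (hK _ _ _ mV mPE Vr3 WGr).
- move=> i; apply: (L2leD mO); last exact: L2le_self (mE i) (Es i).
  exact: L2le_self (mP2 i) (normH_le_normHk 2 P i).
- by move=> i l; apply: (T 1 l i isT); apply: filterS PE => x H Ox; rewrite (H Ox i l).1.
- by move=> i l; apply: (T 2 l i isT); apply: filterS PE => x H Ox; rewrite (H Ox i l).2.
Qed.

End Estimates.

Theorem theorem5p2 (R : realType) (n : nat) (A B D eps h0 : R)
  (hA : 0 < A) (hAB : A < B) (hD : 0 < D) (heps : 0 < eps)
  (hh0 : 0 < h0 < 1)
  (r alpha h : R) (k : nat)
  (hr : 0 < r) (halpha : 0 < alpha < 1) (hh : h0 <= h) (hk : (3 <= k)%N)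
  (lambda2 Ccvx : R) (hlambda2 : 1 <= lambda2) (hCcvx : 0 < Ccvx) :
  let Om := @Omega R n A B D in
  let m := mn n in
  exists2 C1 : R, 0 < C1 &
  forall c : R, 0 < c ->
  convexity_threshold n A B D eps k h c alpha r lambda2 Ccvx ->
  forall (g0 g1 g0s g1s : 'rV[R]_n.+1 -> R -> R)
    (Vs G Gs : 'I_k.+1 -> 'rV[R]_n.+1 -> R) (astar : 'rV[R]_n.+1 -> R)
    (sigma : R),
  Bset A B D eps h g0s g1s r Vs ->
  (forall i, {ae @lebesgue_row R n.+1,
     forall x, Om x -> Lop A B D eps h Vs i x = 0}) ->
  astar = recon A B D eps h Vs ->
  0 < sigma < 1 ->
  Bset A B D eps h g0 g1 r G ->
  Bset A B D eps h g0s g1s r Gs ->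
  normHk Om m (G - Gs) < sigma ->
  forall lambda, lambda2 <= lambda ->
  forall Wmin,
  is_minimizer (Ifun A B D eps h c lambda alpha G) (B0bar A B D (2 * r)) Wmin ->
  let acomp := recon A B D eps h (Wmin + G) in
  let err := C1 * Num.sqrt lambda * Num.sqrt sigma
                  * expR (lambda * (B ^+ 2 - A ^+ 2))
             + C1 * Num.sqrt (lambda * alpha) * expR (- (lambda * (A ^+ 2 - c))) in
  normHk Om 2 (Wmin - (Vs - Gs)) <= err /\
  memL2 Om (acomp - astar) /\ normL2 Om (acomp - astar) <= err.
Proof.
move=> Om m.
have h_gt0 : 0 < h by move: hh0 => /andP[? _]; exact: lt_le_trans hh.
have /andP[al0 al1] := halpha.
have [CH CH0 hCH] := H2_estimate n k hA hAB hD heps h_gt0 hr al0 hCcvx.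
have [K K0 hK] := recon_estimate n k hA hAB hD heps h_gt0 hr.
(* [CH] serves the first estimate; K (CH + 1) serves the second, where both the H^2-error and the
   noise level are at most multiples of the error term; the last 1 makes the constant positive. *)
exists (CH + K * (CH + 1) + 1); first by rewrite ltr_wpDl// addr_ge0 ?mulr_ge0 ?addr_ge0.
move=> c c0 hthr g0 g1 g0s g1s Vs G Gs astar s hVs hL -> s01 hG hGs Gs_s lambda hl Wmin hmin acomp err.
have l1 : 1 <= lambda by exact: le_trans hl.
have est := hCH _ _ _ _ _ _ _ _ _ _ _ hVs hL s01 hG hGs Gs_s l1 (hthr _ _ _ hG _ hl) hmin.
have [mV Vr _] := hVs; have [mG Gr _] := hG; have [mGs _ _] := hGs; have [hW _] := hmin.
have [mrec rec] := hK _ _ _ _ _ mV Vr mG Gr mGs Gs_s hW.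
have les := le_error hA hAB c alpha l1 s01.
have errE : err = (CH + K * (CH + 1) + 1) * error A B c alpha lambda s.
  by rewrite /err /error; ring.
have s0 : 0 <= s by case/andP: s01 => /ltW.
rewrite errE; move: est rec les; set e := error _ _ _ _ _ _ => est rec les.
have e0 : 0 <= e by exact: le_trans les.
split; last split.
- apply: (le_trans est); rewrite ler_wpM2r// -addrA lerDl.
  by rewrite addr_ge0 ?mulr_ge0 ?addr_ge0.
- exact: mrec.
- apply: (le_trans rec); apply: (@le_trans _ _ (K * (CH * e + e))).
    by rewrite ler_wpM2l// lerD.
  rewrite (_ : K * (CH * e + e) = K * (CH + 1) * e); last by ring.
  by rewrite ler_wpM2r// addrAC lerDr addr_ge0.
Qed.
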